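(* A function $g\in L_{\mathrm{exp}}$ belongs to the range space $T(L^\infty)\subseteq L_{\mathrm{exp}}$ if and only if it satisfies both $\check T(g)\in L^\infty$ and $\int_{-1}^1 \frac{g}{w}\,d\mu=0$. That is, $$T(L^\infty)=\Big\{g\in\mathrm{Ker}(\varphi_{1/w}):\check T(g)\in L^\infty\Big\}=\Big\{g\in\mathrm{Ker}(Q_{L_{\mathrm{exp}}}):\check T(g)\in L^\infty\Big\}.$$
   Context: All function spaces are over the interval $(-1,1)$ with Lebesgue measure $\mu$, functions are complex-valued and identified when equal a.e.; $L^0$ is the space of all measurable functions, $L^p=L^p(-1,1)$. Finite Hilbert transform: for $f\in L^1$, $T(f)(t):=\lim_{\varepsilon\to0^+}\frac1\pi\left(\int_{-1}^{t-\varepsilon}+\int_{t+\varepsilon}^1\right)\frac{f(x)}{x-t}\,dx$, which exists for a.e. $t\in(-1,1)$ and is measurable. $w(x):=\sqrt{1-x^2}$ for $x\in(-1,1)$. For $f\in L^1$ with $f/w\in L^1$, $\check T(f):=-w\,T(f/w)\in L^0$. $f^*\colon[0,2]\to[0,\infty]$ is the decreasing rearrangement of $f\in L^0$. The Zygmund space $L_{\mathrm{exp}}$ consists of all $f\in L^0$ with $\|f\|_{L_{\mathrm{exp}}}:=\sup_{0<t<2}\frac{\int_0^t f^*(s)\,ds}{t\log(2e/t)}<\infty$ (equivalently, $\int_{-1}^1 e^{\lambda|f|}\,d\mu<\infty$ for some $\lambda>0$). One has $L_{\mathrm{exp}}\subseteq L^p$ for all $1\le p<\infty$, and hence $g/w\in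 L^1$ for every $g\in L_{\mathrm{exp}}$. The operator $T$ maps $L^\infty$ boundedly into $L_{\mathrm{exp}}$. $\varphi_{1/w}\colon L_{\mathrm{exp}}\to\mathbb C$ is the continuous linear functional $\varphi_{1/w}(g):=\int_{-1}^1\frac gw\,d\mu$, and $Q_{L_{\mathrm{exp}}}\colon L_{\mathrm{exp}}\to L_{\mathrm{exp}}$ is given by $Q_{L_{\mathrm{exp}}}(g):=\left(\frac1\pi\int_{-1}^1\frac gw\,d\mu\right)\chi_{(-1,1)}$. *)

(* Defs.v *)
From HB Require Import structures.
From mathcomp Require Import all_boot all_order all_algebra.
From mathcomp Require Import complex.
From mathcomp Require Import all_classical all_reals all_analysis.
From mathcomp Require Import ess_sup_inf.

Set Implicit Arguments.
Unset Strict Implicit.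
Unset Printing Implicit Defensive.

Import Order.TTheory GRing.Theory Num.Theory.
Import numFieldNormedType.Exports.

Local Open Scope classical_set_scope.
Local Open Scope ring_scope.
Local Open Scope complex_scope.

(* Elements of L^0 are handled through Borel representatives R -> R[i], of
   which only the values on (-1,1) matter; the Borel representatives give the
   same classes as the Lebesgue measurable ones.  Operators such as T determine
   only the a.e. class of their values, hence [eq_ae] and [class_in] below. *)

Section FiniteHilbertTransform.
Context {R : realType}.

Local Notation mu := (@lebesgue_measure R).

Definition I11 : set R := `]-1, 1[.

Definition modulus (z : R[i]) : R := complex.Re `|z|.

Definition eq_ae (f g : R -> R[i]) : Prop := ae_eq mu I11 f g.

Definition L0 : set (R -> R[i]) :=
  [set f | measurable_fun I11 (fun x => complex.Re (f x)) /\
           measurable_fun I11 (fun x => complex.Im (f x))].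

Definition Linfty : set (R -> R[i]) :=
  [set f | L0 f /\ (ess_sup mu ((fun x => (modulus (f x))%:E) \_ I11) < +oo)%E].

Definition class_in (h : R -> R[i]) (X : set (R -> R[i])) : Prop :=
  exists2 k, X k & eq_ae h k.

Definition cintegral (D : set R) (f : R -> R[i]) : R[i] :=
  (\int[mu]_(x in D) complex.Re (f x)) +i* (\int[mu]_(x in D) complex.Im (f x)).

(* [lim] is total: it takes a default value at the points where the principal
   value does not exist, a null set when f is integrable. *)
Definition T (f : R -> R[i]) : R -> R[i] := fun t =>
  lim ((fun e : R =>
    (pi^-1)%:C * (cintegral `]-1, t - e[ (fun x => f x / (x - t)%:C)
                  + cintegral `]t + e, 1[ (fun x => f x / (x - t)%:C)) : R[i]^o)
    @ 0^'+).

Definition w (x : R) : R := Num.sqrt (1 - x ^+ 2).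

Definition divw (f : R -> R[i]) : R -> R[i] := fun x => f x / (w x)%:C.

Definition Tcheck (f : R -> R[i]) : R -> R[i] :=
  fun t => - ((w t)%:C * T (divw f) t).

Definition distribution_fun (f : R -> R[i]) (l : R) : \bar R :=
  mu (I11 `&` [set x | l < modulus (f x)]).

Definition rearrangement (f : R -> R[i]) (s : R) : \bar R :=
  ereal_inf [set l%:E | l in
    [set l : R | 0 <= l /\ (distribution_fun f l <= s%:E)%E]].

Definition norm_Lexp (f : R -> R[i]) : \bar R :=
  ereal_sup [set ((\int[mu]_(s in `]0%R, t[) rearrangement f s)
                  * ((t * ln (2 * expR 1 / t))^-1)%:E)%E | t in `]0, 2[].

Definition Lexp : set (R -> R[i]) :=
  [set f | L0 f /\ (norm_Lexp f < +oo)%E].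

(* The range of T on L^infty, as a set of (representatives of) classes. *)
Definition range_T : set (R -> R[i]) :=
  [set g | L0 g /\ exists2 f, Linfty f & eq_ae g (T f)].

Definition phi_invw (g : R -> R[i]) : R[i] := cintegral I11 (divw g).

Definition Q_Lexp (g : R -> R[i]) : R -> R[i] :=
  fun x => (pi^-1)%:C * phi_invw g * \1_I11 x.

Definition Ker_phi : set (R -> R[i]) :=
  [set g | Lexp g /\ phi_invw g = 0].

Definition Ker_Q : set (R -> R[i]) :=
  [set g | Lexp g /\ eq_ae (Q_Lexp g) (fun=> 0)].

End FiniteHilbertTransform.

(* Main.v *)
(* Substituting x = cos s turns T into the conjugation of Fourier series on
   [0, pi]: for f bounded, T f = G says that the n-th cosine coefficient of G is
   minus the n-th sine coefficient of f for every n (so the mean of G, that is the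
   integral of G / w, vanishes), and for g / w of mean zero Tcheck g = f expresses
   the same relation between f and G = g. Riesz-Fischer in L^2(dx / w) provides the
   partner of a given function, and Abel summation identifies it almost everywhere
   with the principal value: at Lebesgue points the Poisson-regularised kernel of
   1 / (x - t) may be replaced by the truncated one. Thus T (Tcheck g) = g and
   Tcheck (T f) = f.

   For |f| <= 1 the Poisson extensions A of G and B of - f are the real and
   imaginary parts of an analytic function of zero mean with |B| <= 1. Hence
   Re (A + iB)^(2k) has mean zero, which bounds the 2k-th moment of A by the lower
   even ones; by induction it is at most pi (2k)!, and this growth of moments is
   exponential integrability. Conversely functions in Lexp are in L^6, hence
   square integrable against dx / w. *)

Require Import Defs.
From HB Require Import structures.
From mathcomp Require Import all_boot all_order all_algebra.
From mathcomp Require Import complex.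
From mathcomp Require Import all_classical all_reals all_analysis.
From mathcomp Require Import measurable_realfun ess_sup_inf.
From mathcomp Require Import ring lra.

Import Order.TTheory GRing.Theory Num.Theory.
Import numFieldNormedType.Exports.

Set Implicit Arguments.
Unset Strict Implicit.
Unset Printing Implicit Defensive.

Local Open Scope classical_set_scope.
Local Open Scope ring_scope.

(** * Integrals of derivatives on open intervals *)

Section FTC.
Context {R : realType}.
Local Notation mu := (@lebesgue_measure R).
Implicit Types (f F : R -> R) (a b M : R).

(** With [b = sinh y] all kernels are rational in [x], [t], [b] and [aa b] up to factors [w], so
    every estimate is algebra on the denominator [Dk]. For fixed [b] the Abel sums converge
    uniformly, hence sum and integral may be exchanged for any integrable function; only the limit
    [b -> 0] needs Lebesgue points.

    At such a point the difference of the regularised and the truncated kernel, both at scale [b],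
    is dominated by [b / (b^2 + (x - t)^2)]. Its mass does not tend to 0, so domination disposes of
    [h - h t] but not of the constant [h t]. The constant is treated apart: by integrals in closed
    form when [Vk] meets the truncated kernel, by an additional factor [b] when [Wk] meets [Vk].

    The constants of the moment bound: [pi] is the mass of [dx / w], and [(2k)!] reproduces itself
    because the binomial coefficient times [(2q)!] is [(2k)! / (2k - 2q)!], where the last factorial
    is at least [2^(k - q)].

    The sixth power occurs because [1 / w] is not square integrable near the endpoints, so fourth
    moments do not control the integral of [h^2 / w]; but [w^(-3/2)] is integrable, and exponents 3
    and 3/2 pair [h^2] with [1 / w]. *)

Lemma integral_is_derive f F a b : a < b ->
  (forall x, a <= x <= b -> is_derive x 1 F (f x)) ->
  (forall x, a <= x <= b -> {for x, continuous f}) ->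
  (\int[mu]_(x in `[a, b]) (f x)%:E = (F b)%:E - (F a)%:E)%E.
Proof.
move=> ab dF cf.
have cF x : a <= x <= b -> {for x, continuous F}.
  move=> xab; have dFx := dF x xab.
  apply/differentiable_continuous/derivable1_diffP; exact: (@ex_derive _ _ _ _ _ _ _ dFx).
apply: continuous_FTC2 => //.
- apply: continuous_in_subspaceT => x; rewrite inE/= in_itv/=.
  exact: cf.
- split.
  + move=> x; rewrite in_itv/= => /andP[ax xb].
    have dFx : is_derive x 1 F (f x) by apply: dF; rewrite !ltW.
    exact: (@ex_derive _ _ _ _ _ _ _ dFx).
  + by apply: cvg_at_right_filter; apply: cF; rewrite lexx ltW.
  + by apply: cvg_at_left_filter; apply: cF; rewrite lexx ltW.
- move=> x; rewrite in_itv/= => /andP[ax xb].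
  have dFx : is_derive x 1 F (f x) by apply: dF; rewrite !ltW.
  by rewrite derive1E (@derive_val _ _ _ _ _ _ _ dFx).
Qed.

Lemma itvoo_bigcup_cc a b (u v : nat -> R) :
  (forall n, a < u n) -> (forall n, v n < b) ->
  u @ \oo --> a -> v @ \oo --> b ->
  `]a, b[%classic = \bigcup_n `[u n, v n]%classic :> set R.
Proof.
move=> au vb ua vb'; apply/seteqP; split => x /=; last first.
  by move=> [n _] /=; rewrite !in_itv/= => /andP[ux xv];
    rewrite (lt_le_trans (au n))//= (le_lt_trans xv).
rewrite in_itv/= => /andP[ax xb].
have [N _ HN] : \forall n \near \oo, u n <= x /\ x <= v n.
  near=> n; split.
    near: n; apply: (cvgr_le a) => //.
  near: n; apply: (cvgr_ge b) => //.
by exists N => //=; rewrite in_itv/=; apply/andP/HN => /=.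
Unshelve. all: by end_near. Qed.

(** Monotone convergence along an exhaustion by closed intervals: singular endpoints are allowed, at
    the price of nonnegativity. The exhaustion is a parameter so that later it can consist of points
    where [acos] has an exact value. *)
Lemma integral_oo_is_derive_cvg f F a b (u v : nat -> R) :
  (forall n, a < u n < b) -> (forall n, a < v n < b) ->
  (forall n, u n < v n) ->
  {homo u : m n / (m <= n)%N >-> n <= m} -> {homo v : m n / (m <= n)%N >-> m <= n} ->
  u @ \oo --> a -> v @ \oo --> b ->
  (forall x, a < x < b -> 0 <= f x) ->
  (forall x, a < x < b -> is_derive x 1 F (f x)) ->
  (forall x, a < x < b -> {for x, continuous f}) ->
  (F (v n) - F (u n))%:E @[n --> \oo] --> (\int[mu]_(x in `]a, b[) (f x)%:E)%E.
Proof.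
move=> uI vI uv uni vnd ua vb f0 dF cf.
have inab n (x : R) : u n <= x <= v n -> a < x < b.
  move=> /andP[h1 h2]; have /andP[h3 _] := uI n; have /andP[_ h4] := vI n.
  by rewrite (lt_le_trans h3)//= (le_lt_trans h2).
have Hoo : `]a, b[%classic = \bigcup_n `[u n, v n]%classic :> set R.
  by apply: itvoo_bigcup_cc => // n; [have /andP[] := uI n|have /andP[] := vI n].
pose E n : set (measurableTypeR R) := `[u n, v n]%classic.
have mf n : measurable_fun `[u n, v n] (EFin \o f).
  apply/measurable_EFinP; apply: subspace_continuous_measurable_fun => //.
  apply: continuous_in_subspaceT => x; rewrite inE/= in_itv/= => /inab.
  exact: cf.
have nE : nondecreasing_seq E.
  move=> m n mn; rewrite subsetEset => x; rewrite /E /= !in_itv/=.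
  by move=> /andP[h1 h2]; rewrite (le_trans _ h1) ?uni//= (le_trans h2)// vnd.
have fE i x : E i x -> (0 <= (EFin \o f) x)%E.
  by rewrite /E /= in_itv/= => /inab xab; rewrite lee_fin f0.
have mE i : measurable (E i) by exact: measurable_itv.
have H := ge0_nondecreasing_set_cvg_integral (mu := mu) nE mE mf fE.
rewrite Hoo; apply: (cvg_trans _ H); apply: near_eq_cvg; apply: nearW => n.
have dFn x : u n <= x <= v n -> is_derive x 1 F (f x) by move=> /inab; exact: dF.
have cfn x : u n <= x <= v n -> {for x, continuous f} by move=> /inab; exact: cf.
by rewrite [LHS](integral_is_derive (uv n) dFn cfn).
Qed.

(** Increments of [F] are at most [2 * M]. The integrals of [1 / w], of [w^(-3/2)] and of a
    logarithm are bounded in this way. *)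
Lemma integral_oo_is_derive_le f F a b M : a < b ->
  (forall x, a < x < b -> 0 <= f x) ->
  (forall x, a < x < b -> is_derive x 1 F (f x)) ->
  (forall x, a < x < b -> {for x, continuous f}) ->
  (forall x, a < x < b -> `|F x| <= M) ->
  (\int[mu]_(x in `]a, b[) (f x)%:E <= (2 * M)%:E)%E.
Proof.
move=> ab f0 dF cf FM.
(* Dividing by [n.+2] keeps [e n] strictly below half the length from [n = 0] on, so that the closed
   intervals are never degenerate. *)
pose e (n : nat) : R := (b - a) / 2 / n.+2%:R.
have ba2 : 0 < (b - a) / 2 by rewrite divr_gt0// subr_gt0.
have e0 n : 0 < e n by rewrite /e divr_gt0.
have e1 n : e n < (b - a) / 2.
  by rewrite /e ltr_pdivrMr// ltr_pMr// ltr1n.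
have ecv : e @ \oo --> 0.
  rewrite -(mulr0 ((b - a) / 2)); apply: cvgM; first exact: cvg_cst.
  have := @cvg_harmonic R; rewrite -(cvg_shiftn 1).
  by under eq_fun do rewrite /= addn1.
have e_nincr m n : (m <= n)%N -> e n <= e m.
  by move=> mn; rewrite /e ler_pM2l// lef_pV2 ?posrE// ler_nat.
have uI n : a < a + e n < b by have := e0 n; have := e1 n; move=> *; apply/andP; split; lra.
have vI n : a < b - e n < b by have := e0 n; have := e1 n; move=> *; apply/andP; split; lra.
have uv n : a + e n < b - e n by have := e1 n; lra.
have uni : {homo (fun n => a + e n) : m n / (m <= n)%N >-> n <= m}.
  by move=> m n mn; rewrite lerD2l e_nincr.
have vnd : {homo (fun n => b - e n) : m n / (m <= n)%N >-> m <= n}.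
  by move=> m n mn; rewrite lerD2l lerN2 e_nincr.
have ua : a + e n @[n --> \oo] --> a.
  by rewrite -[X in _ --> X]addr0; apply: cvgD => //; exact: cvg_cst.
have vb : b - e n @[n --> \oo] --> b.
  by rewrite -[X in _ --> X]subr0; apply: cvgB => //; exact: cvg_cst.
have H := integral_oo_is_derive_cvg uI vI uv uni vnd ua vb f0 dF cf.
rewrite -(cvg_lim _ H)//; apply: lime_le; first exact: cvgP H.
apply: nearW => n; rewrite lee_fin.
have := FM _ (uI n); have := FM _ (vI n).
by move=> /ler_normlP[_ h1] /ler_normlP[h2 _]; lra.
Qed.

End FTC.

(** * The weight 1/w *)

Section Weight.
Context {R : realType}.
Local Notation mu := (@lebesgue_measure R).
Local Notation I := (@I11 R).
Implicit Types (h k f g : R -> R) (x c M : R).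

Lemma I11E x : I x <-> -1 < x < 1.
Proof. by rewrite /I11 /= in_itv/=. Qed.

Lemma measurable_I11 : measurable I.
Proof. exact: measurable_itv. Qed.
Hint Resolve measurable_I11 : core.

Lemma I11_sqr x : I x -> 0 < 1 - x ^+ 2.
Proof. move=> /I11E/andP[h1 h2]; nra. Qed.

Lemma w_gt0 x : I x -> 0 < w x.
Proof. by move=> Ix; rewrite /w sqrtr_gt0 I11_sqr. Qed.

Lemma w_neq0 x : I x -> w x != 0.
Proof. by move=> /w_gt0/gt_eqF->. Qed.

Lemma w_ge0 x : 0 <= w x.
Proof. exact: sqrtr_ge0. Qed.

Lemma w_sqr x : I x -> w x ^+ 2 = 1 - x ^+ 2.
Proof. by move=> Ix; rewrite /w sqr_sqrtr// ltW// I11_sqr. Qed.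

Lemma w_le1 x : I x -> w x <= 1.
Proof.
move=> Ix; rewrite -(@ler_pXn2r _ 2)// ?nnegrE ?w_ge0// w_sqr// expr1n gerBl.
exact: sqr_ge0.
Qed.

Lemma continuous_w : continuous (@w R).
Proof.
move=> x; rewrite /w; apply: (@continuous_comp _ _ _ (fun x => 1 - x ^+ 2) Num.sqrt).
  by apply: cvgB; [exact: cvg_cst | exact: exprn_continuous].
exact: sqrt_continuous.
Qed.

Lemma measurable_w D : measurable_fun D (@w R).
Proof.
apply: measurable_funTS; apply: continuous_measurable_fun; exact: continuous_w.
Qed.

Lemma measurable_invw : measurable_fun I (fun x => (w x)^-1).
Proof.
apply: open_continuous_measurable_fun; first exact: interval_open.
by move=> x /set_mem Ix; apply: continuousV; [exact: w_neq0 | exact: continuous_w].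
Qed.

Definition wint h := mu.-integrable I (EFin \o (fun x => h x / w x)).
(* Under x = cos s this is the integral of h (cos s) over [0, pi]. *)
Definition J h : R := \int[mu]_(x in I) (h x / w x).

Lemma wint_measurable h : wint h -> measurable_fun I h.
Proof.
move=> /(measurable_int mu)/measurable_EFinP mh.
apply: (@eq_measurable_fun _ _ _ _ _ (fun x => h x / w x * w x)).
  by move=> x /set_mem Ix; rewrite divfK// w_neq0.
by apply: measurable_funM => //; exact: measurable_w.
Qed.

Lemma measurable_divw h : measurable_fun I h -> measurable_fun I (fun x => h x / w x).
Proof. by move=> mh; apply: measurable_funM => //; exact: measurable_invw. Qed.

Lemma eq_wint h k : {in I, h =1 k} -> wint h -> wint k.
Proof. by move=> hk; apply: eq_integrable => // x Ix /=; rewrite hk. Qed.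

Lemma eq_J h k : {in I, h =1 k} -> J h = J k.
Proof. by move=> hk; apply: eq_Rintegral => x Ix; rewrite hk. Qed.

Lemma wint_le h k : measurable_fun I h -> (forall x, I x -> `|h x| <= `|k x|) ->
  wint k -> wint h.
Proof.
move=> mh hk; apply: le_integrable => //.
  by apply/measurable_EFinP; exact: measurable_divw.
move=> x Ix /=; rewrite lee_fin !normrM ler_pM//; exact: hk.
Qed.

Lemma wintD h k : wint h -> wint k -> wint (fun x => h x + k x).
Proof.
move=> ih ik; apply: (@eq_integrable _ _ _ _ _ _ _ _ _ (integrableD _ ih ik)) => //.
by move=> x _ /=; rewrite mulrDl EFinD.
Qed.

Lemma wintZ c h : wint h -> wint (fun x => c * h x).
Proof.
move=> ih; apply: (@eq_integrable _ _ _ _ _ _ _ _ _ (integrableZl _ c ih)) => //.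
by move=> x _ /=; rewrite -EFinM mulrA.
Qed.

Lemma wintB h k : wint h -> wint k -> wint (fun x => h x - k x).
Proof.
move=> ih ik; apply: eq_wint (wintD ih (wintZ (-1) ik)) => x _.
by rewrite mulN1r.
Qed.

Lemma wint_norm h : wint h -> wint (fun x => `|h x|).
Proof.
move=> ih; apply: (wint_le _ _ ih); last by move=> x _; rewrite normr_id.
apply: measurableT_comp => //; exact: wint_measurable ih.
Qed.

Lemma wint0 : wint (fun=> 0).
Proof. by apply: eq_integrable (integrable0 _ _) => // x _ /=; rewrite mul0r. Qed.

Lemma wint_sum (T : Type) (s : seq T) (P : pred T) (F : T -> R -> R) :
  (forall i, P i -> wint (F i)) -> wint (fun x => \sum_(i <- s | P i) F i x).
Proof.
move=> iF; elim: s => [|i s IH]; first by apply: eq_wint wint0 => x _; rewrite big_nil.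
have [Pi|Pi] := boolP (P i).
  by apply: eq_wint (wintD (iF i Pi) IH) => x _; rewrite big_cons Pi.
by apply: eq_wint IH => x _; rewrite big_cons (negbTE Pi).
Qed.

Lemma JD h k : wint h -> wint k -> J (fun x => h x + k x) = J h + J k.
Proof.
by move=> ih ik; rewrite /J -RintegralD//; apply: eq_Rintegral => x _; rewrite mulrDl.
Qed.

Lemma JZ c h : wint h -> J (fun x => c * h x) = c * J h.
Proof.
by move=> ih; rewrite /J -RintegralZl//; apply: eq_Rintegral => x _; rewrite mulrA.
Qed.

Lemma JB h k : wint h -> wint k -> J (fun x => h x - k x) = J h - J k.
Proof.
by move=> ih ik; rewrite /J -RintegralB//; apply: eq_Rintegral => x _; rewrite mulrBl.
Qed.

Lemma J0 : J (fun=> 0) = 0.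
Proof. by rewrite -[RHS](mul0r (J (fun=> 0))) -JZ ?mul0r//; exact: wint0. Qed.

Lemma J_sum (T : Type) (s : seq T) (P : pred T) (F : T -> R -> R) :
  (forall i, P i -> wint (F i)) ->
  J (fun x => \sum_(i <- s | P i) F i x) = \sum_(i <- s | P i) J (F i).
Proof.
move=> iF; elim: s => [|i s IH].
  by rewrite big_nil -[RHS]J0; apply: eq_J => x _; rewrite big_nil.
have [Pi|Pi] := boolP (P i).
  rewrite big_cons Pi -IH -JD; [|exact: iF|exact: wint_sum].
  by apply: eq_J => x _; rewrite big_cons Pi.
by rewrite big_cons (negbTE Pi) -IH; apply: eq_J => x _; rewrite big_cons (negbTE Pi).
Qed.

Lemma J_ge0 h : (forall x, I x -> 0 <= h x) -> 0 <= J h.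
Proof. by move=> h0; apply: Rintegral_ge0 => x Ix; rewrite divr_ge0 ?h0 ?w_ge0. Qed.

Lemma le_J h k : wint h -> wint k -> (forall x, I x -> h x <= k x) -> J h <= J k.
Proof.
move=> ih ik hk; apply: le_Rintegral => // x Ix.
by rewrite ler_wpM2r ?invr_ge0 ?w_ge0// hk.
Qed.

Lemma le_normr_J h : wint h -> `|J h| <= J (fun x => `|h x|).
Proof.
move=> ih; apply: (le_trans (le_normr_Rintegral _ ih)) => //.
rewrite le_eqVlt; apply/orP; left; apply/eqP/eq_Rintegral => x _.
by rewrite normrM normfV (ger0_norm (w_ge0 x)).
Qed.

Lemma integral_wE h : wint h -> (\int[mu]_(x in I) (h x / w x)%:E)%E = (J h)%:E.
Proof. by move=> ih; rewrite /J /Rintegral fineK//; exact: integrable_fin_num. Qed.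

(** The antiderivative [- acos] of [1 / w] is bounded by [pi]. *)
Lemma wint1 : wint (fun=> 1).
Proof.
apply/integrableP; split.
  by apply/measurable_EFinP; apply: measurable_divw; exact: measurable_cst.
apply: (@le_lt_trans _ _ (2 * pi)%:E); last exact: ltry.
have -> : (\int[mu]_(x in I) `|(EFin \o (fun x => 1 / w x)%R) x| =
    \int[mu]_(x in `](-1)%R, 1%R[) ((w x)^-1)%:E)%E.
  by apply: eq_integral => x _ /=; rewrite mul1r ger0_norm// invr_ge0 w_ge0.
apply: (@integral_oo_is_derive_le _ _ (fun x => - acos x)) => //.
- by move=> x _; rewrite invr_ge0 w_ge0.
- move=> x x1; rewrite -[(w x)^-1]opprK.
  have h : is_derive x 1 (@acos R) (- (w x)^-1) by exact: (is_derive1_acos x1).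
  exact: (is_deriveN h).
- by move=> x /I11E Ix; apply: continuousV; [exact: w_neq0 | exact: continuous_w].
- move=> x /andP[/ltW h1 /ltW h2]; rewrite normrN ger0_norm ?acos_ge0 ?acos_lepi//;
  exact/andP.
Qed.

Lemma wint_bounded h M : measurable_fun I h -> (forall x, I x -> `|h x| <= M) -> wint h.
Proof.
move=> mh hM; apply: (wint_le mh _ (wintZ M wint1)) => x Ix.
by rewrite mulr1 (le_trans (hM x Ix))// ler_norm.
Qed.

Lemma wintMl h k M : measurable_fun I h -> (forall x, I x -> `|h x| <= M) ->
  wint k -> wint (fun x => h x * k x).
Proof.
move=> mh hM ik; apply: (wint_le _ _ (wintZ M ik)).
  by apply: measurable_funM => //; exact: wint_measurable ik.
by move=> x Ix; rewrite !normrM; apply: ler_wpM2r => //; rewrite (le_trans (hM x Ix))// ler_norm.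
Qed.

Lemma wint_mul h k : measurable_fun I h -> measurable_fun I k ->
  wint (fun x => h x ^+ 2) -> wint (fun x => k x ^+ 2) -> wint (fun x => h x * k x).
Proof.
move=> mh mk ih ik; apply: (wint_le _ _ (wintD ih ik)); first exact: measurable_funM.
move=> x Ix; rewrite (@ger0_norm _ (_ + _)) ?addr_ge0 ?sqr_ge0//.
by rewrite ler_norml; apply/andP; split; nra.
Qed.

Lemma wint_sqr h : measurable_fun I h -> wint (fun x => h x ^+ 2) -> wint h.
Proof.
move=> mh ih; apply: eq_wint (wint_mul (k := fun=> 1) mh _ ih _) => //.
- by move=> x _; rewrite mulr1.
- by apply: eq_wint wint1 => x _; rewrite expr1n.
Qed.

Lemma wint_sqrD h k : measurable_fun I h -> measurable_fun I k ->
  wint (fun x => h x ^+ 2) -> wint (fun x => k x ^+ 2) -> wint (fun x => (h x + k x) ^+ 2).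
Proof.
move=> mh mk ih ik; apply: eq_wint (wintD (wintD ih ik) (wintZ 2 (wint_mul mh mk ih ik))).
by move=> x _; ring.
Qed.

End Weight.
#[global] Hint Extern 0 (measurable I11) => solve [exact: measurable_I11] : core.

(** * Chebyshev functions *)

Section Chebyshev.
Context {R : realType}.
Local Notation mu := (@lebesgue_measure R).
Local Notation I := (@I11 R).
Implicit Types (h k f g : R -> R) (x c M : R) (n m : nat).

Definition Cn n x : R := cos (n%:R * acos x).
Definition Sn n x : R := sin (n%:R * acos x).

Lemma measurable_acos : measurable_fun I (@acos R).
Proof.
apply: open_continuous_measurable_fun; first exact: interval_open.
by move=> x /set_mem/I11E Ix; exact: continuous_acos.
Qed.

Lemma measurable_Cn n : measurable_fun I (Cn n).
Proof.
apply: measurableT_comp; first exact: (continuous_measurable_fun (@continuous_cos R)).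
by apply: measurable_funM => //; exact: measurable_acos.
Qed.

Lemma measurable_Sn n : measurable_fun I (Sn n).
Proof.
apply: measurableT_comp; first exact: (continuous_measurable_fun (@continuous_sin R)).
by apply: measurable_funM => //; exact: measurable_acos.
Qed.

Lemma Cn_le1 n x : `|Cn n x| <= 1.
Proof. by rewrite ler_norml cos_geN1 cos_le1. Qed.

Lemma Sn_le1 n x : `|Sn n x| <= 1.
Proof. by rewrite ler_norml sin_geN1 sin_le1. Qed.

Lemma Cn0 x : Cn 0 x = 1. Proof. by rewrite /Cn mul0r cos0. Qed.
Lemma Sn0 x : Sn 0 x = 0. Proof. by rewrite /Sn mul0r sin0. Qed.

Lemma CnD n m x : Cn (n + m) x = Cn n x * Cn m x - Sn n x * Sn m x.
Proof. by rewrite /Cn natrD mulrDl cosD. Qed.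

Lemma SnD n m x : Sn (n + m) x = Sn n x * Cn m x + Cn n x * Sn m x.
Proof. by rewrite /Sn natrD mulrDl sinD. Qed.

Lemma CnB n m x : (m <= n)%N -> Cn (n - m) x = Cn n x * Cn m x + Sn n x * Sn m x.
Proof. by move=> mn; rewrite /Cn natrB// mulrBl cosB. Qed.

Lemma wint_Cn n : wint (Cn n).
Proof. by apply: (@wint_bounded _ _ 1); [exact: measurable_Cn|move=> x _; exact: Cn_le1]. Qed.

(** The exhausting intervals end at [cos (1/(n+2))] and its opposite, where [acos] takes the values
    [1/(n+2)] and [pi - 1/(n+2)]. For an [F] that is a continuous function of [acos] the limit is
    then given by [cvg_acos_endpoints]. *)
Lemma J_antiderivative h (F : R -> R) L :
  wint h -> (forall x, I x -> 0 <= h x) ->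
  (forall x, I x -> {for x, continuous h}) ->
  (forall x, I x -> is_derive x 1 F (h x / w x)) ->
  F (cos n.+2%:R^-1) - F (- cos n.+2%:R^-1) @[n --> \oo] --> L -> J h = L.
Proof.
move=> ih h0 ch dF FL.
pose d n : R := n.+2%:R^-1.
have d0 n : 0 < d n by rewrite /d invr_gt0.
have d1 n : d n < 1 by rewrite /d invf_lt1// ltr1n.
have pi2 := @pi_ge2 R.
have din n : d n \in `[0, pi]%R.
  by rewrite in_itv/= ltW//= (le_trans (ltW (d1 n)))//; lra.
have cd n : 0 < cos (d n) by apply: cos_gt0_pihalf; have := d1 n; have := d0 n; move=> *; apply/andP; split; lra.
have cd1 n : cos (d n) < 1.
  by rewrite -cos0 ltr_cos ?d0// in_itv/= lexx ltW ?pi_gt0.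
have vI n : -1 < cos (d n) < 1 by rewrite cd1 andbT; have := cd n; lra.
have uI n : -1 < - cos (d n) < 1.
  by have := cd n; have := cd1 n; move=> *; apply/andP; split; lra.
have uv n : - cos (d n) < cos (d n) by have := cd n; lra.
have vnd : {homo (fun n => cos (d n)) : m n / (m <= n)%N >-> m <= n}.
  move=> m n mn; by rewrite leNgt ltr_cos// -leNgt lef_pV2 ?posrE// ler_nat !ltnS.
have uni : {homo (fun n => - cos (d n)) : m n / (m <= n)%N >-> n <= m}.
  by move=> m n mn; rewrite lerN2 vnd.
have vb : cos (d n) @[n --> \oo] --> (1 : R).
  rewrite -cos0; apply: continuous_cvg; first exact: continuous_cos.
  have := @cvg_harmonic R; rewrite -(cvg_shiftn 1).
  by under eq_fun do rewrite /= addn1.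
have ua : - cos (d n) @[n --> \oo] --> (-1 : R) by exact: cvgN.
have H := @integral_oo_is_derive_cvg _ (fun x => h x / w x) F _ _ _ _ uI vI uv uni vnd ua vb.
have f0 x : -1 < x < 1 -> 0 <= h x / w x.
  by move=> /I11E Ix; rewrite divr_ge0 ?w_ge0 ?h0.
have dF' x : -1 < x < 1 -> is_derive x 1 F (h x / w x).
  by move=> /I11E; exact: dF.
have cf x : -1 < x < 1 -> {for x, continuous (fun x => h x / w x)}.
  move=> /I11E Ix; apply: continuousM; first exact: ch.
  by apply: continuousV; [exact: w_neq0 | exact: continuous_w].
have {}H := H f0 dF' cf.
apply: EFin_inj; rewrite -integral_wE//; apply/esym.
have HL : (F (cos (d n)) - F (- cos (d n)))%:E @[n --> \oo] --> L%:E.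
  by apply: cvg_EFin => //; exact: nearW.
by rewrite -(cvg_lim _ HL)//; apply: cvg_lim H.
Qed.

Lemma sin_natpi n : sin (n%:R * pi) = 0 :> R.
Proof.
elim: n => [|n IH]; first by rewrite mul0r sin0.
by rewrite -addn1 natrD mulrDl mul1r sinDpi IH oppr0.
Qed.

Lemma cvg_acos_endpoints (G : R -> R) : continuous G ->
  G (acos (cos n.+2%:R^-1)) - G (acos (- cos n.+2%:R^-1)) @[n --> \oo] --> G 0 - G pi.
Proof.
move=> cG.
have d0 : n.+2%:R^-1 @[n --> \oo] --> (0 : R).
  have := @cvg_harmonic R; rewrite -(cvg_shiftn 1).
  by under eq_fun do rewrite /= addn1.
have pi2 := @pi_ge2 R.
have din n : 0 <= (n.+2%:R^-1 : R) <= pi.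
  rewrite invr_ge0 ler0n/=; have : (n.+2%:R^-1 : R) <= 1 by rewrite invf_le1// ler1n.
  by move=> h; rewrite (le_trans h)//; lra.
have E n : G (acos (cos n.+2%:R^-1)) - G (acos (- cos n.+2%:R^-1)) =
    G n.+2%:R^-1 - G (pi - n.+2%:R^-1).
  by rewrite acosN ?cos_geN1 ?cos_le1// cosK// in_itv/=.
rewrite (eq_cvg _ _ E).
apply: cvgB; first by apply: continuous_cvg => //; exact: cG.
rewrite -[X in _ --> G X]subr0; apply: continuous_cvg; first exact: cG.
by apply: cvgB => //; exact: cvg_cst.
Qed.

Lemma J1 : J (fun=> 1 : R) = pi.
Proof.
apply: (@J_antiderivative _ (fun x => - acos x)).
- exact: wint1.
- by [].
- by move=> x _; exact: cvg_cst.
- move=> x /I11E Ix; rewrite mul1r -[(w x)^-1]opprK.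
  have h : is_derive x 1 (@acos R) (- (w x)^-1) by exact: (is_derive1_acos Ix).
  exact: (is_deriveN h).
- have -> : (pi : R) = - 0 - - pi by rewrite opprK oppr0 add0r.
  by apply: (@cvg_acos_endpoints -%R) => x; exact: opp_continuous.
Qed.

Lemma continuous_Cn n x : I x -> {for x, continuous (Cn n)}.
Proof.
move=> /I11E Ix; apply: (@continuous_comp _ _ _ (fun x => n%:R * acos x) cos).
  by apply: continuousM; [exact: cvg_cst|exact: continuous_acos].
exact: continuous_cos.
Qed.

Lemma J_Cn n : (0 < n)%N -> J (Cn n) = 0.
Proof.
move=> n0.
(* Adding 1 makes the integrand nonnegative, as [J_antiderivative] demands. *)
suff : J (fun x => 1 + Cn n x) = pi.
  rewrite JD ?J1//; [lra|exact: wint1|exact: wint_Cn].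
have n0' : n%:R != 0 :> R by rewrite pnatr_eq0 -lt0n.
apply: (@J_antiderivative _ (fun x => - acos x - n%:R^-1 * Sn n x)).
- by apply: wintD; [exact: wint1|exact: wint_Cn].
- by move=> x _; have := Cn_le1 n x; rewrite ler_norml; lra.
- by move=> x Ix; apply: cvgD; [exact: cvg_cst|exact: continuous_Cn].
- move=> x Ix.
  have h : is_derive x 1 (@acos R) (- (w x)^-1) by exact: (is_derive1_acos ((I11E x).1 Ix)).
  apply: is_derive_eq; rewrite /Cn /= /GRing.scale /=.
  have := w_neq0 Ix; move: (w x) => u u0; field; exact/andP.
- have -> : (pi : R) = (- 0 - n%:R^-1 * sin (n%:R * 0)) - (- pi - n%:R^-1 * sin (n%:R * pi)).
    by rewrite sin_natpi mulr0 sin0; ring.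
  apply: (@cvg_acos_endpoints (fun t => - t - n%:R^-1 * sin (n%:R * t))) => x.
  apply: cvgB; first exact: opp_continuous.
  apply: cvgM; first exact: cvg_cst.
  apply: continuous_cvg; first exact: continuous_sin.
  by apply: cvgM; [exact: cvg_cst|exact: cvg_id].
Qed.

Lemma J_CnCn n m : (m < n)%N -> J (fun x => Cn n x * Cn m x) = 0.
Proof.
move=> mn; have mn' := ltnW mn.
rewrite (_ : (fun x => _) = (fun x => 2^-1 * (Cn (n + m) x + Cn (n - m) x))); last first.
  by apply/funext => x; rewrite CnD CnB//; field.
have h1 := wint_Cn (n + m); have h2 := wint_Cn (n - m).
rewrite JZ ?JD// ?J_Cn ?subn_gt0 ?addr0 ?mulr0//; last exact: wintD.
by rewrite addn_gt0 (leq_ltn_trans _ mn).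
Qed.

Lemma J_SnSn n m : (m < n)%N -> J (fun x => Sn n x * Sn m x) = 0.
Proof.
move=> mn; have mn' := ltnW mn.
rewrite (_ : (fun x => _) = (fun x => 2^-1 * (Cn (n - m) x - Cn (n + m) x))); last first.
  by apply/funext => x; rewrite CnD CnB//; field.
have h1 := wint_Cn (n + m); have h2 := wint_Cn (n - m).
rewrite JZ ?JB// ?J_Cn ?subn_gt0 ?subr0 ?mulr0//; last exact: wintB.
by rewrite addn_gt0 (leq_ltn_trans _ mn).
Qed.

Lemma J_Cn_sqr n : (0 < n)%N -> J (fun x => Cn n x ^+ 2) = pi / 2.
Proof.
move=> n0.
rewrite (_ : (fun x => _) = (fun x => 2^-1 * (Cn (n + n) x + 1))); last first.
  apply/funext => x; rewrite CnD -!expr2.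
  by have := cos2Dsin2 (n%:R * acos x); rewrite /Cn /Sn; lra.
have h1 := wint_Cn (n + n); have h2 := @wint1 R.
rewrite JZ ?JD// ?J_Cn ?add0r ?J1; last exact: wintD.
  by rewrite mulrC.
by rewrite addn_gt0 n0.
Qed.

Lemma J_Sn_sqr n : (0 < n)%N -> J (fun x => Sn n x ^+ 2) = pi / 2.
Proof.
move=> n0.
rewrite (_ : (fun x => _) = (fun x => 2^-1 * (1 - Cn (n + n) x))); last first.
  apply/funext => x; rewrite CnD -!expr2.
  by have := cos2Dsin2 (n%:R * acos x); rewrite /Cn /Sn; lra.
have h1 := wint_Cn (n + n); have h2 := @wint1 R.
rewrite JZ ?JB// ?J_Cn ?subr0 ?J1; last exact: wintB.
  by rewrite mulrC.
by rewrite addn_gt0 n0.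
Qed.

End Chebyshev.

(** * Poisson sums *)

Section Kernels.
Context {R : realType}.
Local Notation mu := (@lebesgue_measure R).
Local Notation I := (@I11 R).
Implicit Types (h k f g G : R -> R) (x t c M b y : R) (n m N : nat).

(* If b = sinh y then aa b = cosh y and rr b = exp (- y). *)
Definition aa b : R := Num.sqrt (1 + b ^+ 2).
Definition rr b : R := aa b - b.

Lemma aa_sqr b : aa b ^+ 2 = 1 + b ^+ 2.
Proof. by rewrite /aa sqr_sqrtr// addr_ge0// sqr_ge0. Qed.

Lemma aa_ge0 b : 0 <= aa b.
Proof. exact: sqrtr_ge0. Qed.

Lemma aa_gt1 b : 0 < b -> 1 < aa b.
Proof.
move=> b0; rewrite -(@ltr_pXn2r _ 2)// ?nnegrE ?aa_ge0//.
by rewrite aa_sqr expr1n ltrDl exprn_gt0.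
Qed.

Lemma aaB1_le b : 0 < b -> aa b - 1 <= b ^+ 2 / 2.
Proof. by move=> b0; have := aa_gt1 b0; have := aa_sqr b; nra. Qed.

(** From [(aa b - 1) * (aa b + 1) = b ^+ 2], where the second factor is at most 3. *)
Lemma aaB1_ge b : 0 < b -> b < 1 -> b ^+ 2 / 3 <= aa b - 1.
Proof.
move=> b0 b1; have a1 := aa_gt1 b0; have a2 := aa_sqr b.
have a3 : aa b <= 2 by have := aaB1_le b0; nra.
nra.
Qed.

Lemma rr_gt0 b : 0 < b -> 0 < rr b.
Proof.
move=> b0; rewrite /rr subr_gt0 -(@ltr_pXn2r _ 2)// ?nnegrE ?aa_ge0// ?ltW//.
by rewrite aa_sqr ltrDr.
Qed.

Lemma rr_lt1 b : 0 < b -> rr b < 1.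
Proof. by move=> b0; rewrite /rr; have := aa_gt1 b0; have := aa_sqr b; nra. Qed.

(** With [r = rr b] this turns the Poisson denominator [1 - 2 r cos p + r^2] into
    [2 * r * (aa b - cos p)]. *)
Lemma rr_sqr b : rr b ^+ 2 = 2 * rr b * aa b - 1.
Proof. by rewrite /rr; have := aa_sqr b; move: (aa b) => a; nra. Qed.

(** Real part of the finite geometric sum of [z^n], [z = r e^(iy)], multiplied by the squared
    modulus of [1 - z]; [geom_sin] is the imaginary part. *)
Let geom_cos b N (y : R) :
  2 * rr b * (aa b - cos y) * \sum_(n < N) rr b ^+ n * cos (n%:R * y) =
  1 - rr b * cos y - rr b ^+ N * (cos (N%:R * y) - rr b * cos (N%:R * y - y)).
Proof.
elim: N => [|N IH].
  by rewrite big_ord0 expr0 mul0r sub0r cosN cos0; ring.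
have e : N.+1%:R * y = N%:R * y + y by rewrite -natr1 mulrDl mul1r.
rewrite big_ord_recr/= mulrDr IH e addrK exprS !cosD cosN sinN.
have := rr_sqr b; move: (rr b) (aa b) => r a.
move: (cos (N%:R * y)) (sin (N%:R * y)) (cos y) (sin y) (r ^+ N) => p q c s z h.
have -> : 2 * r * (a - c) = r ^+ 2 + 1 - 2 * r * c by rewrite h; ring.
by ring.
Qed.

Let geom_sin b N (y : R) :
  2 * rr b * (aa b - cos y) * \sum_(n < N) rr b ^+ n * sin (n%:R * y) =
  rr b * sin y - rr b ^+ N * (sin (N%:R * y) - rr b * sin (N%:R * y - y)).
Proof.
elim: N => [|N IH].
  by rewrite big_ord0 expr0 mul0r sub0r sinN sin0; ring.
have e : N.+1%:R * y = N%:R * y + y by rewrite -natr1 mulrDl mul1r.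
rewrite big_ord_recr/= mulrDr IH e addrK exprS !sinD cosN sinN.
have := rr_sqr b; move: (rr b) (aa b) => r a.
move: (cos (N%:R * y)) (sin (N%:R * y)) (cos y) (sin y) (r ^+ N) => p q c s z h.
have -> : 2 * r * (a - c) = r ^+ 2 + 1 - 2 * r * c by rewrite h; ring.
by ring.
Qed.

(** Constant of the geometric remainder, uniform in the angle since [aa b - cos y >= aa b - 1]. It
    blows up as [b] tends to 0, which is harmless because [b] is fixed while the number of terms
    grows. *)
Definition gerr b : R := (rr b * (aa b - 1))^-1.

Lemma gerr_ge0 b : 0 < b -> 0 <= gerr b.
Proof. by move=> b0; rewrite invr_ge0 mulr_ge0// ?ltW// ?rr_gt0// subr_gt0 aa_gt1. Qed.

Let err_bound b N (y p q : R) : 0 < b -> `|p| <= 1 -> `|q| <= 1 ->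
  `|rr b ^+ N * (p - rr b * q) / (2 * rr b * (aa b - cos y))| <= gerr b * rr b ^+ N.
Proof.
move=> b0 p1 q1.
have r0 := rr_gt0 b0; have r1 := rr_lt1 b0; have a1 := aa_gt1 b0.
have c1 := cos_le1 y.
have ac : 0 < aa b - cos y by rewrite subr_gt0 (le_lt_trans c1).
have a10 : 0 < aa b - 1 by rewrite subr_gt0.
rewrite normrM normfV (@ger0_norm _ (2 * _ * _)); last first.
  by rewrite !mulr_ge0// ltW.
rewrite normrM (@ger0_norm _ (_ ^+ _)) ?(exprn_ge0 _ (ltW r0))//.
rewrite mulrAC -mulrA (mulrC (gerr b)); apply: ler_wpM2l; first by rewrite exprn_ge0 ?ltW.
have h2 : `|p - rr b * q| <= 2.
  rewrite (le_trans (ler_normB _ _))// normrM (ger0_norm (ltW r0)).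
  have : rr b * `|q| <= 1 by have := normr_ge0 q; nra.
  lra.
rewrite mulrC ler_pdivrMr; last by rewrite !mulr_gt0.
apply: (le_trans h2); rewrite /gerr mulrC.
rewrite ler_pdivlMr; last by rewrite mulr_gt0.
by rewrite -mulrA ler_pM2l// ler_pM2l// lerD2l lerN2.
Qed.

(** The term [n = 0] enters with weight 1, whence the [1/2] beside half the Poisson kernel
    [sinh / (cosh - cos)]. *)
Lemma sum_cos_approx b N (y : R) : 0 < b ->
  `|\sum_(n < N) rr b ^+ n * cos (n%:R * y) - (2^-1 + b / (2 * (aa b - cos y)))|
    <= gerr b * rr b ^+ N.
Proof.
move=> b0; have a1 := aa_gt1 b0; have r0 := rr_gt0 b0.
have ac : 0 < aa b - cos y by rewrite subr_gt0 (le_lt_trans (cos_le1 y)).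
have H := geom_cos b N y.
have Dn : 2 * rr b * (aa b - cos y) != 0.
  by rewrite !mulf_neq0 ?pnatr_eq0//; apply: lt0r_neq0.
have -> : \sum_(n < N) rr b ^+ n * cos (n%:R * y) =
   (1 - rr b * cos y - rr b ^+ N * (cos (N%:R * y) - rr b * cos (N%:R * y - y)))
     / (2 * rr b * (aa b - cos y)).
  by apply: (mulfI Dn); rewrite H mulrCA divff ?mulr1.
have -> : 2^-1 + b / (2 * (aa b - cos y)) =
    (1 - rr b * cos y) / (2 * rr b * (aa b - cos y)).
  have -> : 1 - rr b * cos y = rr b * (aa b - cos y) + b * rr b.
    by rewrite /rr; have := aa_sqr b; move: (aa b) (cos y) => a c; nra.
  move: (lt0r_neq0 r0) (lt0r_neq0 ac); move: (rr b) (aa b) (cos y) => r a c r' ac'.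
  by field; rewrite r' ac'.
rewrite -mulrBl [X in X / _]addrAC subrr add0r mulNr normrN.
by apply: err_bound => //; rewrite ler_norml cos_geN1 cos_le1.
Qed.

Lemma sum_sin_approx b N (y : R) : 0 < b ->
  `|\sum_(n < N) rr b ^+ n * sin (n%:R * y) - sin y / (2 * (aa b - cos y))|
    <= gerr b * rr b ^+ N.
Proof.
move=> b0; have a1 := aa_gt1 b0; have r0 := rr_gt0 b0.
have ac : 0 < aa b - cos y by rewrite subr_gt0 (le_lt_trans (cos_le1 y)).
have H := geom_sin b N y.
have Dn : 2 * rr b * (aa b - cos y) != 0.
  by rewrite !mulf_neq0 ?pnatr_eq0//; apply: lt0r_neq0.
have -> : \sum_(n < N) rr b ^+ n * sin (n%:R * y) =
   (rr b * sin y - rr b ^+ N * (sin (N%:R * y) - rr b * sin (N%:R * y - y)))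
     / (2 * rr b * (aa b - cos y)).
  by apply: (mulfI Dn); rewrite H mulrCA divff ?mulr1.
have -> : sin y / (2 * (aa b - cos y)) =
    (rr b * sin y) / (2 * rr b * (aa b - cos y)).
  move: (lt0r_neq0 r0) (lt0r_neq0 ac); move: (rr b) (aa b) (cos y) (sin y) => r a c s r' ac'.
  by field; rewrite r' ac'.
rewrite -mulrBl [X in X / _]addrAC subrr add0r mulNr normrN.
by apply: err_bound => //; rewrite ler_norml sin_geN1 sin_le1.
Qed.

End Kernels.

(** * The four kernels of the Abel sums *)

Section ConjugateKernels.
Context {R : realType}.
Local Notation mu := (@lebesgue_measure R).
Local Notation I := (@I11 R).
Implicit Types (h k f g G : R -> R) (x t c M b y : R) (n m N : nat).

(* Poisson sums with ratio rr b: with t = cos p and x = cos s, Pk, Sk, Vk and Wk are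
   up to factors w and constants the closed forms of the sums of rr b ^+ n times cos np cos ns,
   sin np sin ns, cos np sin ns and sin np cos ns. As b tends to 0, Vk and Wk tend
   to 1 / (x - t), while Pk and Sk concentrate at t. *)
Definition Dk b t x : R := (x - aa b * t) ^+ 2 + b ^+ 2 * (1 - t ^+ 2).
Definition Pk b t x : R := b * (aa b - x * t) / Dk b t x.
Definition Sk b t x : R := b * w x * w t / Dk b t x.
Definition Vk b t x : R := (x - aa b * t) / Dk b t x.
Definition Wk b t x : R := (aa b * x - t) / Dk b t x.

Lemma Dk_gt0 b t x : 0 < b -> I t -> 0 < Dk b t x.
Proof.
move=> b0 It; rewrite /Dk ltr_wpDl ?sqr_ge0// mulr_gt0 ?exprn_gt0// I11_sqr//.
Qed.

Lemma Dk_factor b t x : I t -> I x ->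
  Dk b t x = (aa b - cos (acos t - acos x)) * (aa b - cos (acos t + acos x)).
Proof.
move=> It Ix; have /andP[/ltW t1 /ltW t2] := (I11E t).1 It.
have /andP[/ltW x1 /ltW x2] := (I11E x).1 Ix.
rewrite cosB cosD !acosK ?in_itv/= ?t1 ?t2 ?x1 ?x2//.
rewrite !sin_acos ?t1 ?t2 ?x1 ?x2// -/(w t) -/(w x) /Dk.
have := w_sqr It; have := w_sqr Ix; have := aa_sqr b.
move: (aa b) (w t) (w x) => a v u ha hu hv.
transitivity ((a - t * x) ^+ 2 - v ^+ 2 * u ^+ 2); last by ring.
have -> : b ^+ 2 = a ^+ 2 - 1 by rewrite ha; ring.
by rewrite hu hv; ring.
Qed.

Let cos_acosI x : I x -> cos (acos x) = x.
Proof.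
by move=> /I11E/andP[h1 h2]; rewrite acosK// in_itv/= !ltW.
Qed.

Let sin_acosI x : I x -> sin (acos x) = w x.
Proof. by move=> /I11E/andP[h1 h2]; rewrite sin_acos// !ltW. Qed.

Let aa_cos_neq0 b (y : R) : 0 < b -> aa b - cos y != 0.
Proof.
move=> b0; apply: lt0r_neq0; rewrite subr_gt0 (le_lt_trans (cos_le1 y))//.
exact: aa_gt1.
Qed.

Let half_dist (p q P Q c : R) : `|p - P| <= c -> `|q - Q| <= c ->
  `|(p + q) / 2 - (P + Q) / 2| <= c.
Proof.
move=> h1 h2; have -> : (p + q) / 2 - (P + Q) / 2 = ((p - P) + (q - Q)) / 2 by ring.
rewrite normrM (ger0_norm (_ : 0 <= 2^-1)) ?invr_ge0// ler_pdivrMr//.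
by rewrite (le_trans (ler_normD _ _))//; lra.
Qed.

Let half_distB (p q P Q c : R) : `|p - P| <= c -> `|q - Q| <= c ->
  `|(p - q) / 2 - (P - Q) / 2| <= c.
Proof.
move=> h1 h2; apply: half_dist => //.
by rewrite -opprD normrN.
Qed.

(** Product-to-sum formulas reduce this and the three lemmas that follow to the Poisson and
    conjugate Poisson sums at the two angles. The summand 1 is the contribution of [n = 0]. *)
Lemma kernel_CC b t x N : 0 < b -> I t -> I x ->
  `|\sum_(n < N) (rr b ^+ n * Cn n t) * Cn n x - (1 + Pk b t x) / 2|
  <= gerr b * rr b ^+ N.
Proof.
move=> b0 It Ix.
have h1 := sum_cos_approx N (acos t - acos x) b0.
have h2 := sum_cos_approx N (acos t + acos x) b0.
have := half_dist h1 h2.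
rewrite -big_split/= mulr_suml.
have -> : \sum_(i < N) (rr b ^+ i * cos (i%:R * (acos t - acos x)) +
     rr b ^+ i * cos (i%:R * (acos t + acos x))) / 2 =
    \sum_(n < N) (rr b ^+ n * Cn n t) * Cn n x.
  by apply: eq_bigr => i _; rewrite /Cn mulrBr mulrDr cosB cosD; field.
rewrite /Pk Dk_factor//.
have -> : aa b - x * t =
   ((aa b - cos (acos t - acos x)) + (aa b - cos (acos t + acos x))) / 2.
  by rewrite cosB cosD !cos_acosI//; field.
have := @aa_cos_neq0 b (acos t - acos x) b0.
have := @aa_cos_neq0 b (acos t + acos x) b0.
move: (aa b - cos (acos t - acos x)) (aa b - cos (acos t + acos x)) => p q q0 p0.
have -> // : (2^-1 + b / (2 * p) + (2^-1 + b / (2 * q))) / 2 =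
  (1 + b * ((p + q) / 2) / (p * q)) / 2.
by field; rewrite p0 q0.
Qed.

Lemma kernel_SS b t x N : 0 < b -> I t -> I x ->
  `|\sum_(n < N) (rr b ^+ n * Sn n t) * Sn n x - Sk b t x / 2|
  <= gerr b * rr b ^+ N.
Proof.
move=> b0 It Ix.
have h1 := sum_cos_approx N (acos t - acos x) b0.
have h2 := sum_cos_approx N (acos t + acos x) b0.
have := half_distB h1 h2.
rewrite -sumrB/= mulr_suml.
have -> : \sum_(i < N) (rr b ^+ i * cos (i%:R * (acos t - acos x)) -
     rr b ^+ i * cos (i%:R * (acos t + acos x))) / 2 =
    \sum_(n < N) (rr b ^+ n * Sn n t) * Sn n x.
  by apply: eq_bigr => i _; rewrite /Sn mulrBr mulrDr cosB cosD; field.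
rewrite /Sk Dk_factor//.
have -> : b * w x * w t = b *
   ((aa b - cos (acos t + acos x)) - (aa b - cos (acos t - acos x))) / 2.
  by rewrite cosB cosD !sin_acosI//; field.
have := @aa_cos_neq0 b (acos t - acos x) b0.
have := @aa_cos_neq0 b (acos t + acos x) b0.
move: (aa b - cos (acos t - acos x)) (aa b - cos (acos t + acos x)) => p q q0 p0.
have -> // : (2^-1 + b / (2 * p) - (2^-1 + b / (2 * q))) / 2 =
  b * (q - p) / 2 / (p * q) / 2.
by field; rewrite p0 q0.
Qed.

Lemma kernel_CS b t x N : 0 < b -> I t -> I x ->
  `|\sum_(n < N) (rr b ^+ n * Cn n t) * Sn n x - - (w x * Vk b t x) / 2|
  <= gerr b * rr b ^+ N.
Proof.
move=> b0 It Ix.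
have h1 := sum_sin_approx N (acos t - acos x) b0.
have h2 := sum_sin_approx N (acos t + acos x) b0.
have := half_distB h2 h1.
rewrite -sumrB/= mulr_suml.
have -> : \sum_(i < N) (rr b ^+ i * sin (i%:R * (acos t + acos x)) -
     rr b ^+ i * sin (i%:R * (acos t - acos x))) / 2 =
    \sum_(n < N) (rr b ^+ n * Cn n t) * Sn n x.
  by apply: eq_bigr => i _; rewrite /Sn /Cn mulrBr mulrDr sinB sinD; field.
have p0 := @aa_cos_neq0 b (acos t - acos x) b0.
have q0 := @aa_cos_neq0 b (acos t + acos x) b0.
suff -> : (sin (acos t + acos x) / (2 * (aa b - cos (acos t + acos x))) -
   sin (acos t - acos x) / (2 * (aa b - cos (acos t - acos x)))) / 2 =
   - (w x * Vk b t x) / 2 by [].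
rewrite /Vk Dk_factor//.
(* The cross terms combine through [w t ^+ 2 + t ^+ 2 = 1] and leave one linear factor. *)
have hs : sin (acos t + acos x) * (aa b - cos (acos t - acos x)) -
  sin (acos t - acos x) * (aa b - cos (acos t + acos x)) =
  - (2 * (w x * (x - aa b * t))).
  rewrite cosB cosD sinB sinD !sin_acosI// !cos_acosI//.
  have := w_sqr It; have := w_sqr Ix; move: (aa b) (w t) (w x) => a v u hu hv.
  transitivity (2 * a * t * u - 2 * u * x * (v ^+ 2 + t ^+ 2)); first by ring.
  by rewrite hv; ring.
move: p0 q0 hs.
move: (aa b - cos (acos t - acos x)) (aa b - cos (acos t + acos x)) => p q p0 q0 hs.
have -> : - (w x * ((x - aa b * t) / (p * q))) = - (2 * (w x * (x - aa b * t))) / (2 * (p * q)).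
  by field; rewrite p0 q0.
by rewrite -hs; field; rewrite p0 q0.
Qed.

Lemma kernel_SC b t x N : 0 < b -> I t -> I x ->
  `|\sum_(n < N) (rr b ^+ n * Sn n t) * Cn n x - (w t * Wk b t x) / 2|
  <= gerr b * rr b ^+ N.
Proof.
move=> b0 It Ix.
have h1 := sum_sin_approx N (acos t - acos x) b0.
have h2 := sum_sin_approx N (acos t + acos x) b0.
have := half_dist h2 h1.
rewrite -big_split/= mulr_suml.
have -> : \sum_(i < N) (rr b ^+ i * sin (i%:R * (acos t + acos x)) +
     rr b ^+ i * sin (i%:R * (acos t - acos x))) / 2 =
    \sum_(n < N) (rr b ^+ n * Sn n t) * Cn n x.
  by apply: eq_bigr => i _; rewrite /Sn /Cn mulrBr mulrDr sinB sinD; field.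
have p0 := @aa_cos_neq0 b (acos t - acos x) b0.
have q0 := @aa_cos_neq0 b (acos t + acos x) b0.
suff -> : (sin (acos t + acos x) / (2 * (aa b - cos (acos t + acos x))) +
   sin (acos t - acos x) / (2 * (aa b - cos (acos t - acos x)))) / 2 =
   (w t * Wk b t x) / 2 by [].
rewrite /Wk Dk_factor//.
have hs : sin (acos t + acos x) * (aa b - cos (acos t - acos x)) +
  sin (acos t - acos x) * (aa b - cos (acos t + acos x)) =
  2 * (w t * (aa b * x - t)).
  rewrite cosB cosD sinB sinD !sin_acosI// !cos_acosI//.
  have := w_sqr It; have := w_sqr Ix; move: (aa b) (w t) (w x) => a v u hu hv.
  transitivity (2 * a * x * v - 2 * v * t * (u ^+ 2 + x ^+ 2)); first by ring.
  by rewrite hu; ring.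
move: p0 q0 hs.
move: (aa b - cos (acos t - acos x)) (aa b - cos (acos t + acos x)) => p q p0 q0 hs.
have -> : w t * ((aa b * x - t) / (p * q)) = (2 * (w t * (aa b * x - t))) / (2 * (p * q)).
  by field; rewrite p0 q0.
by rewrite -hs; field; rewrite p0 q0.
Qed.

Lemma continuous_Dk b t : continuous (Dk b t).
Proof.
move=> x; apply: cvgD; last exact: cvg_cst.
apply: (@continuous_comp _ _ _ (fun x => x - aa b * t) (fun y => y ^+ 2)).
  by apply: cvgB; [exact: cvg_id|exact: cvg_cst].
exact: exprn_continuous.
Qed.

Lemma measurable_invDk b t : 0 < b -> I t -> measurable_fun I (fun x => (Dk b t x)^-1).
Proof.
move=> b0 It; apply: open_continuous_measurable_fun; first exact: interval_open.
move=> x _; apply: continuousV; last exact: continuous_Dk.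
by rewrite gt_eqF// Dk_gt0.
Qed.

Lemma measurable_Pk b t : 0 < b -> I t -> measurable_fun I (Pk b t).
Proof.
move=> b0 It; apply: measurable_funM; last exact: measurable_invDk.
apply: measurable_funM => //; apply: measurable_funB => //.
exact: measurable_funM.
Qed.

Lemma measurable_Sk b t : 0 < b -> I t -> measurable_fun I (Sk b t).
Proof.
move=> b0 It; apply: measurable_funM; last exact: measurable_invDk.
do 2 apply: measurable_funM => //.
exact: measurable_w.
Qed.

Lemma measurable_Vk b t : 0 < b -> I t -> measurable_fun I (Vk b t).
Proof.
move=> b0 It; apply: measurable_funM; last exact: measurable_invDk.
exact: measurable_funB.
Qed.

Lemma measurable_Wk b t : 0 < b -> I t -> measurable_fun I (Wk b t).
Proof.
move=> b0 It; apply: measurable_funM; last exact: measurable_invDk.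
by apply: measurable_funB => //; exact: measurable_funM.
Qed.

(** The convergence to [K] is uniform on [I], so the error is at most [gc * r ^+ N] times the
    integral of [|G| / w]. *)
Lemma J_series (e : nat -> R -> R) (c : nat -> R) (K G : R -> R) (r gc : R) :
  0 <= r < 1 -> 0 <= gc ->
  (forall n, measurable_fun I (e n)) -> (forall n x, I x -> `|e n x| <= 1) ->
  measurable_fun I K -> wint G ->
  (forall N x, I x -> `|\sum_(n < N) c n * e n x - K x| <= gc * r ^+ N) ->
  \sum_(n < N) c n * J (fun x => e n x * G x) @[N --> \oo] --> J (fun x => K x * G x).
Proof.
move=> /andP[r0 r1] gc0 me e1 mK iG H.
have ie n : wint (fun x => e n x * G x) by apply: (@wintMl _ _ _ 1) => // x; exact: e1.
(* The hypothesis at [N = 0], where the sum is empty, bounds [K] itself. *)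
have KM x : I x -> `|K x| <= gc.
  by move=> Ix; have := H 0%N x Ix; rewrite big_ord0 sub0r normrN expr0 mulr1.
have iK : wint (fun x => K x * G x) by apply: (@wintMl _ _ _ gc).
have E N : \sum_(n < N) c n * J (fun x => e n x * G x) =
    J (fun x => (\sum_(n < N) c n * e n x) * G x).
  rewrite (@eq_J _ _ (fun x => \sum_(n < N) c n * (e n x * G x))); last first.
    by move=> x _; rewrite mulr_suml; apply: eq_bigr => i _; rewrite mulrA.
  by rewrite J_sum => [|i _]; [apply: eq_bigr => i _; rewrite JZ|exact: wintZ].
have iE N : wint (fun x => (\sum_(n < N) c n * e n x) * G x).
  rewrite (_ : (fun _ => _) = (fun x => \sum_(n < N) c n * (e n x * G x))); last first.
    by apply/funext => x; rewrite mulr_suml; apply: eq_bigr => i _; rewrite mulrA.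
  by apply: wint_sum => i _; exact: wintZ.
rewrite (eq_cvg _ _ E).
apply/cvgrPdist_le => eps eps0.
have hr : gc * r ^+ N * J (fun x => `|G x|) @[N --> \oo] --> (0 : R).
  rewrite -[X in _ --> X](mul0r (J (fun x => `|G x|))); apply: cvgM; last exact: cvg_cst.
  rewrite -(mulr0 gc); apply: cvgM; first exact: cvg_cst.
  by apply: cvg_expr; rewrite ger0_norm.
near=> N.
rewrite -JB//.
apply: (le_trans (le_normr_J _)); first exact: wintB.
apply: (@le_trans _ _ (gc * r ^+ N * J (fun x => `|G x|))).
  rewrite -JZ; last exact: wint_norm.
  apply: le_J.
  - exact/wint_norm/wintB.
  - exact/wintZ/wint_norm.
  - move=> x Ix; rewrite -mulrBl normrM ler_wpM2r// distrC; exact: H.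
near: N; apply: (cvgr_le 0) => //.
Unshelve. all: by end_near. Qed.

Section CoefficientSums.
Variables (b t : R) (G : R -> R).
Hypotheses (b0 : 0 < b) (It : I t) (iG : wint G).

Let r01 : 0 <= rr b < 1.
Proof. by rewrite rr_lt1// ltW// rr_gt0. Qed.

Lemma sum_CC : \sum_(n < N) (rr b ^+ n * Cn n t) * J (fun x => Cn n x * G x) @[N --> \oo]
  --> J (fun x => (1 + Pk b t x) / 2 * G x).
Proof.
apply: (@J_series Cn (fun n => rr b ^+ n * Cn n t) _ _ (rr b) (gerr b)) => //.
- exact: gerr_ge0.
- by move=> n; exact: measurable_Cn.
- by move=> n x _; exact: Cn_le1.
- by apply: measurable_funM => //; apply: measurable_funD => //; exact: measurable_Pk.
- by move=> N x Ix; exact: kernel_CC.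
Qed.

Lemma sum_SS : \sum_(n < N) (rr b ^+ n * Sn n t) * J (fun x => Sn n x * G x) @[N --> \oo]
  --> J (fun x => Sk b t x / 2 * G x).
Proof.
apply: (@J_series Sn (fun n => rr b ^+ n * Sn n t) _ _ (rr b) (gerr b)) => //.
- exact: gerr_ge0.
- by move=> n; exact: measurable_Sn.
- by move=> n x _; exact: Sn_le1.
- by apply: measurable_funM => //; exact: measurable_Sk.
- by move=> N x Ix; exact: kernel_SS.
Qed.

Lemma sum_CS : \sum_(n < N) (rr b ^+ n * Cn n t) * J (fun x => Sn n x * G x) @[N --> \oo]
  --> J (fun x => - (w x * Vk b t x) / 2 * G x).
Proof.
apply: (@J_series Sn (fun n => rr b ^+ n * Cn n t) _ _ (rr b) (gerr b)) => //.
- exact: gerr_ge0.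
- by move=> n; exact: measurable_Sn.
- by move=> n x _; exact: Sn_le1.
- apply: measurable_funM => //; apply: measurableT_comp => //.
  by apply: measurable_funM; [exact: measurable_w|exact: measurable_Vk].
- by move=> N x Ix; exact: kernel_CS.
Qed.

Lemma sum_SC : \sum_(n < N) (rr b ^+ n * Sn n t) * J (fun x => Cn n x * G x) @[N --> \oo]
  --> J (fun x => (w t * Wk b t x) / 2 * G x).
Proof.
apply: (@J_series Cn (fun n => rr b ^+ n * Sn n t) _ _ (rr b) (gerr b)) => //.
- exact: gerr_ge0.
- by move=> n; exact: measurable_Cn.
- by move=> n x _; exact: Cn_le1.
- by do 2 apply: measurable_funM => //; exact: measurable_Wk.
- by move=> N x Ix; exact: kernel_SC.
Qed.

End CoefficientSums.
End ConjugateKernels.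

(** * Kernel limits at Lebesgue points *)

Section LebesguePoints.
Context {R : realType}.
Local Notation mu := (@lebesgue_measure R).
Local Notation I := (@I11 R).
Implicit Types (h f g G u v : R -> R) (x t c M b y e d : R) (n m k N : nat).

(** Up to a constant, the Poisson kernel of the upper half-plane at height [e]; it serves as
    majorant for the kernels and for their differences. *)
Definition pk e t x : R := e / (e ^+ 2 + (x - t) ^+ 2).

Lemma pk_ge0 e t x : 0 <= e -> 0 <= pk e t x.
Proof. by move=> e0; rewrite divr_ge0// addr_ge0 ?sqr_ge0. Qed.

Lemma continuous_pk e t : 0 < e -> continuous (pk e t).
Proof.
move=> e0 x; apply: cvgM; first exact: cvg_cst.
apply: cvgV; first by rewrite gt_eqF// ltr_wpDr ?sqr_ge0// exprn_gt0.
apply: cvgD; first exact: cvg_cst.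
apply: (@continuous_comp _ _ _ (fun x => x - t) (fun y => y ^+ 2)).
  by apply: cvgB; [exact: cvg_id|exact: cvg_cst].
exact: exprn_continuous.
Qed.

Lemma measurable_pk e t D : 0 < e -> measurable_fun D (pk e t).
Proof.
by move=> e0; apply: measurable_funTS; apply: continuous_measurable_fun; exact: continuous_pk.
Qed.

Lemma pk_le e t x c : 0 < e -> 0 < c -> c <= `|x - t| -> pk e t x <= e / c ^+ 2.
Proof.
move=> e0 c0 cx; rewrite /pk ler_pM2l// lef_pV2 ?posrE ?exprn_gt0//.
  rewrite (@le_trans _ _ (`|x - t| ^+ 2))//; last by rewrite real_normK ?num_real// lerDr sqr_ge0.
  by rewrite ler_sqr ?nnegrE// ltW.
by rewrite ltr_wpDr ?sqr_ge0// exprn_gt0.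
Qed.

Lemma pk_le_inv e t x : 0 < e -> pk e t x <= e^-1.
Proof.
move=> e0; have e2 : 0 < e ^+ 2 by rewrite exprn_gt0.
rewrite /pk ler_pdivrMr ?ltr_wpDr ?sqr_ge0// mulrDr expr2 mulrA mulVf ?gt_eqF// mul1r.
by rewrite lerDl mulr_ge0 ?sqr_ge0// invr_ge0 ltW.
Qed.

Lemma exists_dyadic e d : 0 < e -> e <= d ->
  exists k, 2 ^+ k * e <= d /\ d < 2 ^+ k.+1 * e.
Proof.
move=> e0 ed.
have ex : exists n, (fun n => d < 2 ^+ n * e) n.
  exists (Num.bound (d / e)); rewrite -ltr_pdivrMr//.
  rewrite (lt_le_trans (archi_boundP _))//; first by rewrite divr_ge0 ?ltW// (lt_le_trans e0).
  by rewrite -natrX ler_nat ltnW// ltn_expl.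
have [k dk kmin] := ex_minnP ex; case: k dk kmin => [|k dk kmin].
  by rewrite expr0 mul1r ltNge ed.
exists k; split => //; rewrite leNgt; apply/negP => h.
by have := kmin k h; rewrite ltnn.
Qed.

Section bound.
Variables (u : R -> R) (t M d0 : R).
Hypotheses (mu_ : measurable_fun I u) (d00 : 0 < d0) (M0 : 0 <= M).
Hypothesis avg : forall d, 0 < d -> d <= d0 ->
  (\int[mu]_(x in I `&` ball t d) `|u x|%:E <= (M * d)%:E)%E.

Hint Extern 0 (measurable (_ `&` ball _ _)) => (apply: measurableI => //; exact: measurable_ball) : core.

Let mB d : measurable (I `&` ball t d).
Proof. by apply: measurableI => //; exact: measurable_ball. Qed.

Let mup e A : 0 < e -> measurable A -> A `<=` I ->
  measurable_fun A (fun x => (`|u x| * pk e t x)%:E).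
Proof.
move=> e0 mA AI; apply/measurable_EFinP; apply: measurable_funM; last exact: measurable_pk.
by apply: measurableT_comp => //; exact: measurable_funS mu_.
Qed.

Let mun A : measurable A -> A `<=` I -> measurable_fun A (fun x => (`|u x|)%:E).
Proof.
move=> mA AI; apply/measurable_EFinP.
by apply: measurableT_comp => //; exact: measurable_funS mu_.
Qed.

Let le_cst e c A : 0 < e -> 0 <= c -> measurable A -> A `<=` I ->
  (forall x, A x -> pk e t x <= c) ->
  (\int[mu]_(x in A) (`|u x| * pk e t x)%:E <= c%:E * \int[mu]_(x in A) `|u x|%:E)%E.
Proof.
move=> e0 c0 mA AI H; rewrite -ge0_integralZl_EFin//.
- apply: ge0_le_integral => //.
  + by move=> x _; rewrite lee_fin mulr_ge0// pk_ge0// ltW.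
  + exact: mup.
  + by apply: measurable_funeM; exact: mun.
  + by move=> x Ax; rewrite -EFinM lee_fin mulrC ler_wpM2r// H.
- exact: mun.
Qed.

Let split_le e A B : 0 < e -> measurable A -> measurable B -> A `<=` B -> B `<=` I ->
  (\int[mu]_(x in B) (`|u x| * pk e t x)%:E =
   \int[mu]_(x in A) (`|u x| * pk e t x)%:E +
   \int[mu]_(x in B `\` A) (`|u x| * pk e t x)%:E)%E.
Proof.
move=> e0 mA mB' AB BI; rewrite -ge0_integral_setU//.
- by rewrite setDUK.
- exact: measurableD.
- by apply: mup => //; [exact/measurableU/measurableD|move=> x [/AB/BI//|[/BI]]].
- by move=> x _; rewrite lee_fin mulr_ge0// pk_ge0// ltW.
- by apply/disj_setPS => x [? []].
Qed.

(** The ball of radius [e] contributes at most [M], since [pk <= 1 / e]. On the shell between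
    [2^j e] and [2^(j+1) e] one has [pk <= 1 / (4^j e)], so the shell contributes at most
    [2 M / 2^j]; summing over [j < k] gives [M + 4 M (1 - 1 / 2^k)]. *)
Lemma pk_dyadic e k : 0 < e -> 2 ^+ k * e <= d0 ->
  (\int[mu]_(x in I `&` ball t (2 ^+ k * e)%R) (`|u x| * pk e t x)%:E
    <= (M * (5 - 4 / 2 ^+ k))%:E)%E.
Proof.
move=> e0; elim: k => [|k IH] kd.
  have ei0 : 0 <= e^-1 by rewrite invr_ge0 ltW.
  apply: (le_trans (le_cst e0 ei0 (mB _) (@subIsetl _ _ _) _)).
    by move=> x _; exact: pk_le_inv.
  rewrite expr0 mul1r; apply: (le_trans (lee_wpmul2l _ (avg e0 _))).
  - by rewrite lee_fin invr_ge0 ltW.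
  - by move: kd; rewrite expr0 mul1r.
  - rewrite -EFinM lee_fin mulrCA mulVf ?gt_eqF// mulr1 divr1; lra.
have p2 : 0 < 2 ^+ k * e by rewrite mulr_gt0// exprn_gt0.
have p2S : 0 < 2 ^+ k.+1 * e by rewrite mulr_gt0// exprn_gt0.
have le2 : 2 ^+ k * e <= 2 ^+ k.+1 * e by rewrite ler_pM2r// exprS; have := exprn_gt0 k (ltr0Sn R 1); lra.
have sB : I `&` ball t (2 ^+ k * e) `<=` I `&` ball t (2 ^+ k.+1 * e).
  by move=> x [Ix bx]; split => //; exact: le_ball bx.
rewrite (split_le e0 (mB _) (mB _) sB (@subIsetl _ _ _)).
have {}IH := IH (le_trans le2 kd).
have c0 : 0 <= e / (2 ^+ k * e) ^+ 2 by rewrite divr_ge0 ?sqr_ge0// ltW.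
have sI : (I `&` ball t (2 ^+ k.+1 * e)) `\` (I `&` ball t (2 ^+ k * e)) `<=` I.
  by move=> x [[]].
apply: (le_trans (leeD IH (le_cst e0 c0 (measurableD (mB _) (mB _)) sI _))).
  move=> x [[Ix bx] nb]; apply: pk_le => //.
  rewrite leNgt; apply/negP => h; apply: nb; split => //.
  by rewrite /ball/= distrC.
have h1 : (\int[mu]_(x in (I `&` ball t (2 ^+ k.+1 * e)%R) `\` (I `&` ball t (2 ^+ k * e)%R)) `|u x|%:E
    <= (M * (2 ^+ k.+1 * e))%:E)%E.
  apply: le_trans (avg p2S kd); apply: ge0_subset_integral => //.
  - exact: measurableD.
  - by apply: mun => //; exact: subIsetl.
apply: (le_trans (leeD2l _ (lee_wpmul2l _ h1))).
  by rewrite lee_fin divr_ge0 ?sqr_ge0// ltW.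
rewrite -EFinM -EFinD lee_fin le_eqVlt; apply/orP; left; apply/eqP.
have k0 : 2 ^+ k != 0 :> R by rewrite gt_eqF// exprn_gt0.
rewrite (exprS 2 k); move: (2 ^+ k) k0 => z z0.
by field; rewrite z0 gt_eqF.
Qed.

(** The radius [2^k e] is the largest of its form not exceeding [d0]; outside that ball
    [|x - t| >= d0 / 2], hence [pk <= 4 e / d0^2]. *)
Lemma pk_bound e L : 0 < e -> e <= d0 -> (\int[mu]_(x in I) `|u x|%:E <= L%:E)%E ->
  (\int[mu]_(x in I) (`|u x| * pk e t x)%:E <= (5 * M + 4 * e / d0 ^+ 2 * L)%:E)%E.
Proof.
move=> e0 ed uL; have [k [kd dk]] := exists_dyadic e0 ed.
have p2 : 0 < 2 ^+ k * e by rewrite mulr_gt0// exprn_gt0.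
rewrite (split_le e0 (mB (2 ^+ k * e)) measurable_I11 (@subIsetl _ _ _) (fun x (Ix : I x) => Ix)).
have c0 : 0 <= 4 * e / d0 ^+ 2 by rewrite divr_ge0 ?sqr_ge0// mulr_ge0// ltW.
have sI : I `\` (I `&` ball t (2 ^+ k * e)) `<=` I by move=> x [].
apply: (le_trans (leeD (pk_dyadic e0 kd) (le_cst e0 c0 (measurableD measurable_I11 (mB _)) sI _))).
  move=> x [Ix nb].
  have -> : 4 * e / d0 ^+ 2 = e / (d0 / 2) ^+ 2 by field; rewrite gt_eqF.
  apply: pk_le => //; first by rewrite divr_gt0.
  rewrite leNgt; apply/negP => h; apply: nb; split => //.
  rewrite /ball/= distrC (lt_trans h)// ltr_pdivrMr//; by move: dk; rewrite exprS; lra.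
have h1 : (\int[mu]_(x in I `\` (I `&` ball t (2 ^+ k * e)%R)) `|u x|%:E <= L%:E)%E.
  apply: le_trans uL; apply: ge0_subset_integral => //.
  - exact: measurableD.
  - exact: mun.
apply: (le_trans (leeD2l _ (lee_wpmul2l _ h1))).
  by rewrite lee_fin divr_ge0 ?sqr_ge0// mulr_ge0// ltW.
rewrite -EFinM -EFinD lee_fin lerD2r mulrC ler_wpM2r//.
by rewrite gerBl divr_ge0// exprn_ge0.
Qed.

End bound.
End LebesguePoints.

(** * Dominated kernels at Lebesgue points *)

Section KernelLimits.
Context {R : realType}.
Local Notation mu := (@lebesgue_measure R).
Local Notation I := (@I11 R).
Implicit Types (h f g G u v : R -> R) (x t c M b y e d : R) (n m N : nat).

Local Notation int u := (mu.-integrable I (EFin \o u)).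

Definition avg_le u t M d0 := forall d, 0 < d -> d <= d0 ->
  (\int[mu]_(x in I `&` ball t d) `|u x|%:E <= (M * d)%:E)%E.

(** For [u = h - h t] this says that [t] is a Lebesgue point of [h]. *)
Definition smallavg u t := forall M, 0 < M -> exists2 d0, 0 < d0 & avg_le u t M d0.

Lemma int_measurable u : int u -> measurable_fun I u.
Proof. by move=> /(measurable_int mu)/measurable_EFinP. Qed.

Lemma int_le u v : measurable_fun I u -> (forall x, I x -> `|u x| <= `|v x|) ->
  int v -> int u.
Proof.
by move=> mu_ uv; apply: le_integrable => //; exact/measurable_EFinP.
Qed.

Lemma int_Ml u v M : measurable_fun I v -> (forall x, I x -> `|v x| <= M) -> int u ->
  int (fun x => u x * v x).
Proof.
move=> mv vM iu.
have iM : int (fun x => M * u x).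
  by apply: (@eq_integrable _ _ _ _ _ _ _ _ _ (integrableZl _ M iu)).
apply: int_le iM.
  by apply: measurable_funM => //; exact: int_measurable.
by move=> x Ix; rewrite !normrM mulrC ler_wpM2r// (le_trans (vM x Ix))// ler_norm.
Qed.

Lemma integral_norm_fin u : int u ->
  (\int[mu]_(x in I) `|u x|%:E <= (\int[mu]_(x in I) `|u x|)%:E)%E.
Proof.
move=> iu; by rewrite /Rintegral fineK//; apply: integrable_fin_num => //; exact: integrable_norm iu.
Qed.

Lemma normr_integral_pk_le u (k : R -> R) t M d0 C e :
  int u -> 0 < d0 -> 0 <= M -> 0 <= C -> avg_le u t M d0 -> 0 < e -> e <= d0 ->
  measurable_fun I k -> (forall x, I x -> `|k x| <= C * pk e t x) ->
  `|\int[mu]_(x in I) (u x * k x)| <=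
    C * (5 * M + 4 * e / d0 ^+ 2 * \int[mu]_(x in I) `|u x|).
Proof.
move=> iu d00 M0 C0 avg e0 ed mk kC.
have iuk : int (fun x => u x * k x).
  apply: (@int_Ml _ _ (C / e)) => // x Ix; rewrite (le_trans (kC x Ix))//.
  by rewrite ler_wpM2l// pk_le_inv.
rewrite -lee_fin EFin_normr_Rintegral//.
apply: (le_trans (le_abse_integral _ _ _)) => //; first exact: measurable_int iuk.
have mpk := @measurable_pk R e t I e0.
have mnu : measurable_fun I (fun x => `|u x|).
  by apply: measurableT_comp => //; exact: int_measurable.
apply: (@le_trans _ _ (\int[mu]_(x in I) (C%:E * (`|u x| * pk e t x)%:E))%E).
  apply: ge0_le_integral => //.
  - by apply/measurable_EFinP; apply: measurableT_comp => //; exact: int_measurable iuk.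
  - by apply: measurable_funeM; apply/measurable_EFinP; exact: measurable_funM.
  - move=> x Ix; rewrite /= -EFinM lee_fin normrM mulrCA ler_wpM2l//; exact: kC.
rewrite ge0_integralZl_EFin//; last 2 first.
- by move=> x _; rewrite lee_fin mulr_ge0// pk_ge0// ltW.
- by apply/measurable_EFinP; exact: measurable_funM.
rewrite EFinM lee_wpmul2l//.
apply: pk_bound => //; first exact: int_measurable.
exact: integral_norm_fin.
Qed.

(** The kernels need not become small in mass; the limit is 0 because the averages of [u] vanish at
    [t], while far from [t] the majorant [pk] is of order [e]. *)
Lemma cvg_kernel u (k : R -> R -> R) t C : int u -> smallavg u t -> 0 <= C ->
  (forall e, 0 < e -> e < 1 -> measurable_fun I (k e)) ->
  (forall e x, 0 < e -> e < 1 -> I x -> `|k e x| <= C * pk e t x) ->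
  \int[mu]_(x in I) (u x * k e x) @[e --> 0^'+] --> (0 : R).
Proof.
move=> iu su C0 mk kC; apply/cvgrPdist_le => eps eps0.
set L := \int[mu]_(x in I) `|u x|.
have L0 : 0 <= L by exact: Rintegral_ge0.
(* With this [M] the near part [5 * C * M] is at most [eps / 2]; the threshold [E0] does the same
   for the far part [4 * C * L * e / d0^2]. Adding 1 to [C] and [L] avoids a division by zero. *)
have C10 : 0 < eps / (10 * (C + 1)) by rewrite divr_gt0// mulr_gt0//; lra.
have [d0 d00 avg] := su _ C10.
have E0 : 0 < eps / (8 * (C + 1) * (L + 1)) * d0 ^+ 2.
  rewrite mulr_gt0 ?exprn_gt0// divr_gt0// !mulr_gt0//; lra.
near=> e.
have e0 : 0 < e by near: e; exact: nbhs_right_gt.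
have e1 : e < 1 by near: e; exact: nbhs_right_lt.
have ed : e <= d0 by near: e; exact: nbhs_right_le.
have eE : e <= eps / (8 * (C + 1) * (L + 1)) * d0 ^+ 2 by near: e; exact: nbhs_right_le.
rewrite sub0r normrN.
apply: (le_trans (normr_integral_pk_le iu d00 _ C0 avg e0 ed (mk _ e0 e1) _)).
- exact: ltW.
- by move=> x Ix; exact: kC.
rewrite -/L.
have C1 : 0 < C + 1 by lra.
have L1 : 0 < L + 1 by lra.
have h1 : C * (5 * (eps / (10 * (C + 1)))) <= eps / 2.
  have -> : C * (5 * (eps / (10 * (C + 1)))) = C / (C + 1) * (eps / 2) by field; rewrite gt_eqF.
  rewrite ger_pMl ?divr_gt0// ler_pdivrMr//; lra.
have h2 : C * (4 * e / d0 ^+ 2 * L) <= eps / 2.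
  have -> : C * (4 * e / d0 ^+ 2 * L) = 4 * (C * L) * (e / d0 ^+ 2) by ring.
  have q : e / d0 ^+ 2 <= eps / (8 * (C + 1) * (L + 1)) by rewrite ler_pdivrMr ?exprn_gt0.
  have q0 : 0 <= e / d0 ^+ 2 by rewrite divr_ge0 ?sqr_ge0// ltW.
  apply: (@le_trans _ _ (4 * ((C + 1) * (L + 1)) * (eps / (8 * (C + 1) * (L + 1))))).
    by apply: ler_pM => //; rewrite ?mulr_ge0// ler_pM2l// ler_pM//; lra.
  rewrite le_eqVlt; apply/orP; left; apply/eqP; field.
  by rewrite !gt_eqF.
rewrite mulrDr; lra.
Unshelve. all: by end_near. Qed.

(** The additional factor [e] in the kernel bound lets bounded averages take the place of vanishing
    ones; this admits constant functions [u]. *)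
Lemma cvg_kernel_small u (k : R -> R -> R) t C M d0 : int u -> 0 < d0 -> 0 <= M ->
  avg_le u t M d0 -> 0 <= C ->
  (forall e, 0 < e -> e < 1 -> measurable_fun I (k e)) ->
  (forall e x, 0 < e -> e < 1 -> I x -> `|k e x| <= C * e * pk e t x) ->
  \int[mu]_(x in I) (u x * k e x) @[e --> 0^'+] --> (0 : R).
Proof.
move=> iu d00 M0 avg C0 mk kC; apply/cvgrPdist_le => eps eps0.
set L := \int[mu]_(x in I) `|u x|.
have L0 : 0 <= L by exact: Rintegral_ge0.
set B := C * (5 * M + 4 / d0 ^+ 2 * L).
have B0 : 0 <= B.
  apply: mulr_ge0 => //; apply: addr_ge0; first exact: mulr_ge0.
  by apply: mulr_ge0 => //; apply: divr_ge0 => //; exact: sqr_ge0.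
near=> e.
have e0 : 0 < e by near: e; exact: nbhs_right_gt.
have e1 : e < 1 by near: e; exact: nbhs_right_lt.
have ed : e <= d0 by near: e; exact: nbhs_right_le.
have eE : e <= eps / (B + 1) by near: e; apply: nbhs_right_le; rewrite divr_gt0//; lra.
rewrite sub0r normrN.
have Ce0 : 0 <= C * e by rewrite mulr_ge0// ltW.
apply: (le_trans (normr_integral_pk_le iu d00 M0 Ce0 avg e0 ed (mk _ e0 e1) _)).
  by move=> x Ix; exact: kC.
rewrite -/L.
apply: (@le_trans _ _ (e * B)).
  have -> : C * e * (5 * M + 4 * e / d0 ^+ 2 * L) =
      e * (C * (5 * M + 4 / d0 ^+ 2 * L * e)) by ring.
  apply: ler_wpM2l; first exact: ltW.
  apply: ler_wpM2l => //; rewrite lerD2l.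
  rewrite -[leRHS]mulr1; apply: ler_wpM2l; last exact: ltW.
  by apply: mulr_ge0 => //; apply: divr_ge0 => //; exact: sqr_ge0.
apply: (le_trans (ler_wpM2r B0 eE)).
rewrite mulrAC ler_pdivrMr; last lra.
by rewrite ler_pM2l//; lra.
Unshelve. all: by end_near. Qed.

Lemma avg_le_cst c t : avg_le (fun=> c) t (2 * `|c|) 1.
Proof.
move=> d d0 _; have mB : measurable (I `&` ball t d).
  by apply: measurableI => //; exact: measurable_ball.
rewrite integral_cst//.
apply: (@le_trans _ _ (`|c|%:E * mu (ball t d))%E).
  rewrite lee_wpmul2l//; by apply: le_measure; rewrite ?inE//; exact: measurable_ball.
rewrite lebesgue_measure_ball ?(ltW d0)// -EFinM lee_fin -mulr_natl; lra.
Qed.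

Lemma ae_imp (P Q : R -> Prop) : (forall x, P x -> Q x) ->
  {ae mu, forall x, P x} -> {ae mu, forall x, Q x}.
Proof. by move=> PQ; apply: (@filterS _ _ (ae_filter_ringOfSetsType mu)). Qed.

Lemma ae_imp2 (P Q S : R -> Prop) : (forall x, P x -> Q x -> S x) ->
  {ae mu, forall x, P x} -> {ae mu, forall x, Q x} -> {ae mu, forall x, S x}.
Proof. by move=> PQ; apply: (@filterS2 _ _ (ae_filter_ringOfSetsType mu)). Qed.

Lemma ae_smallavg h : int h ->
  {ae mu, forall t, I t -> smallavg (fun x => h x - h t) t}.
Proof.
move=> ih.
have := lebesgue_differentiation (integrable_locally measurable_I11 ih).
apply: ae_imp => t ht It M M0.
(* [davg] divides by the measure [2 * d] of the ball, so [M / 2] there corresponds to [M * d] in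
   [avg_le]. *)
have M2 : 0 < M / 2 by rewrite divr_gt0.
have : \forall r \near 0^'+, (davg (h \_ I) t r < (M / 2)%:E)%E.
  move/fine_cvgP : ht => [hf hc].
  near=> r; rewrite -[X in (X < _)%E]fineK; last by near: r.
  by rewrite lte_fin; near: r; exact: (cvgr_lt 0).
move=> [d0 /= d00 Hd]; exists (d0 / 2); first by rewrite divr_gt0.
move=> d dp dd.
have : (davg (h \_ I) t d < (M / 2)%:E)%E.
  apply: Hd => //=; rewrite sub0r normrN gtr0_norm//; lra.
have mB : measurable (ball t d : set R) by exact: measurable_ball.
rewrite /davg /iavg lebesgue_measure_ball ?(ltW dp)//.
have d2 : 0 < d *+ 2 by rewrite pmulrn_lgt0.
rewrite inver (gt_eqF d2) muleC.
rewrite -lte_pdivlMr ?invr_gt0// invrK => /ltW H.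
have {H} : (\int[mu]_(y in ball t d) `|(h \_ I) y - (h \_ I) t|%:E <= (M * d)%:E)%E.
  apply: (le_trans _ (le_trans H _)).
    exact: lexx.
  by rewrite -EFinM lee_fin -mulr_natl; lra.
apply: le_trans.
have := int_measurable ih.
move=> /(measurable_restrictT _ measurable_I11).1 mh.
have -> : (\int[mu]_(x in I `&` ball t d) `|h x - h t|%:E =
    \int[mu]_(x in I `&` ball t d) `|(h \_ I) x - (h \_ I) t|%:E)%E.
  by apply: eq_integral => x /set_mem[Ix _]; rewrite !patchE !mem_set.
apply: ge0_subset_integral => //.
- by apply: measurableI => //.
- apply/measurable_EFinP; apply: measurableT_comp => //.
  by apply: measurable_funB => //; exact: measurable_funTS.
Unshelve. all: by end_near. Qed.

(** Applied to [v = 1 / w], which is unbounded on [I] but bounded near each point of [I]. *)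
Lemma smallavg_mul u v t M d1 : measurable_fun I u -> measurable_fun I v ->
  0 < d1 -> 0 < M -> (forall x, I x -> `|x - t| < d1 -> `|v x| <= M) ->
  smallavg u t -> smallavg (fun x => u x * v x) t.
Proof.
move=> mu_ mv d10 M0 vM su eps eps0.
have [d0 d00 avg] := su (eps / M) (divr_gt0 eps0 M0).
exists (Num.min d0 (d1 / 2)); first by rewrite lt_min d00 divr_gt0.
move=> d dp; rewrite le_min => /andP[dd0 dd1].
have mB : measurable (I `&` ball t d).
  by apply: measurableI => //; exact: measurable_ball.
have mU : measurable_fun (I `&` ball t d) (fun x => (`|u x|)%:E).
  apply/measurable_EFinP; apply: measurableT_comp => //.
  by apply: measurable_funS mu_ => //; exact: subIsetl.
apply: (@le_trans _ _ (\int[mu]_(x in I `&` ball t d) (M%:E * `|u x|%:E))%E).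
  apply: ge0_le_integral => //.
  - apply/measurable_EFinP; apply: measurableT_comp => //.
    by apply: (measurable_funS measurable_I11) => //; exact: measurable_funM.
  - exact: measurable_funeM.
  - move=> x [Ix bx]; rewrite -EFinM lee_fin normrM mulrC ler_wpM2r// vM//.
    by move: bx; rewrite /ball/= distrC => bx; lra.
rewrite ge0_integralZl_EFin//; last exact: ltW.
apply: (le_trans (lee_wpmul2l _ (avg d dp dd0))); first by rewrite lee_fin ltW.
by rewrite -EFinM lee_fin mulrA mulrCA divff ?mulr1// gt_eqF.
Qed.

Definition lpt h t := smallavg (fun x => h x - h t) t.

End KernelLimits.

(** * [Pk] and [Sk] as approximate identities *)

Section KernelLimits2.
Context {R : realType}.
Local Notation mu := (@lebesgue_measure R).
Local Notation I := (@I11 R).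
Implicit Types (h f g G u v : R -> R) (x t c M b y e d : R) (n m N : nat).

Local Notation int u := (mu.-integrable I (EFin \o u)).

Lemma I11_norm t : I t -> `|t| < 1.
Proof. by move=> /I11E/andP[h1 h2]; rewrite ltr_norml h1 h2. Qed.

(** Constant of the lower bound [Dk_ge]. It degenerates as [t] approaches an endpoint, but every
    limit is taken at a fixed [t]. *)
Definition ct t : R := 2 / 3 * (1 - `|t|).

Lemma ct_gt0 t : I t -> 0 < ct t.
Proof. by move=> /I11_norm h; rewrite /ct; lra. Qed.

Lemma DkE b t x : Dk b t x = (x - t) ^+ 2 + (aa b - 1) ^+ 2 + 2 * (aa b - 1) * (1 - x * t).
Proof.
rewrite /Dk; have := aa_sqr b; move: (aa b) => a ha.
have -> : b ^+ 2 = a ^+ 2 - 1 by rewrite ha; ring.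
by ring.
Qed.

Lemma mul_le_norm x t : I x -> I t -> x * t <= `|t|.
Proof.
move=> Ix It; rewrite (le_trans (ler_norm _))// normrM ler_piMl//.
exact/ltW/I11_norm.
Qed.

(** In the form [DkE], the bounds [aa b - 1 >= b^2 / 3] and [1 - x t >= 1 - |t|] make the last term
    at least [ct t * b^2], and [ct t <= 1] takes care of [(x - t)^2]. *)
Lemma Dk_ge b t x : 0 < b -> b < 1 -> I t -> I x ->
  ct t * (b ^+ 2 + (x - t) ^+ 2) <= Dk b t x.
Proof.
move=> b0 b1 It Ix; rewrite DkE /ct.
have h1 := aaB1_ge b0 b1; have h2 := mul_le_norm Ix It; have h3 := I11_norm It.
have h4 := normr_ge0 t.
move: (aa b - 1) (x * t) (`|t|) h1 h2 h3 h4 => a p q h1 h2 h3 h4.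
have s0 := sqr_ge0 (x - t); have b20 := sqr_ge0 b.
move: ((x - t) ^+ 2) (b ^+ 2) s0 b20 h1 => s z s0 z0 h1.
have e1 : 2 / 3 * (1 - q) * z <= 2 * a * (1 - p).
  have : z / 3 * (1 - q) <= a * (1 - p) by apply: ler_pM => //; lra.
  lra.
have e2 : 2 / 3 * (1 - q) * s <= s by nra.
have e3 := sqr_ge0 a.
lra.
Qed.

(** Reduces domination by [pk] to the claim that a numerator over [Dk] is of order [b]. *)
Lemma frac_Dk_le b t x (n A : R) : 0 < b -> b < 1 -> I t -> I x -> 0 <= A ->
  `|n| <= A * b -> `|n / Dk b t x| <= A / ct t * pk b t x.
Proof.
move=> b0 b1 It Ix A0 nA.
have D0 := Dk_gt0 x b0 It; have c0 := ct_gt0 It.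
have q0 : 0 < b ^+ 2 + (x - t) ^+ 2 by rewrite ltr_wpDr ?sqr_ge0// exprn_gt0.
rewrite normrM normfV (gtr0_norm D0) ler_pdivrMr// (le_trans nA)//.
rewrite /pk.
have -> : A / ct t * (b / (b ^+ 2 + (x - t) ^+ 2)) * Dk b t x =
   A * b * (Dk b t x / (ct t * (b ^+ 2 + (x - t) ^+ 2))).
  by field; rewrite !gt_eqF.
rewrite ler_peMr//; first by rewrite mulr_ge0// ltW.
by rewrite ler_pdivlMr ?mul1r ?Dk_ge// mulr_gt0.
Qed.

Lemma aa_le2 b : 0 < b -> b < 1 -> aa b <= 2.
Proof. by move=> b0 b1; have := aaB1_le b0; nra. Qed.

Lemma Pk_le b t x : 0 < b -> b < 1 -> I t -> I x -> `|Pk b t x| <= 3 / ct t * pk b t x.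
Proof.
move=> b0 b1 It Ix; apply: frac_Dk_le => //.
rewrite normrM (gtr0_norm b0) mulrC ler_pM2r//.
have h1 := aa_le2 b0 b1; have h2 := aa_gt1 b0.
have := I11_norm Ix; have := I11_norm It => t1 x1.
have : `|x * t| <= 1 by rewrite normrM mulr_ile1// ltW.
by rewrite !ler_norml => /andP[h3 h4]; apply/andP; split; lra.
Qed.

(** [sum_CC] for [G = 1]: only [n = 0] has a nonzero coefficient, so every nonempty partial sum is
    [pi], while the limit is [(pi + J (Pk b t)) / 2]. *)
Lemma J_Pk b t : 0 < b -> I t -> J (Pk b t) = pi.
Proof.
move=> b0 It.
have mP := measurable_Pk b0 It.
have iP : wint (Pk b t).
  have iP1 : wint (fun x => (1 + Pk b t x) / 2).
    apply: (@wint_bounded _ _ (gerr b)) => [|x Ix].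
      by apply: measurable_funM => //; exact: measurable_funD.
    by have := kernel_CC 0 b0 It Ix; rewrite big_ord0 sub0r normrN expr0 mulr1.
  by apply: (eq_wint _ (wintB (wintZ 2 iP1) (@wint1 R))) => z _ /=; field.
have H := sum_CC b0 It wint1.
have E N : \sum_(n < N.+1) (rr b ^+ n * Cn n t) * J (fun x => Cn n x * 1) = pi.
  rewrite big_ord_recl/= big1 ?addr0 => [|i _].
    rewrite expr0 Cn0 !mul1r -[RHS]J1; by congr J; apply/funext => z; rewrite Cn0 mulr1.
  rewrite (_ : (fun x => _) = Cn (bump 0 i)); last by apply/funext => z; rewrite mulr1.
  by rewrite J_Cn ?mulr0.
move: H; rewrite -cvg_shiftS (eq_cvg _ _ E) => H.
have {H} := cvg_unique (@norm_hausdorff _ _) H (cvg_cst _).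
have -> : J (fun x => (1 + Pk b t x) / 2 * 1) = 2^-1 * (pi + J (Pk b t)).
  rewrite -J1 -(JD (@wint1 R) iP) -(JZ _ (wintD (@wint1 R) iP)).
  by apply: eq_J => z _; field.
by move=> /(_ _ _); lra.
Qed.

Lemma wint_int G : wint G -> int G.
Proof.
move=> iG; have mG := wint_measurable iG.
apply: (@int_le _ _ (fun x => G x / w x)) => // x Ix.
rewrite normrM ler_peMr// normfV (ger0_norm (w_ge0 x)) invf_ge1 ?w_gt0//.
exact: w_le1.
Qed.

Lemma invw_near t : I t -> exists d1 M, [/\ 0 < d1, 0 < M &
  forall x, I x -> `|x - t| < d1 -> `|(w x)^-1| <= M].
Proof.
move=> It; have wt := w_gt0 It.
have wt2 : w t / 2 < w t by rewrite ltr_pdivrMr//; lra.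
have : \forall x \near t, w t / 2 < w x.
  exact: (cvgr_gt (w t) (@continuous_w R t) _ wt2).
move=> [d /= d0 Hd]; exists d, (2 / w t); split => //; first by rewrite divr_gt0.
move=> x Ix xt; rewrite normfV (ger0_norm (w_ge0 x)).
rewrite -(invrK (2 / w t)) lef_pV2 ?posrE ?w_gt0// ?invr_gt0 ?divr_gt0// invf_div.
by apply/ltW/Hd; rewrite /= distrC.
Qed.

Lemma wint_cst c : wint (fun=> c : R).
Proof. by apply: eq_wint (wintZ c wint1) => x _; rewrite mulr1. Qed.

Lemma wint_Pk b t : 0 < b -> b < 1 -> I t -> wint (Pk b t).
Proof.
move=> b0 b1 It; have c0 := ct_gt0 It.
apply: (@wint_bounded _ _ (3 / ct t / b)); first exact: measurable_Pk.
move=> x Ix; apply: (le_trans (Pk_le b0 b1 It Ix)).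
by rewrite ler_wpM2l ?pk_le_inv// divr_ge0// ltW.
Qed.

(** As [Pk] has mass exactly [pi] for [dx / w], subtracting [pi * G t] replaces [G] by [G - G t].
    The factor [1 / w] is attached to the function, not to the kernel. *)
Lemma cvg_J_Pk G t : wint G -> I t -> lpt G t ->
  J (fun x => Pk b t x * G x) @[b --> 0^'+] --> pi * G t.
Proof.
move=> iG It lG; have mG := wint_measurable iG.
have c0 := ct_gt0 It.
have iu : int (fun x => (G x - G t) * (w x)^-1).
  by have := wintB iG (wint_cst (G t)).
have su : smallavg (fun x => (G x - G t) * (w x)^-1) t.
  have [d1 [M [d10 M0 wM]]] := invw_near It.
  apply: smallavg_mul wM lG => //; last exact: measurable_invw.
  exact: measurable_funB.
have C0 : 0 <= 3 / ct t by rewrite divr_ge0// ltW.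
have mk e : 0 < e -> e < 1 -> measurable_fun I (Pk e t) by move=> e0 _; exact: measurable_Pk.
have H := cvg_kernel iu su C0 mk (fun e x p q Ix => @Pk_le e t x p q It Ix).
have : \int[mu]_(x in I) ((G x - G t) * (w x)^-1 * Pk b t x) + pi * G t @[b --> 0^'+]
   --> 0 + pi * G t by apply: cvgD => //; exact: cvg_cst.
rewrite add0r; apply: cvg_trans; apply: near_eq_cvg.
near=> b.
have b0 : 0 < b by near: b; exact: nbhs_right_gt.
have b1 : b < 1 by near: b; exact: nbhs_right_lt.
have iP := wint_Pk b0 b1 It.
have mP := measurable_Pk b0 It.
have bP x : I x -> `|Pk b t x| <= 3 / ct t / b.
  move=> Ix; apply: (le_trans (Pk_le b0 b1 It Ix)).
  by rewrite ler_wpM2l ?pk_le_inv// divr_ge0// ltW.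
have iPG : wint (fun x => Pk b t x * G x) by apply: wintMl bP iG.
rewrite -(J_Pk b0 It) mulrC -JZ//.
have -> : \int[mu]_(x in I) ((G x - G t) * (w x)^-1 * Pk b t x) =
    J (fun x => Pk b t x * G x - G t * Pk b t x).
  by apply: eq_Rintegral => x _; ring.
rewrite JB//; last exact: wintZ.
by rewrite subrK.
Unshelve. all: by end_near. Qed.

(** The numerator of the difference is [- b] times [(aa b - 1) + (1 - x t - w x w t)]. Since
    [(1 - x t)^2 - (w x w t)^2 = (x - t)^2], both summands are bounded by a multiple of [Dk], and
    the difference is of order [b] uniformly in [x]. *)
Lemma Sk_Pk_le b t x : 0 < b -> b < 1 -> I t -> I x ->
  `|Sk b t x - Pk b t x| <= (2 / (1 - `|t|) / ct t) * b.
Proof.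
move=> b0 b1 It Ix.
have D0 := Dk_gt0 x b0 It; have c0 := ct_gt0 It.
have t1 : 0 < 1 - `|t| by rewrite subr_gt0 I11_norm.
have n0 := normr_ge0 t.
have wx := w_ge0 x; have wt := w_ge0 t.
have xt : 1 - `|t| <= 1 - x * t by rewrite lerD2l lerN2 mul_le_norm.
have q0 : 0 < b ^+ 2 + (x - t) ^+ 2 by rewrite ltr_wpDr ?sqr_ge0// exprn_gt0.
have ww : 0 <= 1 - x * t - w x * w t <= (x - t) ^+ 2 / (1 - `|t|).
  have sqE : (1 - x * t - w x * w t) * (1 - x * t + w x * w t) = (x - t) ^+ 2.
    by rewrite -subr_sqr exprMn w_sqr// w_sqr//; ring.
  have p0 : 0 <= w x * w t by rewrite mulr_ge0.
  have s0 := sqr_ge0 (x - t).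
  have d0 : 0 <= 1 - x * t - w x * w t.
    by rewrite -(@pmulr_lge0 _ (1 - x * t + w x * w t)) ?sqE//; lra.
  rewrite d0/= ler_pdivlMr// -sqE; apply: ler_wpM2l => //; lra.
have a1 := aa_gt1 b0; have a2 := aaB1_le b0.
have -> : Sk b t x - Pk b t x = - (b * (aa b - 1 + (1 - x * t - w x * w t))) / Dk b t x.
  by rewrite /Sk /Pk; field; rewrite gt_eqF.
move: ww => /andP[ww0 ww1].
rewrite normrM normfV (gtr0_norm D0) ler_pdivrMr// normrN.
rewrite normrM (gtr0_norm b0) [leRHS](_ : _ = b * (2 / (1 - `|t|) / ct t * Dk b t x)); last by ring.
rewrite ler_pM2l// ger0_norm; last lra.
apply: (@le_trans _ _ (2 / (1 - `|t|) * (b ^+ 2 + (x - t) ^+ 2))); last first.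
  rewrite -[leRHS]mulrA ler_wpM2l ?divr_ge0 ?(ltW t1)//.
  by rewrite mulrC ler_pdivlMr// mulrC Dk_ge.
have t2 : 1 <= (1 - `|t|)^-1 by rewrite invf_ge1//; lra.
have s0 := sqr_ge0 (x - t); have z0 := sqr_ge0 b.
move: ww1 t2; move: ((1 - `|t|)^-1) => z ww1 z1.
move: ((x - t) ^+ 2) (b ^+ 2) s0 z0 ww1 a2 => s zz s0 zz0 ww1 a2.
nra.
Qed.

Lemma cvg_J_Sk G t : wint G -> I t -> lpt G t ->
  J (fun x => Sk b t x * G x) @[b --> 0^'+] --> pi * G t.
Proof.
move=> iG It lG.
have H := cvg_J_Pk iG It lG.
have t1 : 0 < 1 - `|t| by rewrite subr_gt0 I11_norm.
set C := 2 / (1 - `|t|) / ct t.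
have C0 : 0 <= C by rewrite !divr_ge0 ?(ltW t1)// ltW// ct_gt0.
suff H2 : J (fun x => Sk b t x * G x) - J (fun x => Pk b t x * G x) @[b --> 0^'+] --> (0 : R).
  have -> : (fun b => J (fun x => Sk b t x * G x)) = (fun b =>
    J (fun x => Sk b t x * G x) - J (fun x => Pk b t x * G x) + J (fun x => Pk b t x * G x)).
    by apply/funext => b; rewrite subrK.
  by rewrite -[X in _ --> X]add0r; exact: cvgD.
apply: norm_cvg0.
apply: (@squeeze_cvgr _ _ _ _ (fun=> 0) (fun b => C * b * J (fun x => `|G x|))); last 2 first.
- exact: cvg_cst.
- rewrite -[X in _ --> X](mul0r (J (fun x => `|G x|))); apply: cvgM; last exact: cvg_cst.
  rewrite -[X in _ --> X](mulr0 C); apply: cvgM; first exact: cvg_cst.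
  exact: cvg_at_right_filter.
near=> b.
have b0 : 0 < b by near: b; exact: nbhs_right_gt.
have b1 : b < 1 by near: b; exact: nbhs_right_lt.
rewrite normr_ge0/=.
have mP := measurable_Pk b0 It; have mS := measurable_Sk b0 It.
have bP x : I x -> `|Pk b t x| <= 3 / ct t / b.
  move=> Ix; apply: (le_trans (Pk_le b0 b1 It Ix)).
  by rewrite ler_wpM2l ?pk_le_inv// divr_ge0// ltW// ct_gt0.
have bS x : I x -> `|Sk b t x| <= C * b + 3 / ct t / b.
  move=> Ix; rewrite -[Sk _ _ _](subrK (Pk b t x)) (le_trans (ler_normD _ _))//.
  by rewrite lerD ?bP// Sk_Pk_le.
have iPG : wint (fun x => Pk b t x * G x) by apply: wintMl bP iG.
have iSG : wint (fun x => Sk b t x * G x) by apply: wintMl bS iG.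
rewrite -JB//; apply: (le_trans (le_normr_J (wintB iSG iPG))).
rewrite -JZ; last exact: wint_norm.
apply: le_J; [exact/wint_norm/wintB|exact/wintZ/wint_norm|].
move=> x Ix; rewrite -mulrBl normrM ler_wpM2r//; exact: Sk_Pk_le.
Unshelve. all: by end_near. Qed.

End KernelLimits2.

(** * Comparison with the truncated kernel *)

Section Truncation.
Context {R : realType}.
Local Notation mu := (@lebesgue_measure R).
Local Notation I := (@I11 R).
Implicit Types (h f g G u v : R -> R) (x t c M b y e d : R) (n m N : nat).

Local Notation int u := (mu.-integrable I (EFin \o u)).

Definition trunc e h t : R :=
  \int[mu]_(x in `]-1, t - e[) (h x / (x - t)) + \int[mu]_(x in `]t + e, 1[) (h x / (x - t)).

Definition trk e t x : R := if e < `|x - t| then (x - t)^-1 else 0.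

(** The truncation radius is [b] itself. Within it the numerator of [Vk] is at most [3 b / 2];
    beyond it the difference from [1 / (x - t)] has a numerator at most [7 b^2 / 2] divided by
    [|x - t| > b]. The constant 4 covers both. *)
Lemma Vk_trk_le b t x : 0 < b -> b < 1 -> I t -> I x ->
  `|Vk b t x - trk b t x| <= 4 / ct t * pk b t x.
Proof.
move=> b0 b1 It Ix.
have D0 := Dk_gt0 x b0 It.
have a1 := aa_gt1 b0; have a2 := aaB1_le b0.
have t1 := I11_norm It; have x1 := I11_norm Ix.
have t1' := normr_ge0 t; have x1' := normr_ge0 x.
have b2 : b ^+ 2 / 2 <= b / 2 by rewrite ler_pM2r// ger_pMr//; lra.
rewrite /trk; case: ifPn => [bs|]; last first.
  rewrite -leNgt => sb; rewrite subr0; apply: frac_Dk_le => //.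
  have -> : x - aa b * t = (x - t) - (aa b - 1) * t by ring.
  rewrite (le_trans (ler_normB _ _))// normrM (@ger0_norm _ (aa b - 1)); last lra.
  have : (aa b - 1) * `|t| <= (aa b - 1) * 1 by apply: ler_wpM2l; lra.
  lra.
have s0 : x - t != 0 by rewrite -normr_gt0; lra.
have -> : Vk b t x - (x - t)^-1 =
   ((x - t) * (x - aa b * t) - Dk b t x) / (x - t) / Dk b t x.
  by rewrite /Vk; field; rewrite s0 gt_eqF.
apply: frac_Dk_le => //.
rewrite normrM normfV ler_pdivrMr ?normr_gt0//.
have -> : (x - t) * (x - aa b * t) - Dk b t x =
   - ((aa b - 1) * (t * (x - t) + (aa b - 1) + 2 * (1 - x * t))).
  by rewrite DkE; ring.
rewrite normrN normrM (@ger0_norm _ (aa b - 1)); last lra.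
have nE : `|t * (x - t) + (aa b - 1) + 2 * (1 - x * t)| <= 7.
  have -> : t * (x - t) + (aa b - 1) + 2 * (1 - x * t) = 2 + (aa b - 1) - (x * t + t * t) by ring.
  have xt : `|x * t| <= 1 by rewrite normrM mulr_ile1//; lra.
  have tt : `|t * t| <= 1 by rewrite normrM mulr_ile1//; lra.
  by move: xt tt; rewrite !ler_norml => /andP[? ?] /andP[? ?]; apply/andP; split; lra.
apply: (@le_trans _ _ (b ^+ 2 / 2 * 7)).
  by apply: ler_pM => //; lra.
apply: (@le_trans _ _ (4 * b * b)); first by have := sqr_ge0 b; rewrite expr2 => ?; lra.
by apply: ler_wpM2l; [rewrite mulr_ge0// ltW|exact: ltW].
Qed.

Lemma measurable_trk e t : 0 < e -> measurable_fun I (trk e t).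
Proof.
move=> e0; apply: measurable_funTS.
(* The maximum with [e ^+ 2] changes nothing where [e < |x - t|] and makes the quotient continuous
   everywhere. *)
have -> : trk e t =
    (fun x => if e < `|x - t| then (x - t) / Num.max (e ^+ 2) ((x - t) ^+ 2) else 0).
  apply/funext => x; rewrite /trk; case: ifPn => // ex.
  have h : e ^+ 2 <= (x - t) ^+ 2.
    by rewrite -[leRHS]real_normK ?num_real// ler_sqr ?nnegrE// ltW.
  rewrite max_r// expr2 invfM mulrA divff ?mul1r//.
  by rewrite -normr_gt0 (lt_trans e0).
apply: measurable_fun_ifT => //.
  by apply: measurable_fun_ltr => //; apply: measurableT_comp => //; exact: measurable_funB.
apply: continuous_measurable_fun => x.
have cB : {for x, continuous (fun x => x - t)} by apply: cvgB; [exact: cvg_id|exact: cvg_cst].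
apply: cvgM => //; apply: cvgV.
  by rewrite gt_eqF// lt_max exprn_gt0.
apply: (@continuous_max _ _ (fun=> e ^+ 2) (fun x => (x - t) ^+ 2)).
  exact: cvg_cst.
apply: (@continuous_comp _ _ _ (fun x => x - t) (fun y => y ^+ 2)) => //.
exact: exprn_continuous.
Qed.

Lemma trk_le e t x : 0 < e -> `|trk e t x| <= e^-1.
Proof.
move=> e0; rewrite /trk; case: ifPn => ex.
  by rewrite normfV lef_pV2 ?posrE ?(lt_trans e0 ex)//; exact: ltW.
by rewrite normr0 invr_ge0 ltW.
Qed.

Lemma int_trk h e t : 0 < e -> int h -> int (fun x => h x * trk e t x).
Proof.
move=> e0 ih; apply: (@int_Ml _ _ _ e^-1) => //; first exact: measurable_trk.
by move=> x _; exact: trk_le.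
Qed.

Lemma integral_trk h e t : 0 < e -> I t -> int h ->
  \int[mu]_(x in I) (h x * trk e t x) = trunc e h t.
Proof.
move=> e0 It ih; have ihk := int_trk t e0 ih.
set A : set R := `]-1, t - e[%classic; set B : set R := `]t + e, 1[%classic.
have /andP[t1 t2] := (I11E t).1 It.
have mA : measurable A by exact: measurable_itv.
have mB : measurable B by exact: measurable_itv.
have AI : A `<=` I.
  by move=> x; rewrite /A /= in_itv/= => /andP[h1 h2]; apply/I11E; rewrite h1/=; lra.
have BI : B `<=` I.
  by move=> x; rewrite /B /= in_itv/= => /andP[h1 h2]; apply/I11E; rewrite h2 andbT; lra.
have ABI : A `|` B `<=` I by move=> x [/AI|/BI].
have trkE x : I x -> trk e t x = ((fun x => (x - t)^-1) \_ (A `|` B)) x.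
  move=> /I11E/andP[x1 x2]; rewrite /trk patchE; case: ifPn => [|ex].
    rewrite ltr_normr => /orP[ex|ex]; rewrite mem_set//.
      by right; rewrite /B/= in_itv/= x2 andbT; lra.
    by left; rewrite /A/= in_itv/= x1; lra.
  case: ifPn => // /set_mem [|]; rewrite /A /B /= in_itv/= => /andP[h1 h2].
    by move: ex; rewrite ltr_normr negb_or -!leNgt => /andP[? ?]; lra.
  by move: ex; rewrite ltr_normr negb_or -!leNgt => /andP[? ?]; lra.
have iAB : mu.-integrable (A `|` B) (EFin \o (fun x => h x / (x - t))).
  have : mu.-integrable (A `|` B) (EFin \o (fun x => h x * trk e t x)).
    by apply: integrableS ihk => //; exact: measurableU.
  apply: eq_integrable; first exact: measurableU.
  by move=> x /[dup]/set_mem/ABI Ix ABx /=; rewrite trkE ?patchE ?ABx.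
rewrite /trunc -/A -/B -Rintegral_setU//; last first.
  apply/disj_setPS => x []; rewrite /A /B /= !in_itv/= => /andP[_ h1] /andP[h2 _].
  lra.
have -> : A `|` B = I `&` (A `|` B) by rewrite setIidr.
rewrite Rintegral_mkcondr; apply: eq_Rintegral => x /set_mem Ix.
by rewrite trkE// !patchE; case: ifPn; rewrite ?mulr0.
Qed.

Lemma Rintegral_oo_is_derive f (F : R -> R) (a b : R) : a < b ->
  (forall x, a <= x <= b -> is_derive x 1 F (f x)) ->
  (forall x, a <= x <= b -> {for x, continuous f}) ->
  \int[mu]_(x in `]a, b[) f x = F b - F a.
Proof.
move=> ab dF cf; rewrite /Rintegral.
have mf : measurable_fun `]a, b[ (EFin \o f).
  apply/measurable_EFinP; apply: open_continuous_measurable_fun; first exact: interval_open.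
  by move=> x /set_mem; rewrite /= in_itv/= => /andP[ax xb]; apply: cf; rewrite !ltW.
have := integral_is_derive ab dF cf.
by rewrite (integral_itv_bndoo _ _ mf) => ->; rewrite -EFinB.
Qed.

(** [Vk] is half the logarithmic derivative of [Dk], and at both endpoints [Dk] is a perfect
    square. *)
Lemma integral_Vk b t : 0 < b -> I t ->
  \int[mu]_(x in I) Vk b t x = ln (aa b - t) - ln (aa b + t).
Proof.
move=> b0 It.
have /andP[t1 t2] := (I11E t).1 It.
have a1 := aa_gt1 b0.
have D0 x := Dk_gt0 x b0 It.
have dF x : -1 <= x <= 1 -> is_derive x 1 (fun x => 2^-1 * ln (Dk b t x)) (Vk b t x).
  move=> _.
  have dD : is_derive x 1 (Dk b t) (2 * (x - aa b * t)).
    rewrite /Dk; apply: is_derive_eq; rewrite /GRing.scale /=; ring.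
  have dl : is_derive (Dk b t x) 1 (@ln R) (Dk b t x)^-1 by exact: is_derive1_ln.
  have := is_derive1_comp dl dD.
  move=> h; apply: is_derive_eq; rewrite /Vk /GRing.scale /=.
  by field; rewrite gt_eqF.
have cV x : -1 <= x <= 1 -> {for x, continuous (Vk b t)}.
  move=> _; apply: cvgM; first by apply: cvgB; [exact: cvg_id|exact: cvg_cst].
  by apply: cvgV; [rewrite gt_eqF|exact: continuous_Dk].
have m11 : (-1 : R) < 1 by lra.
rewrite /I11 (Rintegral_oo_is_derive m11 dF cV).
have -> : Dk b t 1 = (aa b - t) ^+ 2 by rewrite DkE; ring.
have -> : Dk b t (-1) = (aa b + t) ^+ 2 by rewrite DkE; ring.
have h1 : 0 < aa b - t by lra.
have h2 : 0 < aa b + t by lra.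
by rewrite (lnXn 2 h1) (lnXn 2 h2); field.
Qed.

(** The two terms [ln b] cancel by the symmetry of the truncation, so the value is independent of
    [b] once the excised interval lies inside [I]. *)
Lemma trunc_cst b t : 0 < b -> b < 1 - `|t| -> I t ->
  trunc b (fun=> 1) t = ln (1 - t) - ln (1 + t).
Proof.
move=> b0 bt It.
have /andP[t1 t2] := (I11E t).1 It.
have tn := ler_norm t; have tn' : - t <= `|t| by rewrite -normrN ler_norm.
have cV (x : R) : x - t != 0 -> {for x, continuous (fun x => 1 / (x - t))}.
  move=> xt; apply: cvgM; first exact: cvg_cst.
  by apply: cvgV => //; apply: cvgB; [exact: cvg_id|exact: cvg_cst].
have e1 : (\int[mu]_(x in `]-1, t - b[) (1 / (x - t)) = ln b - ln (1 + t))%R.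
  have dF x : -1 <= x <= t - b -> is_derive x 1 (fun x => ln (t - x)) (1 / (x - t)).
    move=> /andP[h1 h2].
    have dl : is_derive (t - x) 1 (@ln R) (t - x)^-1 by apply: is_derive1_ln; lra.
    have dD : is_derive x 1 (fun x => t - x) (-1) by apply: is_derive_eq; ring.
    have h := @is_derive1_comp R (@ln R) (fun x => t - x) x _ _ dl dD.
    apply: (is_derive_eq h).
    by rewrite mulrN1 mul1r -invrN opprB.
  have cF x : -1 <= x <= t - b -> {for x, continuous (fun x => 1 / (x - t))}.
    by move=> /andP[h1 h2]; apply: cV; apply: ltr0_neq0; lra.
  have lt : -1 < t - b by lra.
  rewrite (Rintegral_oo_is_derive lt dF cF) opprK [t + 1]addrC.
  by congr (ln _ - _); ring.
have e2 : (\int[mu]_(x in `]t + b, 1[) (1 / (x - t)) = ln (1 - t) - ln b)%R.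
  have dF x : t + b <= x <= 1 -> is_derive x 1 (fun x => ln (x - t)) (1 / (x - t)).
    move=> /andP[h1 h2].
    have dl : is_derive (x - t) 1 (@ln R) (x - t)^-1 by apply: is_derive1_ln; lra.
    have dD : is_derive x 1 (fun x => x - t) 1 by apply: is_derive_eq; ring.
    have h := @is_derive1_comp R (@ln R) (fun x => x - t) x _ _ dl dD.
    apply: (is_derive_eq h).
    by rewrite mulr1 mul1r.
  have cF x : t + b <= x <= 1 -> {for x, continuous (fun x => 1 / (x - t))}.
    by move=> /andP[h1 h2]; apply: cV; apply: lt0r_neq0; lra.
  have lt : t + b < 1 by lra.
  rewrite (Rintegral_oo_is_derive lt dF cF).
  by congr (_ - ln _); ring.
rewrite /trunc e1 e2; lra.
Qed.

End Truncation.

(** * Principal values as limits of regularised integrals *)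

Section PrincipalValue.
Context {R : realType}.
Local Notation mu := (@lebesgue_measure R).
Local Notation I := (@I11 R).
Implicit Types (h f g G u v : R -> R) (x t c M b y e d : R) (n m N : nat).

Local Notation int u := (mu.-integrable I (EFin \o u)).

Lemma int_cst c : int (fun=> c).
Proof. exact: wint_int (wint_cst c). Qed.

Lemma int_mul_bounded h (k : R -> R) M : int h -> measurable_fun I k ->
  (forall x, I x -> `|k x| <= M) -> int (fun x => h x * k x).
Proof. by move=> ih mk kM; exact: int_Ml kM ih. Qed.

Lemma intB f g : int f -> int g -> int (fun x => f x - g x).
Proof. by move=> i1 i2; exact: (integrableB _ i1 i2). Qed.

Lemma RintZ c f : int f -> \int[mu]_(x in I) (c * f x) = c * \int[mu]_(x in I) f x.
Proof. by move=> i1; rewrite RintegralZl. Qed.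

(** A Lebesgue point controls only [h - h t]; the constant is integrated against the kernel
    separately. *)
Lemma kernel_split h (k : R -> R) t M : int h -> measurable_fun I k ->
  (forall x, I x -> `|k x| <= M) ->
  \int[mu]_(x in I) (h x * k x) = \int[mu]_(x in I) ((h x - h t) * k x)
    + h t * \int[mu]_(x in I) (1 * k x).
Proof.
move=> ih mk kM.
have i1 := int_mul_bounded ih mk kM.
have i2 := int_mul_bounded (int_cst 1) mk kM.
have i3 : int (fun x => h t * (1 * k x)).
  by have := int_mul_bounded (int_cst (h t)) mk kM; under eq_fun do rewrite -(mul1r (k _)).
rewrite -RintZ// -RintegralD//.
- by apply: eq_Rintegral => x _; ring.
- exact: (int_mul_bounded (intB ih (int_cst (h t))) mk kM).
Qed.

Lemma cvg_V_trunc h t : int h -> I t -> lpt h t ->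
  (\int[mu]_(x in I) (h x * Vk b t x)) - trunc b h t @[b --> (0 : R)^'+] --> (0 : R).
Proof.
move=> ih It lh; have c0 := ct_gt0 It.
have t1 : 0 < 1 - `|t| by rewrite subr_gt0 I11_norm.
have mK e : 0 < e -> e < 1 -> measurable_fun I (fun x => Vk e t x - trk e t x).
  by move=> e0 _; apply: measurable_funB; [exact: measurable_Vk|exact: measurable_trk].
have C0 : 0 <= 4 / ct t by rewrite divr_ge0// ltW.
have H1 := cvg_kernel (intB ih (int_cst (h t))) lh C0 mK
  (fun e x p q Ix => @Vk_trk_le _ e t x p q It Ix).
have Kle e x : 0 < e -> e < 1 -> I x -> `|Vk e t x - trk e t x| <= 4 / ct t / e.
  move=> e0 e1 Ix; apply: (le_trans (Vk_trk_le e0 e1 It Ix)).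
  by rewrite ler_wpM2l// pk_le_inv.
have Vle e x : 0 < e -> e < 1 -> I x -> `|Vk e t x| <= 4 / ct t / e + e^-1.
  move=> e0 e1 Ix; rewrite -[Vk _ _ _](subrK (trk e t x)) (le_trans (ler_normD _ _))//.
  by rewrite lerD ?Kle// trk_le.
(* For the constant, domination by [pk] yields only boundedness; here the two explicit integrals
   have the common limit [ln (1 - t) - ln (1 + t)]. *)
have H2 : \int[mu]_(x in I) (1 * (Vk b t x - trk b t x)) @[b --> 0^'+] --> (0 : R).
  have lnc : (ln (aa b - t) - ln (aa b + t)) - (ln (1 - t) - ln (1 + t)) @[b --> 0^'+] --> (0 : R).
    have /andP[t2 t3] := (I11E t).1 It.
    rewrite -[X in _ --> X](subrr (ln (1 - t) - ln (1 + t))).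
    apply: cvgB; last exact: cvg_cst.
    have aa1 : aa b @[b --> 0^'+] --> (1 : R).
      apply: cvg_at_right_filter; rewrite /aa.
      rewrite -[X in _ --> X](_ : Num.sqrt (1 + 0 ^+ 2) = 1); last first.
        by rewrite expr0n/= addr0 sqrtr1.
      apply: continuous_cvg; first exact: sqrt_continuous.
      apply: cvgD; first exact: cvg_cst.
      exact: exprn_continuous.
    apply: cvgB; apply: continuous_cvg.
    - by apply: continuous_ln; lra.
    - by apply: cvgB => //; exact: cvg_cst.
    - by apply: continuous_ln; lra.
    - by apply: cvgD => //; exact: cvg_cst.
  apply: cvg_trans lnc; apply: near_eq_cvg.
  near=> b.
  have b0 : 0 < b by near: b; exact: nbhs_right_gt.
  have b1 : b < 1 by near: b; exact: nbhs_right_lt.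
  have bt : b < 1 - `|t| by near: b; exact: nbhs_right_lt.
  rewrite -integral_Vk// -(trunc_cst b0 bt It) -integral_trk//; last exact: int_cst.
  rewrite -RintegralB//.
  - by apply: eq_Rintegral => x _; rewrite mulrBr !mul1r.
  - have := int_mul_bounded (int_cst 1) (measurable_Vk b0 It) (fun x => Vle b x b0 b1).
    by under eq_fun do rewrite mul1r.
  - by apply: int_trk => //; exact: int_cst.
have : (\int[mu]_(x in I) ((h x - h t) * (Vk b t x - trk b t x))) +
   h t * (\int[mu]_(x in I) (1 * (Vk b t x - trk b t x))) @[b --> (0 : R)^'+] --> 0 + h t * 0.
  by apply: cvgD => //; apply: cvgM => //; exact: cvg_cst.
rewrite mulr0 addr0; apply: cvg_trans; apply: near_eq_cvg.
near=> b.
have b0 : 0 < b by near: b; exact: nbhs_right_gt.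
have b1 : b < 1 by near: b; exact: nbhs_right_lt.
rewrite -(kernel_split t ih (mK b b0 b1) (fun x => Kle b x b0 b1)).
rewrite -integral_trk// -RintegralB//.
- by apply: eq_Rintegral => x _; rewrite mulrBr.
- exact: (int_mul_bounded ih (measurable_Vk b0 It) (fun x => Vle b x b0 b1)).
- exact: int_trk.
Unshelve. all: by end_near. Qed.

(** The numerator [(aa b - 1) * (x + t)] is of order [b^2], one power better than domination by
    [pk]; [cvg_W_V] spends that power on the constant part. *)
Lemma Wk_Vk_le b t x : 0 < b -> b < 1 -> I t -> I x ->
  `|Wk b t x - Vk b t x| <= (ct t)^-1 * b * pk b t x.
Proof.
move=> b0 b1 It Ix; have D0 := Dk_gt0 x b0 It.
have a1 := aa_gt1 b0; have a2 := aaB1_le b0.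
have t1 := I11_norm It; have x1 := I11_norm Ix.
have -> : Wk b t x - Vk b t x = ((aa b - 1) * (x + t)) / Dk b t x.
  by rewrite /Wk /Vk; field; rewrite gt_eqF.
rewrite (mulrC _ b); apply: frac_Dk_le => //; first exact: ltW.
rewrite normrM (@ger0_norm _ (aa b - 1)); last lra.
apply: (@le_trans _ _ (b ^+ 2 / 2 * 2)); last by rewrite expr2; lra.
apply: ler_pM => //; first lra.
by rewrite (le_trans (ler_normD _ _))//; lra.
Qed.

Lemma cvg_W_V h t : int h -> I t -> lpt h t ->
  \int[mu]_(x in I) (h x * (Wk b t x - Vk b t x)) @[b --> 0^'+] --> (0 : R).
Proof.
move=> ih It lh; have c0 := ct_gt0 It.
have mK e : 0 < e -> e < 1 -> measurable_fun I (fun x => Wk e t x - Vk e t x).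
  by move=> e0 _; apply: measurable_funB; [exact: measurable_Wk|exact: measurable_Vk].
have C0 : 0 <= (ct t)^-1 by rewrite invr_ge0 ltW.
have Kle2 e x : 0 < e -> e < 1 -> I x -> `|Wk e t x - Vk e t x| <= (ct t)^-1 * pk e t x.
  move=> e0 e1 Ix; apply: (le_trans (Wk_Vk_le e0 e1 It Ix)).
  rewrite ler_wpM2r ?pk_ge0 ?(ltW e0)// ler_piMr// ltW//.
have H1 := cvg_kernel (intB ih (int_cst (h t))) lh C0 mK Kle2.
have M0 : (0 : R) <= 2 * `|1| by rewrite mulr_ge0.
have H2 := cvg_kernel_small (int_cst 1) (@ltr01 R) M0 (avg_le_cst 1 t) C0 mK
  (fun e x p q Ix => @Wk_Vk_le e t x p q It Ix).
have : (\int[mu]_(x in I) ((h x - h t) * (Wk b t x - Vk b t x))) +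
   h t * (\int[mu]_(x in I) (1 * (Wk b t x - Vk b t x))) @[b --> (0 : R)^'+] --> 0 + h t * 0.
  by apply: cvgD => //; apply: cvgM => //; exact: cvg_cst.
rewrite mulr0 addr0; apply: cvg_trans; apply: near_eq_cvg.
near=> b.
have b0 : 0 < b by near: b; exact: nbhs_right_gt.
have b1 : b < 1 by near: b; exact: nbhs_right_lt.
have Kle x : I x -> `|Wk b t x - Vk b t x| <= (ct t)^-1 / b.
  move=> Ix; apply: (le_trans (Kle2 _ _ b0 b1 Ix)).
  by rewrite ler_wpM2l// pk_le_inv.
by rewrite -(kernel_split t ih (mK b b0 b1) Kle).
Unshelve. all: by end_near. Qed.

Lemma Vk_le b t x : 0 < b -> b < 1 -> I t -> I x ->
  `|Vk b t x| <= 4 / ct t / b + b^-1.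
Proof.
move=> b0 b1 It Ix; rewrite -[Vk _ _ _](subrK (trk b t x)) (le_trans (ler_normD _ _))//.
rewrite lerD ?trk_le// (le_trans (Vk_trk_le b0 b1 It Ix))//.
by rewrite ler_wpM2l ?pk_le_inv// divr_ge0// ltW// ct_gt0.
Qed.

Lemma Wk_le b t x : 0 < b -> b < 1 -> I t -> I x ->
  `|Wk b t x| <= (ct t)^-1 / b + (4 / ct t / b + b^-1).
Proof.
move=> b0 b1 It Ix; rewrite -[Wk _ _ _](subrK (Vk b t x)) (le_trans (ler_normD _ _))//.
rewrite lerD ?Vk_le// (le_trans (Wk_Vk_le b0 b1 It Ix))//.
have c0 : 0 <= (ct t)^-1 by rewrite invr_ge0 ltW// ct_gt0.
apply: ler_pM; rewrite ?pk_le_inv ?pk_ge0 ?(ltW b0)//; first by rewrite mulr_ge0// ltW.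
by rewrite ler_piMr// ltW.
Qed.

Lemma cvg_trunc_V h t (L : R) : int h -> I t -> lpt h t ->
  \int[mu]_(x in I) (h x * Vk b t x) @[b --> (0 : R)^'+] --> L ->
  trunc b h t @[b --> (0 : R)^'+] --> L.
Proof.
move=> ih It lh HL.
have -> : (fun b => trunc b h t) = (fun b => (\int[mu]_(x in I) (h x * Vk b t x))
    - ((\int[mu]_(x in I) (h x * Vk b t x)) - trunc b h t)).
  by apply/funext => b; ring.
by rewrite -[L]subr0; apply: cvgB => //; exact: cvg_V_trunc.
Qed.

Lemma cvg_trunc_W h t (L : R) : int h -> I t -> lpt h t ->
  \int[mu]_(x in I) (h x * Wk b t x) @[b --> (0 : R)^'+] --> L ->
  trunc b h t @[b --> (0 : R)^'+] --> L.
Proof.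
move=> ih It lh HL; apply: cvg_trunc_V => //.
have H : (\int[mu]_(x in I) (h x * Wk b t x)) -
    (\int[mu]_(x in I) (h x * (Wk b t x - Vk b t x))) @[b --> (0 : R)^'+] --> L.
  by rewrite -[L]subr0; apply: cvgB => //; exact: cvg_W_V.
apply: cvg_trans H; apply: near_eq_cvg; near=> b => /=.
have b0 : 0 < b by near: b; exact: nbhs_right_gt.
have b1 : b < 1 by near: b; exact: nbhs_right_lt.
have iW : int (fun x => h x * Wk b t x).
  by apply: (int_mul_bounded ih (measurable_Wk b0 It)) => x; exact: (Wk_le b0 b1 It).
have iV : int (fun x => h x * Vk b t x).
  by apply: (int_mul_bounded ih (measurable_Vk b0 It)) => x; exact: (Vk_le b0 b1 It).
have -> : \int[mu]_(x in I) (h x * (Wk b t x - Vk b t x)) =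
   \int[mu]_(x in I) (h x * Wk b t x) - \int[mu]_(x in I) (h x * Vk b t x).
  by rewrite -RintegralB//; apply: eq_Rintegral => x _; rewrite mulrBr.
ring.
Unshelve. all: by end_near. Qed.

End PrincipalValue.

(** * Completeness and the Riesz-Fischer theorem *)

Section Completeness.
Context {R : realType}.
Local Notation mu := (@lebesgue_measure R).
Local Notation I := (@I11 R).
Implicit Types (h f g G u v : R -> R) (x t c M b y : R) (n m N k j : nat).

(** Cauchy-Schwarz for the measure [dx / w] of mass [pi], through
    [|h| <= 2^k / 2 * h^2 + 1 / (2 * 2^k)]; each term contributes half of [pi / 2^k]. *)
Lemma J_norm_le_sqr h k : measurable_fun I h -> wint (fun x => h x ^+ 2) ->
  J (fun x => h x ^+ 2) <= pi / 4 ^+ k -> J (fun x => `|h x|) <= pi / 2 ^+ k.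
Proof.
move=> mh ih Jh.
have p0 : 0 < 2 ^+ k :> R by rewrite exprn_gt0.
apply: (@le_trans _ _ (J (fun x => 2 ^+ k / 2 * h x ^+ 2 + (2 * 2 ^+ k)^-1 * 1))).
  apply: le_J; first exact/wint_norm/wint_sqr.
    by apply: wintD; [exact: wintZ|exact/wintZ/wint1].
  move=> x _; rewrite -(@real_normK _ (h x)) ?num_real//.
  have : 0 <= (2 ^+ k * `|h x| - 1) ^+ 2 / (2 * 2 ^+ k).
    by rewrite divr_ge0 ?sqr_ge0// mulr_ge0// ltW.
  rewrite [X in 0 <= X -> _](_ : _ = 2 ^+ k / 2 * `|h x| ^+ 2 + (2 * 2 ^+ k)^-1 * 1 - `|h x|).
    by rewrite subr_ge0.
  by field; rewrite gt_eqF.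
rewrite JD; [|exact: wintZ|exact/wintZ/wint1].
rewrite JZ// JZ; last exact: wint1.
have c0 : 0 <= 2 ^+ k / 2 :> R by rewrite divr_ge0// ltW.
rewrite J1; apply: (le_trans (lerD (ler_wpM2l c0 Jh) (lexx _))).
rewrite le_eqVlt; apply/orP; left; apply/eqP.
have -> : 4 ^+ k = 2 ^+ k * 2 ^+ k :> R by rewrite -exprMn; congr (_ ^+ _); ring.
by field; rewrite gt_eqF.
Qed.

Lemma limn_einf_ge0 (u : nat -> \bar R) : (forall n, 0 <= u n)%E -> (0 <= limn_einf u)%E.
Proof.
move=> u0; rewrite limn_einf_lim; apply: lime_ge; first exact: is_cvg_einfs.
by apply: nearW => n; apply: le_ereal_inf_tmp => _ [m _ <-]; exact: u0.
Qed.

Lemma limn_einf_le (u : nat -> \bar R) (c : \bar R) : (forall n, u n <= c)%E -> (limn_einf u <= c)%E.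
Proof.
move=> uc; rewrite limn_einf_lim; apply: lime_le; first exact: is_cvg_einfs.
apply: nearW => n; apply: (le_trans _ (uc n)); apply: ereal_inf_lbound.
by exists n => //=.
Qed.

Lemma measurable_fun_limn_einf (D : set R) (f : nat -> R -> \bar R) :
  (forall n, measurable_fun D (f n)) -> measurable_fun D (fun x => limn_einf (f^~ x)).
Proof.
move=> mf; rewrite (_ : (fun x => _) = (fun x => - limn_esup (-%E \o f^~ x))%E).
  apply: measurableT_comp => //.
  by apply: measurable_fun_limn_esup => n; exact: measurableT_comp.
by apply/funext => x; rewrite limn_esupN oppeK.
Qed.

Section fast_cauchy.
Variable S : nat -> R -> R.
Hypothesis mS : forall n, measurable_fun I (S n).
Hypothesis iS : forall n, wint (fun x => S n x ^+ 2).
Hypothesis cS : forall k j, (k <= j)%N ->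
  J (fun x => (S j x - S k x) ^+ 2) <= pi / 4 ^+ k.

Let iSB j k : wint (fun x => (S j x - S k x) ^+ 2).
Proof.
apply: eq_wint (wint_sqrD (mS j) (k := fun x => - S k x) _ (iS j) _) => //.
- by apply: measurableT_comp.
- by apply: eq_wint (iS k) => x _; rewrite sqrrN.
Qed.

Let mSB j k : measurable_fun I (fun x => S j x - S k x).
Proof. exact: measurable_funB. Qed.

Let d k x := `|S k.+1 x - S k x|.

Let d_ge0 k x : 0 <= d k x / w x.
Proof. by rewrite divr_ge0 ?w_ge0 /d. Qed.

Let wint_d k : wint (d k).
Proof. by apply/wint_norm/wint_sqr. Qed.

Let sum_fin : (\sum_(k <oo) \int[mu]_(x in I) (d k x / w x)%:E < +oo)%E.
Proof.
apply: (@le_lt_trans _ _ (\sum_(k <oo) (pi / 2 ^+ k)%:E)%E).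
  apply: lee_nneseries => [k _ _|k _].
    by apply: integral_ge0 => x _; rewrite lee_fin d_ge0.
  rewrite integral_wE// lee_fin; apply: (J_norm_le_sqr (mSB _ _) (iSB _ _)).
  exact: cS.
apply: (@le_lt_trans _ _ (2 * pi)%:E); last exact: ltry.
apply: lime_le.
  apply: is_cvg_nneseries => k _ _; rewrite lee_fin.
  by apply: divr_ge0; [exact: pi_ge0|exact: exprn_ge0].
apply: nearW => n; rewrite sumEFin lee_fin.
have -> : \sum_(0 <= k < n) pi / 2 ^+ k = (2 * pi) * (1 - (2 ^+ n)^-1) :> R.
  elim: n => [|n IH]; first by rewrite big_geq// expr0 invr1 subrr mulr0.
  rewrite big_nat_recr//= IH exprS; field.
  by rewrite gt_eqF// exprn_gt0.
by rewrite ler_piMr// ?mulr_ge0 ?pi_ge0// gerBl invr_ge0 exprn_ge0.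
Qed.

Let md k : measurable_fun I (fun x => (d k x / w x)%:E).
Proof. exact: measurable_int (wint_d k). Qed.

Let ae_fin : {ae mu, forall x, I x -> (\sum_(k <oo) (d k x / w x)%:E < +oo)%E}.
Proof.
have d0 k x : I x -> (0 <= (d k x / w x)%:E)%E.
  by move=> _; rewrite lee_fin d_ge0.
have iD : mu.-integrable I (fun x => \sum_(k <oo) (d k x / w x)%:E)%E.
  apply/integrableP; split.
    by apply: ge0_emeasurable_sum => [k x Ix _|k _]; [exact: d0|exact: md].
  under eq_integral => x /set_mem Ix.
    rewrite gee0_abs; last by apply: nneseries_ge0 => k _ _; exact: d0.
    over.
  by rewrite integral_nneseries.
have mI : measurable (I : set (measurableTypeR R)) by exact: measurable_itv.
apply: (ae_imp _ (integrable_ae mI iD)) => x /= h Ix.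
by have := h Ix; rewrite fin_numElt => /andP[].
Qed.

(** An upper limit is measurable and defined everywhere; [fine] replaces infinite values by 0, which
    by [ae_cvg] concerns a null set. *)
Let G x := fine (limn_esup (fun n => (S n x)%:E)).

Let mG : measurable_fun I G.
Proof.
apply: measurableT_comp; first exact: fine_measurable.
by apply: measurable_fun_limn_esup => n; exact/measurable_EFinP.
Qed.

Let ae_cvg : {ae mu, forall x, I x -> S n x @[n --> \oo] --> G x}.
Proof.
apply: (ae_imp _ ae_fin) => x /= h Ix; have {h}fx := h Ix.
have wx := w_gt0 Ix.
have cvS : cvgn (S^~ x).
  pose u k := S k.+1 x - S k x.
  have cu : cvgn (series u).
    apply: normed_cvg; rewrite [X in cvgn X](_ : _ = series (fun k => `|u k|)); last first.
      by apply/funext => n; rewrite /=.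
    apply: nondecreasing_is_cvgn.
      by apply/nondecreasing_seqP => n; rewrite /series/= big_nat_recr//= lerDl.
    exists (w x * fine (\sum_(k <oo) (d k x / w x)%:E)%E) => _ [n _ <-].
    rewrite mulrC -ler_pdivrMr// mulr_suml -lee_fin fineK; last first.
      rewrite ge0_fin_numE// nneseries_ge0// => k _ _.
      by rewrite lee_fin d_ge0.
    rewrite -sumEFin; apply: nneseries_lim_ge => k _ _.
    by rewrite lee_fin divr_ge0 ?w_ge0.
  have -> : S^~ x = (fun n => S 0%N x + series u n).
    by apply/funext => n; rewrite /series/= telescope_sumr// addrC subrK.
  by apply: is_cvgD => //; exact: is_cvg_cst.
have HE : (S n x)%:E @[n --> \oo] --> (limn (S^~ x))%:E.
  by apply: cvg_EFin => //; exact: nearW.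
by rewrite /G (cvg_limn_einf_sup HE).2.
Qed.

(** Summability of the [L^1] norms of the increments gives convergence almost everywhere, and
    Fatou's lemma transfers the quadratic bounds to the limit. *)
Lemma fast_cauchy : exists G, [/\ measurable_fun I G, wint (fun x => G x ^+ 2) &
  forall k, J (fun x => (G x - S k x) ^+ 2) <= pi / 4 ^+ k].
Proof.
have mGS k : measurable_fun I (fun x => G x - S k x) by exact: measurable_funB.
have mE (h : R -> R) : measurable_fun I h ->
    measurable_fun I (fun x => (h x ^+ 2 / w x)%:E).
  by move=> mh; apply/measurable_EFinP; apply: measurable_divw; exact: measurable_funX.
have H k : (\int[mu]_(x in I) ((G x - S k x) ^+ 2 / w x)%:E <= (pi / 4 ^+ k)%:E)%E.
  have mI : measurable (I : set (measurableTypeR R)) by exact: measurable_itv.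
  have := fatou mu mI (fun n => mE _ (mSB (n + k) k)).
  have p0 n x : I x -> (0 <= ((S (n + k) x - S k x) ^+ 2 / w x)%:E)%E.
    by move=> _; rewrite lee_fin divr_ge0 ?sqr_ge0 ?w_ge0.
  move=> /(_ p0) F.
  apply: (le_trans (le_trans _ F)).
    apply: ae_ge0_le_integral => //.
    - by move=> x _; rewrite lee_fin divr_ge0 ?sqr_ge0 ?w_ge0.
    - exact: mE.
    - by move=> x Ix; apply: limn_einf_ge0 => n; exact: p0.
    - apply: measurable_fun_limn_einf => n; exact: mE.
    - apply: (ae_imp _ ae_cvg) => x /= h Ix; have {h}cx := h Ix.
      rewrite le_eqVlt; apply/orP; left; apply/eqP/esym.
      apply: (cvg_limn_einf_sup _).1.
      apply: cvg_EFin; first exact: nearW.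
      apply: cvgM; last exact: cvg_cst.
      have cx' : S (n + k) x - S k x @[n --> \oo] --> G x - S k x.
        apply: cvgB; last exact: cvg_cst.
        by rewrite -(cvg_shiftn k) in cx.
      by rewrite expr2; under eq_fun do rewrite expr2; apply: cvgM.
  apply: limn_einf_le => n.
  by rewrite integral_wE ?lee_fin ?cS ?leq_addl.
have iGS k : wint (fun x => (G x - S k x) ^+ 2).
  apply/integrableP; split; first exact: mE.
  apply: (@le_lt_trans _ _ (pi / 4 ^+ k)%:E); last exact: ltry.
  apply: le_trans (H k); apply: ge0_le_integral => //.
  - by apply: measurableT_comp => //; exact: mE.
  - exact: mE.
  - by move=> x Ix /=; rewrite lee_fin ger0_norm// divr_ge0 ?sqr_ge0 ?w_ge0.
exists G; split => //.
  apply: eq_wint (wint_sqrD (mGS 0%N) (mS 0%N) (iGS 0%N) (iS 0%N)) => x _.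
  by rewrite subrK.
by move=> k; rewrite -lee_fin -integral_wE.
Qed.

End fast_cauchy.
End Completeness.

(** * Bessel's inequality and Riesz-Fischer for a bounded orthogonal system *)

Section RieszFischer.
Context {R : realType}.
Local Notation mu := (@lebesgue_measure R).
Local Notation I := (@I11 R).
Implicit Types (h f g G u v : R -> R) (x t b y : R) (n m N M k j : nat) (c : nat -> R).

Variable e : nat -> R -> R.
Hypothesis me : forall n, measurable_fun I (e n).
Hypothesis e1 : forall n x, I x -> `|e n x| <= 1.
Hypothesis e_orth : forall n m, (m < n)%N -> J (fun x => e n x * e m x) = 0.
Hypothesis e_norm : forall n, J (fun x => e n x ^+ 2) = pi / 2.

Definition psum c N x := \sum_(n < N) c n * e n x.

Lemma measurable_psum c N : measurable_fun I (psum c N).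
Proof. by apply: measurable_sum => n; apply: measurable_funM. Qed.

Lemma wint_eM n f : wint f -> wint (fun x => e n x * f x).
Proof. by move=> wf; apply: (wintMl (me n) (e1 n)). Qed.

Lemma wint_e n : wint (e n).
Proof. exact: (wint_bounded (me n) (e1 n)). Qed.

Lemma wint_psumM c N f : wint f -> wint (fun x => psum c N x * f x).
Proof.
move=> wf; rewrite (_ : (fun x => _) = (fun x => \sum_(n < N) c n * (e n x * f x))).
  by apply: wint_sum => i _; apply: wintZ; exact: wint_eM.
by apply/funext => x; rewrite mulr_suml; apply: eq_bigr => i _; rewrite mulrA.
Qed.

Lemma J_psumM c N f : wint f ->
  J (fun x => psum c N x * f x) = \sum_(n < N) c n * J (fun x => e n x * f x).
Proof.
move=> wf; rewrite (_ : (fun x => _) = (fun x => \sum_(n < N) c n * (e n x * f x))).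
  rewrite J_sum => [|i _]; last by apply: wintZ; exact: wint_eM.
  by apply: eq_bigr => i _; rewrite JZ//; exact: wint_eM.
by apply/funext => x; rewrite mulr_suml; apply: eq_bigr => i _; rewrite mulrA.
Qed.

Lemma wint_psum c N : wint (psum c N).
Proof.
by apply: eq_wint (wint_psumM c N (@wint1 R)) => x _; rewrite mulr1.
Qed.

Lemma wint_psum_sqr c N : wint (fun x => psum c N x ^+ 2).
Proof. exact: wint_psumM (wint_psum c N). Qed.

Lemma J_e_e n m : J (fun x => e n x * e m x) = if n == m then pi / 2 else 0.
Proof.
case: eqVneq => [->|]; first by rewrite -(e_norm m).
rewrite neq_ltn => /orP[nm|]; last exact: e_orth.
rewrite -(e_orth nm); congr J; apply/funext => x; exact: mulrC.
Qed.

Lemma J_psum_e c N m : J (fun x => psum c N x * e m x) = if (m < N)%N then c m * (pi / 2) else 0.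
Proof.
rewrite J_psumM; last exact: wint_e.
under eq_bigr do rewrite J_e_e.
case: ifPn => mN.
  rewrite (bigD1 (Ordinal mN))//= eqxx big1 ?addr0// => i im.
  by rewrite ifF ?mulr0//; apply/negbTE.
rewrite big1// => i _; rewrite ifF ?mulr0//.
by apply/negbTE; apply: contraNneq mN => <-.
Qed.

Lemma J_psum_sqr c N : J (fun x => psum c N x ^+ 2) = pi / 2 * \sum_(n < N) c n ^+ 2.
Proof.
rewrite [LHS](J_psumM c N (wint_psum c N)) mulr_sumr; apply: eq_bigr => n _.
rewrite [X in _ * X](_ : _ = J (fun x => psum c N x * e n x)); last first.
  by congr J; apply/funext => x; exact: mulrC.
by rewrite J_psum_e ltn_ord; ring.
Qed.

Lemma psumB c N M : (N <= M)%N -> (fun x => psum c M x - psum c N x) =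
  psum (fun n => if (n < N)%N then 0 else c n) M.
Proof.
move=> NM; apply/funext => x; rewrite /psum.
rewrite -!(big_mkord xpredT (fun n => c n * e n x)).
rewrite -(big_mkord xpredT (fun n => (if (n < N)%N then 0 else c n) * e n x)).
rewrite (big_cat_nat (leq0n N) NM)/= [RHS](big_cat_nat (leq0n N) NM)/=.
rewrite [LHS]addrC addKr [X in _ = X + _]big_nat [X in _ = X + _]big1 => [|i /andP[_ iN]]; last by rewrite iN mul0r.
rewrite add0r [LHS]big_nat [RHS]big_nat; apply: eq_bigr => i /andP[Ni _].
by rewrite ltnNge Ni.
Qed.

Lemma J_psumB_sqr c N M : (N <= M)%N ->
  J (fun x => (psum c M x - psum c N x) ^+ 2) =
  pi / 2 * (\sum_(n < M) c n ^+ 2 - \sum_(n < N) c n ^+ 2).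
Proof.
move=> NM.
have -> : (fun x => (psum c M x - psum c N x) ^+ 2) =
    (fun x => psum (fun n => if (n < N)%N then 0 else c n) M x ^+ 2).
  by apply/funext => x; rewrite -(psumB c NM).
rewrite J_psum_sqr; congr (_ * _).
rewrite -!(big_mkord xpredT (fun n => c n ^+ 2)).
rewrite -(big_mkord xpredT (fun n => (if (n < N)%N then 0 else c n) ^+ 2)).
rewrite (big_cat_nat (leq0n N) NM)/= [in RHS](big_cat_nat (leq0n N) NM)/=.
rewrite [RHS]addrC addKr [X in X + _ = _]big_nat [X in X + _ = _]big1 => [|i /andP[_ iN]]; last by rewrite iN expr0n.
rewrite add0r [LHS]big_nat [RHS]big_nat; apply: eq_bigr => i /andP[Ni _].
by rewrite ltnNge Ni.
Qed.

Lemma bessel f N : measurable_fun I f -> wint (fun x => f x ^+ 2) ->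
  \sum_(n < N) (2 / pi * J (fun x => e n x * f x)) ^+ 2 <= 2 / pi * J (fun x => f x ^+ 2).
Proof.
move=> mf wf2; have wf := wint_sqr mf wf2.
set c := fun n => 2 / pi * J (fun x => e n x * f x).
have p0 := @pi_gt0 R; have pn0 := lt0r_neq0 p0.
have wPf := wint_psumM c N wf.
have : 0 <= J (fun x => (psum c N x - f x) ^+ 2).
  by apply: J_ge0 => x _; exact: sqr_ge0.
have -> : J (fun x => (psum c N x - f x) ^+ 2) =
   J (fun x => psum c N x ^+ 2) + J (fun x => f x ^+ 2) - 2 * J (fun x => psum c N x * f x).
  rewrite -JZ// -JD//; last exact: wint_psum_sqr.
  rewrite -JB.
  - by congr J; apply/funext => x; ring.
  - by apply: wintD => //; exact: wint_psum_sqr.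
  - exact: wintZ.
rewrite J_psum_sqr J_psumM//.
have -> : \sum_(n < N) c n * J (fun x => e n x * f x) = pi / 2 * \sum_(n < N) c n ^+ 2.
  rewrite mulr_sumr; apply: eq_bigr => n _; rewrite /c.
  by move: pn0; move: (J _) (pi : R) => a p pn; field; exact: pn.
move=> H; rewrite -(@ler_pM2l _ (pi / 2)) ?divr_gt0//.
have -> : pi / 2 * (2 / pi * J (fun x => f x ^+ 2)) = J (fun x => f x ^+ 2).
  by move: pn0; move: (J _) (pi : R) => a p pn; field; exact: pn.
lra.
Qed.

(** The last clause reflects that [G] is a limit of combinations of the [e n]. For the cosines of
    positive index it is applied to the constant 1 and gives [J G = 0]. *)
Lemma riesz_fischer c (B : R) : (forall N, \sum_(n < N) c n ^+ 2 <= B) ->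
  exists G, [/\ measurable_fun I G, wint (fun x => G x ^+ 2),
    (forall m, J (fun x => e m x * G x) = c m * (pi / 2)) &
    (forall h, measurable_fun I h -> (forall x, I x -> `|h x| <= 1) ->
       (forall n, J (fun x => h x * e n x) = 0) -> J (fun x => h x * G x) = 0)].
Proof.
move=> cB.
pose T N := \sum_(n < N) c n ^+ 2.
have Tnd : nondecreasing_seq T.
  by apply/nondecreasing_seqP => n; rewrite /T big_ord_recr/= lerDl sqr_ge0.
have Tcv : cvgn T.
  by apply: nondecreasing_is_cvgn => //; exists B => _ [n _ <-]; exact: cB.
have Tlim N : T N <= limn T by exact: nondecreasing_cvgn_le.
have exN k : exists N, limn T - 1 / 4 ^+ k <= T N.
  have : \forall N \near \oo, limn T - 1 / 4 ^+ k <= T N.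
    apply: (cvgr_ge (limn T)) => //.
    by rewrite ltrBlDr ltrDl divr_gt0// exprn_gt0.
  by move=> [N _ HN]; exists N; apply: HN => /=.
have [N0 HN0] := choice exN.
(* The sum makes [NN] nondecreasing and at least [N0]; the summand [k] ensures that the coefficient
   of index [m] is present in [S k] as soon as [k > m]. *)
pose NN k := ((\sum_(i < k.+1) N0 i) + k)%N.
have NNm : {homo NN : k j / (k <= j)%N}.
  apply: homo_leq => // [x y z|k]; first exact: leq_trans.
  by rewrite /NN (big_ord_recr k.+1)/= leq_add ?leqnSn// leq_addr.
have NNk k : (k <= NN k)%N by rewrite /NN leq_addl.
have NN0 k : (N0 k <= NN k)%N by rewrite /NN big_ord_recr/= addnAC leq_addl.
pose S k := psum c (NN k).
have cS k j : (k <= j)%N -> J (fun x => (S j x - S k x) ^+ 2) <= pi / 4 ^+ k.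
  move=> kj; rewrite /S J_psumB_sqr ?NNm//.
  have h1 := Tlim (NN j); have h2 := HN0 k; have h3 := Tnd _ _ (NN0 k).
  rewrite (_ : pi / 4 ^+ k = pi / 2 * (2 * (1 / 4 ^+ k))); last by move: (pi : R) => ?; field; rewrite gt_eqF// exprn_gt0.
  have i0 : 0 <= 1 / 4 ^+ k :> R by rewrite divr_ge0// exprn_ge0.
  rewrite ler_pM2l ?divr_gt0 ?pi_gt0// -/(T _) -/(T _); lra.
have mS n : measurable_fun I (S n) by exact: measurable_psum.
have [G [mG iG GS]] := fast_cauchy mS (fun n => wint_psum_sqr c (NN n)) cS.
have wG := wint_sqr mG iG.
(* Pairing a function bounded by 1 with [G] instead of [S k] costs at most the [L^1] error
   [pi / 2^k], so an eventually constant pairing passes to [G]. *)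
have key h (z : R) k0 : measurable_fun I h -> (forall x, I x -> `|h x| <= 1) ->
    (forall k, (k0 <= k)%N -> J (fun x => h x * S k x) = z) -> J (fun x => h x * G x) = z.
  move=> mh h1 hv; apply/eqP; rewrite -subr_eq0 -normr_le0.
  have cv0 : pi / 2 ^+ k @[k --> \oo] --> (0 : R).
    rewrite -(mulr0 pi); apply: cvgM; first exact: cvg_cst.
    rewrite (_ : (fun k => _) = (fun k => 2^-1 ^+ k)).
      by apply: cvg_expr; rewrite ger0_norm ?invr_ge0// invf_lt1// ltr1n.
    by apply/funext => k; rewrite exprVn.
  rewrite -(cvg_lim (@norm_hausdorff _ _) cv0).
  apply: limr_ge; first exact: cvgP cv0.
  exists k0 => // k /= k0k.
  have wSk : wint (S k) by exact: wint_psum.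
  have mGS : measurable_fun I (fun x => G x - S k x) by exact: measurable_funB.
  have wGS : wint (fun x => G x - S k x) by exact: wintB.
  have wGS2 : wint (fun x => (G x - S k x) ^+ 2).
    apply: eq_wint (wintB (wintD iG (wint_psum_sqr c (NN k)))
      (wintZ 2 (wint_mul mG (mS k) iG (wint_psum_sqr c (NN k))))) => x _.
    by rewrite /S; ring.
  rewrite -(hv k k0k) -JB; [|exact: wintMl h1 wG|exact: wintMl h1 wSk].
  have -> : (fun x => h x * G x - h x * S k x) = (fun x => h x * (G x - S k x)).
    by apply/funext => x; rewrite mulrBr.
  have whGS : wint (fun x => h x * (G x - S k x)) by exact: wintMl h1 wGS.
  apply: (le_trans (le_normr_J whGS)).
  apply: (le_trans _ (J_norm_le_sqr mGS wGS2 (GS k))).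
  apply: le_J; [exact: wint_norm|exact: wint_norm|].
  by move=> x Ix; rewrite normrM ler_piMl// h1.
exists G; split => //.
- move=> m; apply: (key _ _ m.+1) => // [|k mk]; first exact: e1.
  rewrite (_ : (fun x => _) = (fun x => psum c (NN k) x * e m x)).
    by rewrite J_psum_e (leq_trans mk).
  by apply/funext => x; rewrite mulrC.
- move=> h mh h1 hv; apply: (key _ _ 0%N) => // k _.
  rewrite (_ : (fun x => _) = (fun x => psum c (NN k) x * h x)); last first.
    by apply/funext => x; rewrite mulrC.
  rewrite J_psumM; last exact: wint_bounded mh h1.
  rewrite big1// => i _; rewrite (_ : (fun x => _) = (fun x => h x * e i x)) ?hv ?mulr0//.
  by apply/funext => x; rewrite mulrC.
Qed.

End RieszFischer.

(** * Inversion of the transforms *)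

Section Inversion.
Context {R : realType}.
Local Notation mu := (@lebesgue_measure R).
Local Notation I := (@I11 R).
Implicit Types (h f g F G u v : R -> R) (x t b y : R) (n m N k j : nat).

Local Notation int u := (mu.-integrable I (EFin \o u)).

Let CnS n : R -> R := Cn n.+1.
Let SnS n : R -> R := Sn n.+1.

Let mCnS n : measurable_fun I (CnS n). Proof. exact: measurable_Cn. Qed.
Let mSnS n : measurable_fun I (SnS n). Proof. exact: measurable_Sn. Qed.
Let CnS1 n x : I x -> `|CnS n x| <= 1. Proof. by move=> _; exact: Cn_le1. Qed.
Let SnS1 n x : I x -> `|SnS n x| <= 1. Proof. by move=> _; exact: Sn_le1. Qed.
Let CnS_orth n m : (m < n)%N -> J (fun x => CnS n x * CnS m x) = 0.
Proof. by move=> mn; exact: J_CnCn. Qed.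
Let SnS_orth n m : (m < n)%N -> J (fun x => SnS n x * SnS m x) = 0.
Proof. by move=> mn; exact: J_SnSn. Qed.
Let CnS_norm n : J (fun x => CnS n x ^+ 2) = pi / 2. Proof. exact: J_Cn_sqr. Qed.
Let SnS_norm n : J (fun x => SnS n x ^+ 2) = pi / 2. Proof. exact: J_Sn_sqr. Qed.

Lemma pi_neq0 : pi != 0 :> R.
Proof. exact: lt0r_neq0 (pi_gt0 R). Qed.

Let coefK (z : R) : - (2 / pi * z) * (pi / 2) = - z.
Proof. by move: pi_neq0; move: (pi : R) => p p0; field; exact: p0. Qed.

(** Bessel for the sines makes the coefficients square summable, Riesz-Fischer for the cosines
    realises them. At [n = 0], where [Sn 0 = 0], the relation is the vanishing mean of [G]. *)
Lemma exists_conj_sin f : measurable_fun I f -> wint (fun x => f x ^+ 2) ->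
  exists G, [/\ measurable_fun I G, wint (fun x => G x ^+ 2), J G = 0 &
    forall n, J (fun x => Cn n x * G x) = - J (fun x => Sn n x * f x)].
Proof.
move=> mf wf2.
pose c n := - (2 / pi * J (fun x => SnS n x * f x)).
have cB N : \sum_(n < N) c n ^+ 2 <= 2 / pi * J (fun x => f x ^+ 2).
  by under eq_bigr do rewrite /c sqrrN; exact: (bessel mSnS SnS1 SnS_orth SnS_norm).
have [G [mG wG2 cG orthG]] := riesz_fischer mCnS CnS1 CnS_orth CnS_norm cB.
have JG : J G = 0.
  rewrite -[RHS](orthG (fun=> 1))//; first by congr J; apply/funext => x; rewrite mul1r.
    by move=> x _; rewrite normr1.
  by move=> n; rewrite -(@J_Cn R n.+1)//; congr J; apply/funext => x; rewrite mul1r.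
exists G; split => // -[|n].
  rewrite (_ : (fun x => Cn 0 x * _) = G); last by apply/funext => x; rewrite Cn0 mul1r.
  rewrite (_ : (fun x => Sn 0 x * _) = (fun=> 0)) ?J0 ?oppr0//.
  by apply/funext => x; rewrite Sn0 mul0r.
by rewrite [LHS]cG /c coefK.
Qed.

(** Index 0 is excluded because there the relation would force [J g = 0]. *)
Lemma exists_conj_cos g : measurable_fun I g -> wint (fun x => g x ^+ 2) ->
  exists F, [/\ measurable_fun I F, wint (fun x => F x ^+ 2) &
    forall n, (0 < n)%N -> J (fun x => Sn n x * F x) = - J (fun x => Cn n x * g x)].
Proof.
move=> mg wg2.
pose c n := - (2 / pi * J (fun x => CnS n x * g x)).
have cB N : \sum_(n < N) c n ^+ 2 <= 2 / pi * J (fun x => g x ^+ 2).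
  by under eq_bigr do rewrite /c sqrrN; exact: (bessel mCnS CnS1 CnS_orth CnS_norm).
have [F [mF wF2 cF _]] := riesz_fischer mSnS SnS1 SnS_orth SnS_norm cB.
exists F; split => // -[//|n] _.
by rewrite [LHS]cF /c coefK.
Qed.

Lemma J_half_Pk b t G : 0 < b -> b < 1 -> I t -> wint G ->
  J (fun x => (1 + Pk b t x) / 2 * G x) = (J G + J (fun x => Pk b t x * G x)) / 2.
Proof.
move=> b0 b1 It wG.
have bP x : I x -> `|Pk b t x| <= 3 / ct t / b.
  move=> Ix; apply: (le_trans (Pk_le b0 b1 It Ix)).
  by rewrite ler_wpM2l ?pk_le_inv// divr_ge0// ltW// ct_gt0.
have wP : wint (fun x => Pk b t x * G x) by exact: wintMl (measurable_Pk b0 It) bP wG.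
rewrite -JD// mulrC -JZ; last exact: wintD.
by congr J; apply/funext => x; ring.
Qed.

Lemma J_half (k : R -> R) (c M : R) G : measurable_fun I k -> (forall x, I x -> `|k x| <= M) ->
  wint G -> J (fun x => c * k x * G x) = c * J (fun x => k x * G x).
Proof.
move=> mk kM wG; rewrite -JZ; last exact: wintMl mk kM wG.
by congr J; apply/funext => x; rewrite mulrA.
Qed.

Lemma J_wM f (k : R -> R) : J (fun x => w x * k x * f x) = \int[mu]_(x in I) (f x * k x).
Proof.
by apply: eq_Rintegral => x /set_mem Ix; have := w_neq0 Ix; move: (w x) => u u0; field.
Qed.

(** One Abel sum is evaluated twice. By [sum_CC] it tends to [J (Pk G) / 2]; by the coefficient
    relation and [sum_CS] it tends to half the integral of [f * Vk], the factor [w x] cancelling the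
    weight. Hence both integrals agree for every small [b]. *)
Lemma cvg_trunc_sin f G t : wint f -> wint G -> J G = 0 ->
  (forall n, J (fun x => Cn n x * G x) = - J (fun x => Sn n x * f x)) ->
  I t -> lpt f t -> lpt G t -> trunc b f t @[b --> (0 : R)^'+] --> pi * G t.
Proof.
move=> wf wG JG0 HfG It lf lG; apply: cvg_trunc_V => //; first exact: wint_int.
have := cvg_J_Pk wG It lG; apply: cvg_trans; apply: near_eq_cvg; near=> b.
have b0 : 0 < b by near: b; exact: nbhs_right_gt.
have b1 : b < 1 by near: b; exact: nbhs_right_lt.
have H1 := sum_CC b0 It wG.
have H2 := sum_CS b0 It wf.
have E N : \sum_(n < N) rr b ^+ n * Cn n t * J (fun x => Cn n x * G x) =
   - \sum_(n < N) rr b ^+ n * Cn n t * J (fun x => Sn n x * f x).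
  by rewrite -sumrN; apply: eq_bigr => i _; rewrite HfG mulrN.
move: H1; rewrite (eq_cvg _ _ E) => H1.
have := cvg_unique (@norm_hausdorff _ _) H1 (cvgN H2).
move=> /(_ _ _); rewrite J_half_Pk// JG0 add0r.
have bV x : I x -> `|Vk b t x| <= 4 / ct t / b + b^-1 by exact: Vk_le.
have mwV : measurable_fun I (fun x => w x * Vk b t x).
  by apply: measurable_funM; [exact: measurable_w|exact: measurable_Vk].
have bwV x : I x -> `|w x * Vk b t x| <= 4 / ct t / b + b^-1.
  move=> Ix; rewrite normrM (le_trans _ (bV x Ix))// ler_piMl// (ger0_norm (w_ge0 x)).
  exact: w_le1.
have -> : J (fun x => - (w x * Vk b t x) / 2 * f x) = - 2^-1 * J (fun x => w x * Vk b t x * f x).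
  rewrite -(J_half _ mwV bwV wf); congr J; apply/funext => x; ring.
rewrite J_wM; move: (Rintegral _ _ _) (J _) => p q; lra.
Unshelve. all: by end_near. Qed.

(** The same double evaluation with [sum_SS] and [sum_SC]. The kernel is now [w t * Wk], with the
    weight at the fixed point [t]; this produces the division by [w t]. *)
Lemma cvg_trunc_cos g F t : wint g -> wint F ->
  (forall n, (0 < n)%N -> J (fun x => Sn n x * F x) = - J (fun x => Cn n x * g x)) ->
  I t -> lpt (fun x => g x / w x) t -> lpt F t ->
  trunc b (fun x => g x / w x) t @[b --> (0 : R)^'+] --> - (pi * F t / w t).
Proof.
move=> wg wF HgF It lg lF; apply: cvg_trunc_W => //.
have HS := cvg_J_Sk wF It lF.
have wt := w_neq0 It.
have : - (J (fun x => Sk b t x * F x) / w t) @[b --> (0 : R)^'+] --> - (pi * F t / w t).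
  by apply: cvgN; apply: cvgM => //; exact: cvg_cst.
apply: cvg_trans; apply: near_eq_cvg; near=> b.
have b0 : 0 < b by near: b; exact: nbhs_right_gt.
have b1 : b < 1 by near: b; exact: nbhs_right_lt.
have H1 := sum_SS b0 It wF.
have H2 := sum_SC b0 It wg.
have E N : \sum_(n < N) rr b ^+ n * Sn n t * J (fun x => Sn n x * F x) =
   - \sum_(n < N) rr b ^+ n * Sn n t * J (fun x => Cn n x * g x).
  rewrite -sumrN; apply: eq_bigr => i _.
  (* At index 0, which the relation does not cover, both terms vanish because [Sn 0 t = 0]. *)
  have [i0|i0] := posnP i; last by rewrite HgF// mulrN.
  by rewrite i0 Sn0 mulr0 !mul0r oppr0.
move: H1; rewrite (eq_cvg _ _ E) => H1.
have := cvg_unique (@norm_hausdorff _ _) H1 (cvgN H2).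
move=> /(_ _ _).
have bW x : I x -> `|Wk b t x| <= (ct t)^-1 / b + (4 / ct t / b + b^-1) by exact: Wk_le.
have bS x : I x -> `|Sk b t x| <= 2 / (1 - `|t|) / ct t * b + 3 / ct t / b.
  move=> Ix; rewrite -[Sk _ _ _](subrK (Pk b t x)) (le_trans (ler_normD _ _))//.
  rewrite lerD ?Sk_Pk_le// (le_trans (Pk_le b0 b1 It Ix))//.
  by rewrite ler_wpM2l ?pk_le_inv// divr_ge0// ltW// ct_gt0.
have -> : J (fun x => Sk b t x / 2 * F x) = 2^-1 * J (fun x => Sk b t x * F x).
  rewrite -(J_half _ (measurable_Sk b0 It) bS wF); congr J; apply/funext => x; ring.
have -> : J (fun x => w t * Wk b t x / 2 * g x) = w t / 2 * J (fun x => Wk b t x * g x).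
  rewrite -(J_half _ (measurable_Wk b0 It) bW wg); congr J; apply/funext => x; ring.
have -> : \int[mu]_(x in I) (g x / w x * Wk b t x) = J (fun x => Wk b t x * g x).
  by apply: eq_Rintegral => x _; ring.
move: (J (fun x => Sk b t x * F x)) (J (fun x => Wk b t x * g x)) => p q pq.
have -> : p = - (w t * q) by lra.
by field.
Unshelve. all: by end_near. Qed.

End Inversion.

(** * Moments of conjugate functions *)

Section Moments.
Context {R : realType}.
Local Notation mu := (@lebesgue_measure R).
Local Notation I := (@I11 R).
Local Open Scope complex_scope.
Implicit Types (h f g F G u v : R -> R) (x t b y : R) (n m N k j q : nat).

Lemma cReM (z1 z2 : R[i]) :
  complex.Re (z1 * z2) = complex.Re z1 * complex.Re z2 - complex.Im z1 * complex.Im z2.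
Proof. by case: z1 => a b; case: z2. Qed.

Lemma cImM (z1 z2 : R[i]) :
  complex.Im (z1 * z2) = complex.Re z1 * complex.Im z2 + complex.Im z1 * complex.Re z2.
Proof. by case: z1 => a b; case: z2. Qed.

Lemma cReD (z1 z2 : R[i]) : complex.Re (z1 + z2) = complex.Re z1 + complex.Re z2.
Proof. by case: z1 => a b; case: z2. Qed.

Lemma cRe_sum (T : Type) (s : seq T) (P : pred T) (z : T -> R[i]) :
  complex.Re (\sum_(i <- s | P i) z i) = \sum_(i <- s | P i) complex.Re (z i).
Proof. by apply: (big_morph _ cReD). Qed.

Lemma expC_i2 k : ('i%C : R[i]) ^+ k.*2 = ((-1) ^+ k)%:C.
Proof.
elim: k => [|k IH]; first by rewrite expr0.
rewrite doubleS -addn2 exprD IH sqr_i exprS (_ : -1 = (-1)%:C :> R[i]).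
  by rewrite -rmorphM mulrC.
by apply/eqP; rewrite eq_complex /= oppr0 !eqxx.
Qed.

Lemma Re_term (A B : R) n j : complex.Re ((B *i) ^+ n * A%:C ^+ j) =
  if odd n then 0 else (-1) ^+ n./2 * B ^+ n * A ^+ j.
Proof.
have -> : B *i = 'i%C * B%:C :> R[i] by apply/eqP; rewrite eq_complex /=; apply/andP; split; apply/eqP; ring.
rewrite exprMn -(mulrA ('i%C ^+ n)) -!rmorphXn -rmorphM.
have [no|no] := boolP (odd n).
  rewrite -[n in 'i%C ^+ n]odd_double_half no add1n exprS expC_i2 -mulrA -rmorphM.
  by rewrite cReM/= mul0r mulr0 subr0.
rewrite -[n in 'i%C ^+ n]odd_double_half (negbTE no) add0n expC_i2 -rmorphM.
by rewrite mulrA.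
Qed.

Lemma sum_double (F : nat -> R) k :
  \sum_(i < k.*2) F i = \sum_(q < k) (F q.*2 + F q.*2.+1).
Proof.
elim: k => [|k IH]; first by rewrite !big_ord0.
by rewrite doubleS !big_ord_recr/= IH addrA.
Qed.

(** Only even powers of [i B] are real, and as [|B| <= 1] each of these terms is at least minus its
    binomial coefficient times the even power of [A]. *)
Lemma Re_exp_ge (A B : R) k : `|B| <= 1 ->
  A ^+ k.*2 - \sum_(q < k) 'C(k.*2, q.*2)%:R * A ^+ q.*2 <= complex.Re ((A +i* B) ^+ k.*2).
Proof.
move=> B1.
have -> : A +i* B = B *i + A%:C by apply/eqP; rewrite eq_complex /=; apply/andP; split; apply/eqP; ring.
rewrite exprDn cRe_sum.
have E i : complex.Re ((B *i) ^+ (k.*2 - i) * A%:C ^+ i *+ 'C(k.*2, i)) =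
  'C(k.*2, i)%:R * (if odd (k.*2 - i) then 0 else (-1) ^+ (k.*2 - i)./2 * B ^+ (k.*2 - i) * A ^+ i).
  rewrite -Re_term -mulr_natl -(rmorph_nat (real_complex R)) cReM/= mul0r subr0.
  by [].
under [leRHS]eq_bigr do rewrite E.
rewrite [leRHS]big_ord_recr/= subnn/= binn !expr0 !mul1r addrC lerD2l.
rewrite (sum_double (fun i => 'C(k.*2, i)%:R * (if odd (k.*2 - i) then 0 else
  (-1) ^+ (k.*2 - i)./2 * B ^+ (k.*2 - i) * A ^+ i))).
rewrite -sumrN; apply: ler_sum => q _.
have qk : (q.*2.+1 < k.*2)%N by rewrite -doubleS leq_double.
rewrite !oddB ?(ltnW qk)// ?(ltnW (ltnW qk))//= !odd_double/= mulr0 addr0.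
rewrite -mulrN ler_wpM2l//.
rewrite -[X in - X]mul1r -mulNr ler_wpM2r//.
  by rewrite -mul2n mulnC exprM sqr_ge0.
have : `|(-1) ^+ (k.*2 - q.*2)./2 * B ^+ (k.*2 - q.*2)| <= 1.
  by rewrite normrM normrX normrN1 expr1n mul1r normrX exprn_ile1.
by rewrite ler_norml => /andP[].
Qed.

Lemma fact_double_ge k : (2 ^ k <= (k.*2)`!)%N.
Proof.
elim: k => // k IH; rewrite doubleS expnS !factS.
by rewrite mulnA leq_mul// mulnS leq_addr.
Qed.

(** By induction the term of index [q] is at most [pi * (2k)! / (2k - 2q)!]. Since [(2j)! >= 2^j],
    the sum is bounded by [pi * (2k)!] times [1/2 + 1/4 + ... < 1]. *)
Lemma moment_recursion (M : nat -> R) : M 0%N <= pi ->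
  (forall k, (0 < k)%N -> M k <= \sum_(q < k) 'C(k.*2, q.*2)%:R * M q) ->
  forall k, M k <= pi * (k.*2)`!%:R.
Proof.
move=> M0 Mrec; elim/ltn_ind => -[|k] IH; first by rewrite fact0 mulr1.
apply: (le_trans (Mrec _ _)) => //.
have fE q : (q < k.+1)%N -> 'C(k.+1.*2, q.*2)%:R * (pi * (q.*2)`!%:R) =
   pi * (k.+1.*2)`!%:R / ((k.+1 - q).*2)`!%:R :> R.
  move=> qk; have q2 : (q.*2 <= k.+1.*2)%N by rewrite leq_double ltnW.
  rewrite -(bin_fact q2) -doubleB !natrM; move: (pi : R) => p; field.
  by rewrite pnatr_eq0 -lt0n fact_gt0.
apply: (@le_trans _ _ (\sum_(q < k.+1) pi * (k.+1.*2)`!%:R / 2 ^+ (k.+1 - q))).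
  apply: ler_sum => q _.
  apply: (le_trans (ler_wpM2l (ler0n _ _) (IH q (ltn_ord q)))).
  rewrite fE// ler_wpM2l ?mulr_ge0 ?pi_ge0//.
  rewrite lef_pV2 ?posrE ?ltr0n ?fact_gt0// ?exprn_gt0//.
  by rewrite -natrX ler_nat fact_double_ge.
rewrite -mulr_sumr ler_piMr ?mulr_ge0 ?pi_ge0//.
rewrite (reindex_inj rev_ord_inj)/=.
under eq_bigr => i _ do rewrite subKn ?ltn_ord//.
have -> : \sum_(i < k.+1) (2 ^+ i.+1)^-1 = 1 - (2 ^+ k.+1)^-1 :> R.
  elim: k.+1 => [|n IHn]; first by rewrite big_ord0 expr0 invr1 subrr.
  rewrite big_ord_recr/= IHn !exprS; field.
  by rewrite gt_eqF// exprn_gt0.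
by rewrite gerBl invr_ge0 exprn_ge0.
Qed.

End Moments.

(** * Powers of analytic trigonometric polynomials *)

Section TrigPowers.
Context {R : realType}.
Local Notation mu := (@lebesgue_measure R).
Local Notation I := (@I11 R).
Local Open Scope complex_scope.
Implicit Types (h f g F G u v P Q : R -> R) (x t b y : R) (n m N k j q : nat).

Lemma J_dominated (hn : nat -> R -> R) h (M : R) :
  (forall n, measurable_fun I (hn n)) -> measurable_fun I h ->
  (forall n x, I x -> `|hn n x| <= M) ->
  (forall x, I x -> hn n x @[n --> \oo] --> h x) ->
  J (hn n) @[n --> \oo] --> J h.
Proof.
move=> mhn mh hM hcv.
have mI : measurable (I : set (measurableTypeR R)) by exact: measurable_itv.
have mE u : measurable_fun I u -> measurable_fun I (fun x => (u x / w x)%:E).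
  by move=> mu_; apply/measurable_EFinP; apply: measurable_divw.
have iM := @wint_cst R M.
have cv : {ae mu, forall x, I x -> (hn n x / w x)%:E @[n --> \oo] --> (h x / w x)%:E}.
  apply: aeW => x Ix; apply: cvg_EFin; first exact: nearW.
  by apply: cvgM; [exact: hcv|exact: cvg_cst].
have dom : {ae mu, forall x n, I x -> (`|(hn n x / w x)%:E| <= (M / w x)%:E)%E}.
  apply: aeW => x n Ix; rewrite lee_fin normrM normfV (ger0_norm (w_ge0 x)).
  by rewrite ler_wpM2r ?invr_ge0 ?w_ge0// hM.
have [_ _] := dominated_convergence mI (fun n => mE _ (mhn n)) (mE _ mh) cv iM dom.
have wh : wint h.
  apply: (wint_bounded (M := M)) => // x Ix.
  have H : `|hn n x| @[n --> \oo] --> `|h x| by exact: cvg_norm (hcv x Ix).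
  rewrite -(cvg_lim (@norm_hausdorff _ _) H).
  by apply: limr_le; [exact: cvgP H|apply: nearW => n; exact: hM].
rewrite integral_wE// => H.
have /fine_cvgP[_ ] : (J (hn n))%:E @[n --> \oo] --> (J h)%:E.
  apply: cvg_trans H; apply: near_eq_cvg; apply: nearW => n /=.
  by rewrite integral_wE//; exact: (wint_bounded (mhn n) (hM n)).
exact.
Qed.

(** For [x = cos s], [P] and [Q] are the real and imaginary parts of a polynomial in [e^(is)] with
    real coefficients and no constant term. Products keep this form, so all positive powers have
    mean zero. *)
Definition trigpair P Q := exists s : seq (R * nat),
  [/\ all (fun p => 0 < p.2)%N s, (forall x, P x = \sum_(p <- s) p.1 * Cn p.2 x) &
      (forall x, Q x = \sum_(p <- s) p.1 * Sn p.2 x)].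

Lemma trigpair_J0 P Q : trigpair P Q -> J P = 0.
Proof.
move=> [s [s0 PE _]].
rewrite (_ : P = fun x => \sum_(p <- s) p.1 * Cn p.2 x); last exact/funext.
rewrite J_sum; last by move=> p _; exact/wintZ/wint_Cn.
rewrite big_seq big1// => p ps; rewrite JZ; last exact: wint_Cn.
have p2 : (0 < p.2)%N by move/allP : s0; apply.
by rewrite J_Cn ?mulr0.
Qed.

Lemma trigpair_mul P Q P' Q' : trigpair P Q -> trigpair P' Q' ->
  trigpair (fun x => P x * P' x - Q x * Q' x) (fun x => P x * Q' x + Q x * P' x).
Proof.
move=> [s [s0 PE QE]] [s' [s0' PE' QE']].
exists [seq (p.1 * p1.1, (p.2 + p1.2)%N) | p <- s, p1 <- s']; split.
- apply/allP => _ /allpairsP[[p p1] [/= ps qs ->]] /=.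
  by rewrite addn_gt0; move/allP : s0 => /(_ _ ps) ->.
- move=> x; rewrite big_allpairs_dep PE PE' QE QE' !mulr_suml -sumrB.
  apply: eq_bigr => p _; rewrite !mulr_sumr -sumrB; apply: eq_bigr => p1 _ /=.
  by rewrite CnD; ring.
- move=> x; rewrite big_allpairs_dep PE PE' QE QE' !mulr_suml -big_split/=.
  apply: eq_bigr => p _; rewrite !mulr_sumr -big_split/=; apply: eq_bigr => p1 _ /=.
  by rewrite SnD; ring.
Qed.

Lemma trigpair_sum (d : nat -> R) N : d 0%N = 0 ->
  trigpair (fun x => \sum_(n < N) d n * Cn n x) (fun x => \sum_(n < N) d n * Sn n x).
Proof.
move=> d0; exists [seq (d n, n) | n <- iota 0 N & (0 < n)%N]; split.
- by rewrite all_map; apply/allP => n; rewrite mem_filter => /andP[].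
- move=> x; rewrite big_map big_filter -(big_mkord xpredT (fun n => d n * Cn n x)).
  rewrite /index_iota subn0 [RHS]big_mkcond/=; apply: eq_bigr => -[|n]//= _.
  by rewrite d0 mul0r.
- move=> x; rewrite big_map big_filter -(big_mkord xpredT (fun n => d n * Sn n x)).
  rewrite /index_iota subn0 [RHS]big_mkcond/=; apply: eq_bigr => -[|n]//= _.
  by rewrite d0 mul0r.
Qed.

Lemma trigpair_exp P Q m : trigpair P Q ->
  trigpair (fun x => complex.Re ((P x +i* Q x) ^+ m.+1))
           (fun x => complex.Im ((P x +i* Q x) ^+ m.+1)).
Proof.
move=> PQ; elim: m => [//|m IH].
have := trigpair_mul PQ IH.
have -> : (fun x => P x * complex.Re ((P x +i* Q x) ^+ m.+1) -
    Q x * complex.Im ((P x +i* Q x) ^+ m.+1)) =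
    (fun x => complex.Re ((P x +i* Q x) ^+ m.+2)).
  by apply/funext => x; rewrite [in RHS]exprS cReM.
have -> // : (fun x => P x * complex.Im ((P x +i* Q x) ^+ m.+1) +
    Q x * complex.Re ((P x +i* Q x) ^+ m.+1)) =
    (fun x => complex.Im ((P x +i* Q x) ^+ m.+2)).
by apply/funext => x; rewrite [in RHS]exprS cImM.
Qed.

Lemma exp_bound (A B K : R) m : 0 <= K -> `|A| <= K -> `|B| <= K ->
  `|complex.Re ((A +i* B) ^+ m)| <= (2 * K) ^+ m /\
  `|complex.Im ((A +i* B) ^+ m)| <= (2 * K) ^+ m.
Proof.
move=> K0 AK BK; elim: m => [|m [IH1 IH2]]; first by rewrite !expr0 /= normr1 normr0.
have e (a c : R) : `|a| <= (2 * K) ^+ m -> `|c| <= (2 * K) ^+ m ->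
    `|A| * `|a| + `|B| * `|c| <= (2 * K) ^+ m.+1.
  move=> h1 h2; rewrite exprS (_ : 2 * K * _ = K * (2 * K) ^+ m + K * (2 * K) ^+ m); last by ring.
  by rewrite lerD// ler_pM.
rewrite exprS cReM cImM /=; split.
  by apply: (le_trans (ler_normB _ _)); rewrite !normrM; exact: e.
by apply: (le_trans (ler_normD _ _)); rewrite !normrM; exact: e.
Qed.

Lemma cvg_exp (An Bn : nat -> R) (A B : R) m :
  An n @[n --> \oo] --> A -> Bn n @[n --> \oo] --> B ->
  complex.Re ((An n +i* Bn n) ^+ m) @[n --> \oo] --> complex.Re ((A +i* B) ^+ m) /\
  complex.Im ((An n +i* Bn n) ^+ m) @[n --> \oo] --> complex.Im ((A +i* B) ^+ m).
Proof.
move=> hA hB; elim: m => [|m [IH1 IH2]].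
  by rewrite !expr0 /=; split; exact: cvg_cst.
rewrite !exprS !cReM !cImM /=; split.
  rewrite (_ : (fun n => _) = (fun n => An n * complex.Re ((An n +i* Bn n) ^+ m) -
    Bn n * complex.Im ((An n +i* Bn n) ^+ m))).
    by apply: cvgB; apply: cvgM.
  by apply/funext => n; rewrite exprS cReM.
rewrite (_ : (fun n => _) = (fun n => An n * complex.Im ((An n +i* Bn n) ^+ m) +
    Bn n * complex.Re ((An n +i* Bn n) ^+ m))).
  by apply: cvgD; apply: cvgM.
by apply/funext => n; rewrite exprS cImM.
Qed.

Lemma measurable_exp P Q m : measurable_fun I P -> measurable_fun I Q ->
  measurable_fun I (fun x => complex.Re ((P x +i* Q x) ^+ m)) /\
  measurable_fun I (fun x => complex.Im ((P x +i* Q x) ^+ m)).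
Proof.
move=> mP mQ; elim: m => [|m [IH1 IH2]].
  by split; exact: measurable_cst.
split.
  rewrite (_ : (fun x => _) = (fun x => P x * complex.Re ((P x +i* Q x) ^+ m) -
    Q x * complex.Im ((P x +i* Q x) ^+ m))).
    by apply: measurable_funB; apply: measurable_funM.
  by apply/funext => z; rewrite exprS cReM.
rewrite (_ : (fun x => _) = (fun x => P x * complex.Im ((P x +i* Q x) ^+ m) +
    Q x * complex.Re ((P x +i* Q x) ^+ m))).
  by apply: measurable_funD; apply: measurable_funM.
by apply/funext => z; rewrite exprS cImM.
Qed.

(** Dominated convergence carries the zero mean from the polynomials to their bounded pointwise
    limit. *)
Lemma J_Re_exp_eq0 (An Bn : nat -> R -> R) (A B : R -> R) (K : R) m : 0 <= K ->
  (forall n, trigpair (An n) (Bn n)) ->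
  (forall n, measurable_fun I (An n)) -> (forall n, measurable_fun I (Bn n)) ->
  measurable_fun I A -> measurable_fun I B ->
  (forall n x, I x -> `|An n x| <= K) -> (forall n x, I x -> `|Bn n x| <= K) ->
  (forall x, I x -> An n x @[n --> \oo] --> A x) ->
  (forall x, I x -> Bn n x @[n --> \oo] --> B x) ->
  J (fun x => complex.Re ((A x +i* B x) ^+ m.+1)) = 0.
Proof.
move=> K0 tr mAn mBn mA mB AK BK cA cB.
have := @J_dominated (fun n (z : R) => complex.Re ((An n z +i* Bn n z) ^+ m.+1))
  (fun x => complex.Re ((A x +i* B x) ^+ m.+1)) ((2 * K) ^+ m.+1).
have h1 n : measurable_fun I (fun x => complex.Re ((An n x +i* Bn n x) ^+ m.+1)).
  exact: (measurable_exp _ (mAn n) (mBn n)).1.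
have h2 : measurable_fun I (fun x => complex.Re ((A x +i* B x) ^+ m.+1)).
  exact: (measurable_exp _ mA mB).1.
have h3 n x : I x -> `|complex.Re ((An n x +i* Bn n x) ^+ m.+1)| <= (2 * K) ^+ m.+1.
  by move=> Ix; exact: (exp_bound _ K0 (AK n x Ix) (BK n x Ix)).1.
have h4 x : I x -> complex.Re ((An n x +i* Bn n x) ^+ m.+1) @[n --> \oo] -->
    complex.Re ((A x +i* B x) ^+ m.+1).
  by move=> Ix; exact: (cvg_exp _ (cA x Ix) (cB x Ix)).1.
move=> /(_ h1 h2 h3 h4).
have E n : J (fun x => complex.Re ((An n x +i* Bn n x) ^+ m.+1)) = 0.
  exact: trigpair_J0 (trigpair_exp m (tr n)).
rewrite (eq_cvg _ _ E) => H.
by apply/esym; exact: cvg_unique (cvg_cst _) H.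
Qed.

End TrigPowers.

(** * Moments of the Poisson extension and of its boundary values *)

Section MomentBound.
Context {R : realType}.
Local Notation mu := (@lebesgue_measure R).
Local Notation I := (@I11 R).
Local Open Scope complex_scope.
Implicit Types (h f g F G u v P Q : R -> R) (x t b y : R) (n m N k j q : nat).

(** Rests on [w x * w t <= 1 - x * t]. As [Pk] has mass [pi], it yields the bound [|B| <= 1] for the
    extension of [- f]. *)
Lemma Sk_bounds b t x : 0 < b -> I t -> I x -> 0 <= Sk b t x <= Pk b t x.
Proof.
move=> b0 It Ix; have D0 := Dk_gt0 x b0 It.
have wx := w_ge0 x; have wt := w_ge0 t; have wx2 := w_sqr Ix; have wt2 := w_sqr It.
have a1 := aa_gt1 b0.
have ww : w x * w t <= aa b - x * t.
  have := sqr_ge0 (w x - w t); have := sqr_ge0 (x - t); nra.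
rewrite /Sk /Pk divr_ge0/= ?(ltW D0)//; last by rewrite !mulr_ge0// ltW.
by rewrite ler_pM2r ?invr_gt0// -mulrA ler_pM2l.
Qed.

Section fixed_b.
Variables (f G : R -> R) (b : R).
Hypotheses (mf : measurable_fun I f) (f1 : forall x, I x -> `|f x| <= 1).
Hypotheses (wG : wint G) (JG : J G = 0)
  (HfG : forall n, J (fun x => Cn n x * G x) = - J (fun x => Sn n x * f x))
  (b0 : 0 < b) (b1 : b < 1).

Let A t := pi^-1 * J (fun x => Pk b t x * G x).
Let B t := - (pi^-1 * J (fun x => Sk b t x * f x)).
(** By the coefficient relation these are at once the cosine coefficients of [A] and the sine
    coefficients of [B], so [An N] and [Bn N] form a [trigpair]. *)
Let d n := 2 / pi * rr b ^+ n * J (fun x => Cn n x * G x).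
Let An N t := \sum_(n < N) d n * Cn n t.
Let Bn N t := \sum_(n < N) d n * Sn n t.

Let wf : wint f. Proof. exact: wint_bounded mf f1. Qed.

Let d0 : d 0 = 0.
Proof.
rewrite /d HfG (_ : (fun x => _) = (fun=> 0)) ?J0 ?oppr0 ?mulr0//.
by apply/funext => x; rewrite Sn0 mul0r.
Qed.

Let r0 : 0 <= rr b. Proof. exact/ltW/rr_gt0. Qed.
Let r1 : rr b < 1. Proof. exact: rr_lt1. Qed.

Let dle n : `|d n| <= 2 * rr b ^+ n.
Proof.
rewrite /d HfG mulrN normrN normrM.
have wSf : wint (fun x => Sn n x * f x).
  by apply: (wintMl (measurable_Sn n) (M := 1)) => // x _; exact: Sn_le1.
have h : `|J (fun x => Sn n x * f x)| <= pi.
  apply: (le_trans (le_normr_J wSf)); rewrite -J1.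
  apply: le_J; [exact: wint_norm|exact: wint1|].
  by move=> x Ix; rewrite normrM mulr_ile1 ?f1// Sn_le1.
rewrite ger0_norm; last by rewrite mulr_ge0 ?exprn_ge0// divr_ge0// pi_ge0.
have rn : 0 <= 2 / pi * rr b ^+ n by rewrite mulr_ge0 ?exprn_ge0// divr_ge0// pi_ge0.
apply: (le_trans (ler_wpM2l rn h)).
rewrite le_eqVlt; apply/orP; left; apply/eqP.
by have := @pi_neq0 R; move: (pi : R) => p p0; field; exact: p0.
Qed.

(** Sum of the bounds [2 * r^n] on the coefficients. It grows as [b] tends to 0 but enters only
    integrability and dominated convergence, not the moment bound. *)
Let K := 2 / (1 - rr b).

Let K0 : 0 <= K. Proof. by rewrite divr_ge0// subr_ge0 ltW. Qed.

Let sum_le N : \sum_(n < N) 2 * rr b ^+ n <= K.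
Proof.
have r10 : 0 < 1 - rr b by rewrite subr_gt0.
have -> : \sum_(n < N) 2 * rr b ^+ n = K * (1 - rr b ^+ N).
  rewrite /K; elim: N => [|N IH]; first by rewrite big_ord0 expr0 subrr mulr0.
  by rewrite big_ord_recr/= IH exprS; field; rewrite gt_eqF.
by rewrite ler_piMr// gerBl exprn_ge0.
Qed.

Let AnK N x : I x -> `|An N x| <= K.
Proof.
move=> _; apply: (le_trans (ler_norm_sum _ _ _)); apply: le_trans (sum_le N).
apply: ler_sum => i _; rewrite normrM (le_trans _ (dle i))// ler_piMr//.
exact: Cn_le1.
Qed.

Let BnK N x : I x -> `|Bn N x| <= K.
Proof.
move=> _; apply: (le_trans (ler_norm_sum _ _ _)); apply: le_trans (sum_le N).
apply: ler_sum => i _; rewrite normrM (le_trans _ (dle i))// ler_piMr//.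
exact: Sn_le1.
Qed.

Let mAn N : measurable_fun I (An N).
Proof. by apply: measurable_sum => n; apply: measurable_funM => //; exact: measurable_Cn. Qed.

Let mBn N : measurable_fun I (Bn N).
Proof. by apply: measurable_sum => n; apply: measurable_funM => //; exact: measurable_Sn. Qed.

Let cvgA x : I x -> An n x @[n --> \oo] --> A x.
Proof.
move=> Ix; have := sum_CC b0 Ix wG; rewrite J_half_Pk// JG add0r => H.
rewrite (_ : (fun n => _) = (fun N => 2 / pi *
  \sum_(n < N) rr b ^+ n * Cn n x * J (fun x0 => Cn n x0 * G x0))); last first.
  apply/funext => N; rewrite mulr_sumr; apply: eq_bigr => i _.
  by rewrite /d; ring.
rewrite (_ : A x = 2 / pi * (J (fun x0 => Pk b x x0 * G x0) / 2)); last first.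
  by rewrite /A; have := @pi_neq0 R; move: (pi : R) => p p0; field; exact: p0.
by apply: cvgM => //; exact: cvg_cst.
Qed.

Let cvgB' x : I x -> Bn n x @[n --> \oo] --> B x.
Proof.
move=> Ix; have H := sum_SS b0 Ix wf.
rewrite (_ : (fun n => _) = (fun N => - (2 / pi) *
  \sum_(n < N) rr b ^+ n * Sn n x * J (fun x0 => Sn n x0 * f x0))); last first.
  apply/funext => N; rewrite mulr_sumr; apply: eq_bigr => i _.
  by rewrite /d HfG; ring.
have bS y : I y -> `|Sk b x y| <= 3 / ct x / b.
  move=> Iy; have /andP[s0 sP] := Sk_bounds b0 Ix Iy.
  rewrite ger0_norm// (le_trans sP)// (le_trans (ler_norm _))//.
  rewrite (le_trans (Pk_le b0 b1 Ix Iy))// ler_wpM2l ?pk_le_inv//.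
  by rewrite divr_ge0// ltW// ct_gt0.
have -> : B x = - (2 / pi) * J (fun y => Sk b x y / 2 * f y).
  have -> : (fun y => Sk b x y / 2 * f y) = (fun y => 2^-1 * Sk b x y * f y).
    by apply/funext => y; ring.
  rewrite (J_half _ (measurable_Sk b0 Ix) bS wf) /B.
  by have := @pi_neq0 R; move: (pi : R) => p p0; field; exact: p0.
by apply: cvgM => //; exact: cvg_cst.
Qed.

Let mA : measurable_fun I A.
Proof. exact: (measurable_fun_cvg mAn cvgA). Qed.

Let mB : measurable_fun I B.
Proof. exact: (measurable_fun_cvg mBn cvgB'). Qed.

Let B1 x : I x -> `|B x| <= 1.
Proof.
move=> Ix; rewrite /B normrN normrM ger0_norm ?invr_ge0 ?pi_ge0//.
rewrite mulrC ler_pdivrMr ?pi_gt0// mul1r.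
have bS y : I y -> `|Sk b x y| <= 3 / ct x / b.
  move=> Iy; have /andP[s0 sP] := Sk_bounds b0 Ix Iy.
  rewrite ger0_norm// (le_trans sP)// (le_trans (ler_norm _))//.
  rewrite (le_trans (Pk_le b0 b1 Ix Iy))// ler_wpM2l ?pk_le_inv//.
  by rewrite divr_ge0// ltW// ct_gt0.
have wSf : wint (fun y => Sk b x y * f y) := wintMl (measurable_Sk b0 Ix) bS wf.
apply: (le_trans (le_normr_J wSf)); rewrite -(J_Pk b0 Ix).
apply: le_J; [exact: wint_norm|exact: wint_Pk|].
move=> y Iy; have /andP[s0 sP] := Sk_bounds b0 Ix Iy.
by rewrite normrM (ger0_norm s0) (le_trans _ sP)// ler_piMr// f1.
Qed.

Let AK x : I x -> `|A x| <= K.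
Proof.
move=> Ix; have H : `|An n x| @[n --> \oo] --> `|A x| by exact: cvg_norm (cvgA Ix).
rewrite -(cvg_lim (@norm_hausdorff _ _) H); apply: limr_le; first exact: cvgP H.
by apply: nearW => n; exact: AnK.
Qed.

Let wAX n : wint (fun x => A x ^+ n).
Proof.
apply: (wint_bounded (M := K ^+ n)); first exact: measurable_funX.
by move=> x Ix; rewrite normrX; apply: lerXn2r; rewrite ?nnegrE// AK.
Qed.

Lemma moment_Pk k : J (fun t => (pi^-1 * J (fun x => Pk b t x * G x)) ^+ k.*2) <=
  pi * (k.*2)`!%:R.
Proof.
apply: (@moment_recursion _ (fun k => J (fun t => A t ^+ k.*2))).
  by rewrite le_eqVlt; apply/orP; left; apply/eqP; rewrite -[RHS]J1; congr J;
    apply/funext => x; rewrite expr0.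
move=> {}k k0.
have Jz : J (fun x => complex.Re ((A x +i* B x) ^+ k.*2)) = 0.
  have := @J_Re_exp_eq0 R An Bn A B K k.*2.-1 K0 (fun N => trigpair_sum N d0)
    mAn mBn mA mB AnK BnK cvgA cvgB'.
  by rewrite prednK// double_gt0.
have wz : wint (fun x => complex.Re ((A x +i* B x) ^+ k.*2)).
  apply: (wint_bounded (M := (2 * (K + 1)) ^+ k.*2)); first exact: (measurable_exp _ mA mB).1.
  move=> x Ix; apply: (exp_bound _ _ _ _).1.
  - by rewrite addr_ge0.
  - by rewrite (le_trans (AK Ix))// lerDl.
  - by rewrite (le_trans (B1 Ix))// lerDr.
(* The zero becomes the mean of the real part of the power, after which [Re_exp_ge] applies
   pointwise. *)
rewrite -subr_le0 -[leRHS]Jz.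
have wq q : wint (fun x => 'C(k.*2, q.*2)%:R * A x ^+ q.*2) by apply: wintZ.
have -> : \sum_(q < k) 'C(k.*2, q.*2)%:R * J (fun t => A t ^+ q.*2) =
    J (fun x => \sum_(q < k) 'C(k.*2, q.*2)%:R * A x ^+ q.*2).
  by rewrite J_sum => [|q _]; [apply: eq_bigr => q _; rewrite JZ|exact: wq].
have ws : wint (fun x => \sum_(q < k) 'C(k.*2, q.*2)%:R * A x ^+ q.*2).
  by apply: wint_sum => q _; exact: wq.
rewrite -JB//; apply: le_J => //; first exact: wintB.
by move=> x Ix; apply: Re_exp_ge; exact: B1.
Qed.

Lemma measurable_Pk_int : measurable_fun I (fun t => pi^-1 * J (fun x => Pk b t x * G x)).
Proof. exact: mA. Qed.

Lemma wint_Pk_intX n : wint (fun t => (pi^-1 * J (fun x => Pk b t x * G x)) ^+ n).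
Proof. exact: wAX. Qed.

End fixed_b.

(** The bound [moment_Pk] is uniform in [b], and the extensions converge to [G] at its Lebesgue
    points; Fatou's lemma along [b = 1/(n+2)] concludes. *)
Lemma conj_moment f G k : measurable_fun I f -> (forall x, I x -> `|f x| <= 1) ->
  wint G -> J G = 0 ->
  (forall n, J (fun x => Cn n x * G x) = - J (fun x => Sn n x * f x)) ->
  (\int[mu]_(x in I) (G x ^+ k.*2 / w x)%:E <= (pi * (k.*2)`!%:R)%:E)%E.
Proof.
move=> mf f1 wG JG HfG.
pose b n : R := n.+2%:R^-1.
have b0 n : 0 < b n by rewrite invr_gt0.
have b1 n : b n < 1 by rewrite invf_lt1// ltr1n.
have bcv : b n @[n --> \oo] --> (0 : R).
  have := @cvg_harmonic R; rewrite -(cvg_shiftn 1).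
  by under eq_fun do rewrite /= addn1.
pose An n t := pi^-1 * J (fun x => Pk (b n) t x * G x).
have mI : measurable (I : set (measurableTypeR R)) by exact: measurable_itv.
have mG := wint_measurable wG.
have mE u : measurable_fun I u -> measurable_fun I (fun x => (u x ^+ k.*2 / w x)%:E).
  by move=> mu_; apply/measurable_EFinP; apply: measurable_divw; exact: measurable_funX.
have mAn n : measurable_fun I (An n) by exact: (measurable_Pk_int wG JG (b0 n) (b1 n)).
have p0 u x : I x -> (0 <= (u x ^+ k.*2 / w x)%:E)%E.
  by move=> _; rewrite lee_fin divr_ge0 ?w_ge0// -mul2n mulnC exprM sqr_ge0.
have F := fatou mu mI (fun n => mE _ (mAn n)) (fun n x => @p0 (An n) x).
apply: (le_trans (le_trans _ F)).
  apply: ae_ge0_le_integral => //.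
  - by move=> x; exact: p0.
  - exact: mE.
  - by move=> x Ix; apply: limn_einf_ge0 => n; exact: p0.
  - by apply: measurable_fun_limn_einf => n; exact: mE.
  - apply: (ae_imp _ (ae_smallavg (wint_int wG))) => x lG Ix.
    have {}lG : lpt G x := lG Ix.
    rewrite le_eqVlt; apply/orP; left; apply/eqP/esym.
    apply: (cvg_limn_einf_sup _).1.
    apply: cvg_EFin; first exact: nearW.
    apply: cvgM; last exact: cvg_cst.
    have cx : An n x @[n --> \oo] --> G x.
      rewrite (_ : G x = pi^-1 * (pi * G x)); last first.
        by rewrite mulrA mulVf ?mul1r// pi_neq0.
      apply: cvgM; first exact: cvg_cst.
      have /cvg_at_rightP := cvg_J_Pk wG Ix lG; apply; split => //.
    apply: (@continuous_cvg _ _ _ _ _ _ (fun y => y ^+ k.*2)) => //.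
    exact: exprn_continuous.
apply: limn_einf_le => n.
rewrite integral_wE; last exact: (wint_Pk_intX mf f1 wG JG HfG (b0 n) (b1 n)).
by rewrite lee_fin; exact: (moment_Pk mf f1 wG JG HfG (b0 n) (b1 n)).
Qed.

End MomentBound.

(** * The Zygmund space *)

Section Modulus.
Context {R : realType}.
Local Notation mu := (@lebesgue_measure R).
Local Notation I := (@I11 R).
Local Open Scope complex_scope.
Implicit Types (g : R -> R[i]) (x t s l c : R) (n m k j q : nat).

Lemma modulusE (z : R[i]) : modulus z = Num.sqrt (complex.Re z ^+ 2 + complex.Im z ^+ 2).
Proof. by case: z. Qed.

Lemma modulus_ge0 (z : R[i]) : 0 <= modulus z.
Proof. by rewrite modulusE sqrtr_ge0. Qed.

Lemma Re_le_modulus (z : R[i]) : `|complex.Re z| <= modulus z.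
Proof. by rewrite modulusE -sqrtr_sqr ler_wsqrtr// lerDl sqr_ge0. Qed.

Lemma Im_le_modulus (z : R[i]) : `|complex.Im z| <= modulus z.
Proof. by rewrite modulusE -sqrtr_sqr ler_wsqrtr// lerDr sqr_ge0. Qed.

Lemma modulus_le (z : R[i]) : modulus z <= `|complex.Re z| + `|complex.Im z|.
Proof.
rewrite modulusE -(@ler_pXn2r _ 2)// ?nnegrE ?sqrtr_ge0 ?addr_ge0//.
rewrite sqr_sqrtr ?addr_ge0 ?sqr_ge0// sqrrD !real_normK ?num_real//.
by rewrite addrAC lerDl mulrn_wge0// mulr_ge0.
Qed.

Lemma measurable_modulus g : L0 g -> measurable_fun I (fun x => modulus (g x)).
Proof.
move=> [mr mi]; under eq_fun do rewrite modulusE.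
apply: measurableT_comp; first exact: (continuous_measurable_fun (@sqrt_continuous R)).
by apply: measurable_funD; exact: measurable_funX.
Qed.

(** Taken directly from the integral as a supremum over simple functions, so that it applies to
    [rearrangement g] as it stands. *)
Lemma le_integral_ge0 (D : set R) (f1 f2 : R -> \bar R) :
  (forall x, D x -> 0 <= f1 x)%E -> (forall x, D x -> f1 x <= f2 x)%E ->
  (\int[mu]_(x in D) f1 x <= \int[mu]_(x in D) f2 x)%E.
Proof.
move=> f0 f12; rewrite !ge0_integralE//; last first.
  by move=> x Dx; exact: le_trans (f0 x Dx) (f12 x Dx).
apply: ereal_sup_le => _ [h hf <-]; exists h => // x.
apply: (le_trans (hf x)); rewrite !patchE; case: ifPn => // /set_mem Dx; exact: f12.
Qed.

(** The integrand is [w^(-3/2)]. With the fourth root [q] it is the inverse cube of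
    [q (1 - x) * q (1 + x)], one factor being at least 1 according to the sign of [x]; and [4 * q]
    is an antiderivative of [q^(-3)]. *)
Lemma wint_invsqrtw : wint (fun x => (Num.sqrt (@w R x))^-1).
Proof.
apply/integrableP; split.
  apply/measurable_EFinP; apply: measurable_divw.
  apply: open_continuous_measurable_fun; first exact: interval_open.
  move=> x /set_mem Ix; apply: cvgV; first by rewrite sqrtr_eq0 -ltNge w_gt0.
  by apply: continuous_cvg; [exact: sqrt_continuous|exact: continuous_w].
pose q (u : R) : R := Num.sqrt (Num.sqrt u).
pose f x : R := (q (1 - x) ^+ 3)^-1 + (q (1 + x) ^+ 3)^-1.
have q0 (u : R) : 0 < u -> 0 < q u by move=> u0; rewrite !sqrtr_gt0.
have q4 (u : R) : 0 < u -> q u ^+ 4 = u.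
  by move=> u0; rewrite (exprM _ 2 2) !sqr_sqrtr ?sqrtr_ge0// ltW.
have s1 (u : R) : 1 <= u -> 1 <= Num.sqrt u by move=> u1; rewrite -[leLHS]sqrtr1 ler_wsqrtr.
have qle1 (u : R) : 1 <= u -> 1 <= q u by move=> u1; exact/s1/s1.
apply: (@le_lt_trans _ _ (\int[mu]_(x in `](-1)%R, 1%R[) (f x)%:E)%E).
  apply: le_integral_ge0 => // x Ix; have /andP[x1 x2] := (I11E x).1 Ix.
  rewrite lee_fin ger0_norm; last first.
    by rewrite divr_ge0 ?w_ge0// invr_ge0 sqrtr_ge0.
  have u0 : 0 < 1 - x by lra.
  have v0 : 0 < 1 + x by lra.
  have wE : w x = q (1 - x) ^+ 2 * q (1 + x) ^+ 2.
    rewrite /q !sqr_sqrtr ?sqrtr_ge0// -sqrtrM ?(ltW u0)// /w; congr Num.sqrt; ring.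
  have sw : Num.sqrt (w x) = q (1 - x) * q (1 + x).
    by rewrite wE -exprMn sqrtr_sqr gtr0_norm// mulr_gt0 ?q0.
  rewrite sw wE /f.
  have qu := q0 _ u0; have qv := q0 _ v0.
  have [x0|x0] := lerP 0 x.
    have h : 1 <= q (1 + x) by apply: qle1; lra.
    rewrite (_ : _ / _ = (q (1 - x) ^+ 3)^-1 * (q (1 + x) ^+ 3)^-1); last first.
      by field; rewrite !gt_eqF.
    rewrite (@le_trans _ _ ((q (1 - x) ^+ 3)^-1))//; last first.
      by rewrite lerDl invr_ge0 exprn_ge0// ltW.
    rewrite ler_piMr ?invr_ge0 ?exprn_ge0 ?(ltW qu)//.
    by rewrite invf_le1 ?exprn_gt0// exprn_ege1.
  have h : 1 <= q (1 - x) by apply: qle1; lra.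
  rewrite (_ : _ / _ = (q (1 - x) ^+ 3)^-1 * (q (1 + x) ^+ 3)^-1); last first.
    by field; rewrite !gt_eqF.
  rewrite (@le_trans _ _ ((q (1 + x) ^+ 3)^-1))//; last first.
    by rewrite lerDr invr_ge0 exprn_ge0// ltW.
  rewrite ler_piMl ?invr_ge0 ?exprn_ge0 ?(ltW qv)//.
  by rewrite invf_le1 ?exprn_gt0// exprn_ege1.
have qc (u : R) : 0 < u -> {for u, continuous q}.
  move=> u0; apply: (@continuous_comp _ _ _ Num.sqrt Num.sqrt); exact: sqrt_continuous.
have dq (u : R) : 0 < u -> is_derive u 1 q (4 * q u ^+ 3)^-1.
  move=> u0; have su : 0 < Num.sqrt u by rewrite sqrtr_gt0.
  have d1 := is_derive1_sqrt u0; have d2 := is_derive1_sqrt su.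
  apply: (is_derive_eq (@is_derive1_comp R Num.sqrt Num.sqrt u _ _ d2 d1)).
  rewrite -/(q u) (_ : Num.sqrt u = q u ^+ 2); last by rewrite sqr_sqrtr ?sqrtr_ge0.
  by field; rewrite gt_eqF// q0.
have q2 (u : R) : 0 < u < 2 -> `|q u| <= 2.
  move=> /andP[u0 u2]; rewrite gtr0_norm ?q0// -(@ler_pXn2r _ 4)// ?nnegrE ?(ltW (q0 _ u0))//.
  by rewrite q4//; apply: (le_trans (ltW u2)); rewrite -natrX ler_nat.
apply: (@le_lt_trans _ _ (2 * 16)%:E); last exact: ltry.
apply: (@integral_oo_is_derive_le _ f (fun x => 4 * q (1 + x) - 4 * q (1 - x))) => //.
- move=> x /andP[x1 x2]; rewrite addr_ge0// invr_ge0 exprn_ge0// ltW// q0; lra.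
- move=> x /andP[x1 x2].
  have u0 : 0 < 1 - x by lra.
  have v0 : 0 < 1 + x by lra.
  have e1 : is_derive x 1 (fun x => 1 + x) 1 by apply: is_derive_eq; ring.
  have e2 : is_derive x 1 (fun x => 1 - x) (-1) by apply: is_derive_eq; ring.
  have d1 := @is_derive1_comp R q (fun x => 1 + x) x _ _ (dq _ v0) e1.
  have d2 := @is_derive1_comp R q (fun x => 1 - x) x _ _ (dq _ u0) e2.
  have d3 := is_deriveB (is_deriveZ 4 d1) (is_deriveZ 4 d2).
  apply: (is_derive_eq d3); rewrite /GRing.scale /= /f.
  by field; rewrite !gt_eqF ?q0.
- move=> x /andP[x1 x2]; apply: cvgD.
    apply: cvgV; first by rewrite expf_neq0// gt_eqF// q0; lra.
    apply: (@continuous_comp _ _ _ (fun x => q (1 - x)) (fun y => y ^+ 3)); last exact: exprn_continuous.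
    apply: (@continuous_comp _ _ _ (fun x => 1 - x) q); last by apply: qc; lra.
    by apply: cvgB; [exact: cvg_cst|exact: cvg_id].
  apply: cvgV; first by rewrite expf_neq0// gt_eqF// q0; lra.
  apply: (@continuous_comp _ _ _ (fun x => q (1 + x)) (fun y => y ^+ 3)); last exact: exprn_continuous.
  apply: (@continuous_comp _ _ _ (fun x => 1 + x) q); last by apply: qc; lra.
  by apply: cvgD; [exact: cvg_cst|exact: cvg_id].
- move=> x /andP[x1 x2]; rewrite (le_trans (ler_normB _ _))// !normrM (@ger0_norm _ 4)//.
  have h1 : `|q (1 + x)| <= 2 by apply: q2; lra.
  have h2 : `|q (1 - x)| <= 2 by apply: q2; lra.
  lra.
Qed.

(** Pointwise [h^2 / w <= h^6 + w^(-3/2)], by comparing [h^2] with [w^(-1/2)]; this is Young's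
    inequality with exponents 3 and 3/2. *)
Lemma wint_sqr_of_pow6 (h : R -> R) : measurable_fun I h ->
  mu.-integrable I (EFin \o (fun x => h x ^+ 6)) -> wint (fun x => h x ^+ 2).
Proof.
move=> mh ih.
have iD : mu.-integrable I (EFin \o (fun x => h x ^+ 6 + (Num.sqrt (w x))^-1 / w x)).
  exact: (integrableD _ ih wint_invsqrtw).
apply: (@int_le _ _ _ _ _ iD).
  by apply: measurable_divw; exact: measurable_funX.
move=> x Ix; have wx := w_gt0 Ix.
have h6 : h x ^+ 6 = (h x ^+ 2) ^+ 3 by rewrite -exprM.
set b := (w x)^-1; have b0 : 0 < b by rewrite invr_gt0.
have -> : (Num.sqrt (w x))^-1 = Num.sqrt b by rewrite /b sqrtrV// ltW.
set sb := Num.sqrt b; have sb0 : 0 < sb by rewrite sqrtr_gt0.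
have sb2 : b = sb ^+ 2 by rewrite sqr_sqrtr// ltW.
have a0 : 0 <= h x ^+ 2 by exact: sqr_ge0.
rewrite ger0_norm; last by rewrite mulr_ge0// ltW.
rewrite ger0_norm; last first.
  rewrite h6; apply: addr_ge0; first exact: exprn_ge0.
  by apply: mulr_ge0; exact: ltW.
rewrite h6; move: (h x ^+ 2) a0 => a a0.
have [ab|ab] := lerP a sb.
  apply: (@le_trans _ _ (sb * b)); first by rewrite ler_wpM2r// ltW.
  by rewrite lerDr exprn_ge0.
apply: (@le_trans _ _ (a ^+ 3)); last by rewrite lerDl; apply: mulr_ge0; exact: ltW.
rewrite exprS ler_wpM2l// sb2; apply: lerXn2r; rewrite ?nnegrE// ltW//.
Qed.

End Modulus.

(** * Exponential tails from the Zygmund norm *)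

Section Zygmund.
Context {R : realType}.
Local Notation mu := (@lebesgue_measure R).
Local Notation I := (@I11 R).
Implicit Types (g : R -> R[i]) (x t s l c : R) (n m k j q : nat).

Lemma measurable_gt (h : R -> R) l : measurable_fun I h ->
  measurable (I `&` [set x | l < h x]).
Proof.
move=> mh; have := mh measurable_I11 `]l, +oo[%classic (measurable_itv _).
by congr measurable; apply/seteqP; split => x /=; rewrite in_itv/= andbT.
Qed.

Lemma mu_I11 : mu I = 2%:E.
Proof.
rewrite /I11 lebesgue_measure_itv/= lte_fin ifT; last lra.
by rewrite -EFinB; congr EFin; lra.
Qed.

Lemma distribution_fun_le g l l' : L0 g -> l <= l' ->
  (distribution_fun g l' <= distribution_fun g l)%E.
Proof.
move=> /measurable_modulus mg ll; apply: le_measure; rewrite ?inE.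
- exact: measurable_gt.
- exact: measurable_gt.
- by move=> x [Ix h]; split => //=; exact: le_lt_trans h.
Qed.

Lemma distribution_fun_le2 g l : L0 g -> (distribution_fun g l <= 2%:E)%E.
Proof.
move=> /measurable_modulus mg; rewrite -mu_I11; apply: le_measure; rewrite ?inE//.
exact: measurable_gt.
Qed.

Lemma rearrangement_ge0 g s : (0 <= rearrangement g s)%E.
Proof. by apply: le_ereal_inf_tmp => _ [l [l0 _] <-]; rewrite lee_fin. Qed.

Lemma rearrangement_le g s l : 0 <= l -> (distribution_fun g l <= s%:E)%E ->
  (rearrangement g s <= l%:E)%E.
Proof. by move=> l0 gl; apply: ereal_inf_lbound; exists l. Qed.

Lemma rearrangement_nonincr g s t : s <= t -> (rearrangement g t <= rearrangement g s)%E.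
Proof.
move=> st; apply: ereal_inf_le_tmp => _ [l [l0 gl] <-]; exists l => //; split => //.
by rewrite (le_trans gl)// lee_fin.
Qed.

Lemma distribution_le_rearrangement g t l : L0 g ->
  (rearrangement g t < l%:E)%E -> (distribution_fun g l <= t%:E)%E.
Proof.
move=> Lg /ereal_inf_lt[_ [l' [l'0 gl'] <-]]; rewrite lte_fin => ll.
by rewrite (le_trans _ gl')// distribution_fun_le// ltW.
Qed.

Lemma ln2e_ge1 t : 0 < t -> t < 2 -> 1 <= ln (2 * expR 1 / t).
Proof.
move=> t0 t2; rewrite -[leLHS](expRK 1) ler_ln ?posrE ?expR_gt0 ?divr_gt0 ?mulr_gt0 ?expR_gt0//.
by rewrite ler_pdivlMr// mulrC ler_pM2r ?expR_gt0// ltW.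
Qed.

(** The exponent carries a factor 2 so that the tails still sum after multiplication by
    [exp (k + 2)] in [tail_int_pow6]. *)
Lemma Lexp_tail g : Lexp g -> exists c, 0 < c /\
  forall k, (distribution_fun g (c * k.+1%:R) <= (2 * expR (- (2 * k.+1%:R)))%:E)%E.
Proof.
move=> [Lg ng].
have n0 : (0 <= norm_Lexp g)%E.
  have t12 : (1 : R) \in `]0, 2[ by rewrite in_itv/=; lra.
  apply: (@le_trans _ _ ((\int[mu]_(s in `]0%R, 1%R[) rearrangement g s)
                  * ((1 * ln (2 * expR 1 / 1))^-1)%:E)%E).
    apply: mule_ge0; first by apply: integral_ge0 => x _; exact: rearrangement_ge0.
    rewrite lee_fin invr_ge0 mul1r (le_trans ler01)// ln2e_ge1//; lra.
  by apply: ereal_sup_ubound; exists 1.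
set N := fine (norm_Lexp g).
have NE : norm_Lexp g = N%:E by rewrite fineK// ge0_fin_numE.
have N0 : 0 <= N by rewrite -lee_fin -NE.
(* The rearrangement is nonincreasing, so [t] times its value at [t] is at most its integral over
   [(0, t)]. *)
have rle t : 0 < t -> t < 2 -> (rearrangement g t <= (N * ln (2 * expR 1 / t))%:E)%E.
  move=> t0 t2; have L1 := ln2e_ge1 t0 t2; set L := ln _ in L1 *.
  have tL : 0 < t * L by rewrite mulr_gt0// (lt_le_trans ltr01).
  have h1 : (\int[mu]_(s in `]0%R, t[) rearrangement g s * ((t * L)^-1)%:E <= N%:E)%E.
    rewrite -NE; apply: ereal_sup_ubound; exists t => //=.
    by rewrite in_itv/= t0 t2.
  have h2 : (rearrangement g t * t%:E <= \int[mu]_(s in `]0%R, t[) rearrangement g s)%E.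
    have -> : (rearrangement g t * t%:E = \int[mu]_(s in `]0%R, t[) (cst (rearrangement g t)) s)%E.
      have mt : mu `]0, t[%classic = t%:E.
        by rewrite lebesgue_measure_itv/= lte_fin t0 -EFinB subr0.
      rewrite integral_cst; last exact: measurable_itv.
      by congr (_ * _)%E; exact: esym mt.
    apply: le_integral_ge0; first by move=> x _; exact: rearrangement_ge0.
    by move=> s; rewrite /= in_itv/= => /andP[_ /ltW st]; exact: rearrangement_nonincr.
  have h3 : (rearrangement g t * (t%:E * ((t * L)^-1)%:E) <= N%:E)%E.
    rewrite muleA; apply: (le_trans _ h1); apply: lee_wpmul2r => //.
    by rewrite lee_fin invr_ge0 ltW.
  move: h3; rewrite -EFinM invfM mulrA divff ?gt_eqF// mul1r.
  have L0 : 0 < L by rewrite (lt_le_trans ltr01).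
  by rewrite lee_pdivrMr// -EFinM.
(* At [t = 2 e^(-2(k+1))] the logarithm is [1 + 2 (k + 1) <= 3 (k + 1)]; the extra 1 supplies the
   strict inequality of [distribution_le_rearrangement]. *)
exists (3 * N + 1); split; first by lra.
move=> k; apply: distribution_le_rearrangement => //.
have e0 := expR_gt0 (- (2 * k.+1%:R) : R).
have e1 : expR (- (2 * k.+1%:R)) < 1 :> R.
  by rewrite -expR0 ltr_expR oppr_lt0 mulr_gt0.
apply: (le_lt_trans (rle _ _ _)); [by rewrite mulr_gt0|lra|].
rewrite lte_fin.
have -> : 2 * expR 1 / (2 * expR (- (2 * k.+1%:R))) = expR (1 + 2 * k.+1%:R) :> R.
  rewrite expRN expRD; field.
  by rewrite gt_eqF ?expR_gt0.
rewrite expRK; have : 1 <= k.+1%:R :> R by rewrite ler1n.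
move: (k.+1%:R : R) => z z1; nra.
Qed.

End Zygmund.

(** * Integrability of the sixth power from exponential tails *)

Section ExpIntegrability.
Context {R : realType}.
Local Notation mu := (@lebesgue_measure R).
Local Notation I := (@I11 R).
Implicit Types (g : R -> R[i]) (x t s l c : R) (n m k j q : nat).

(** For [y > 1] a single term suffices: if [k + 1] is the largest integer below [y], then
    [exp (k + 2) >= exp y]. *)
Lemma expR_layer (y : R) : 0 <= y ->
  ((expR y)%:E <= (expR 1)%:E + \sum_(k <oo) ((expR k.+2%:R)%:E * (\1_[set z | k.+1%:R < z] y)%:E))%E.
Proof.
move=> y0.
have s0 k : (0 <= (expR k.+2%:R)%:E * (\1_[set z | k.+1%:R < z] y)%:E)%E.
  by rewrite -EFinM lee_fin mulr_ge0 ?expR_ge0// indicE.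
have [y1|y1] := lerP y 1.
  apply: (@le_trans _ _ (expR 1)%:E); first by rewrite lee_fin ler_expR.
  by rewrite leeDl//; apply: nneseries_ge0 => k _ _; exact: s0.
pose k := (Num.truncn y).-1.
have tn := truncn_itv y0.
have [t1 t2] : (Num.truncn y)%:R <= y /\ y < (Num.truncn y).+1%:R by case/andP: tn.
have tpos : (0 < Num.truncn y)%N by rewrite truncn_gt0 ltW.
have [ky|ky] := ltrP k.+1%:R y.
  apply: (@le_trans _ _ (expR k.+2%:R)%:E).
    by rewrite lee_fin ler_expR (le_trans (ltW t2))// ler_nat /k prednK.
  apply: (@le_trans _ _ (\sum_(k <oo) ((expR k.+2%:R)%:E * (\1_[set z | k.+1%:R < z] y)%:E))%E).
    apply: (@le_trans _ _ (\sum_(0 <= i < k.+1) ((expR i.+2%:R)%:E * (\1_[set z | i.+1%:R < z] y)%:E))%E).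
      rewrite big_nat_recr//=.
      rewrite [X in (_ <= _ + X)%E](_ : _ = (expR k.+2%:R)%:E); last first.
        by rewrite indicE mem_set// mule1.
      by rewrite leeDr// sume_ge0.
    by apply: nneseries_lim_ge => i _ _; exact: s0.
  by rewrite leeDr// lee_fin expR_ge0.
(* y is an integer k+1, so the strict inequality fails at k and the term of index k-1 dominates *)
have yE : y = k.+1%:R.
  by apply/eqP; rewrite eq_le ky /k prednK.
case: k ky yE => [|j] ky yE; first by move: y1; rewrite yE ltxx.
apply: (@le_trans _ _ (expR j.+2%:R)%:E); first by rewrite yE.
apply: (@le_trans _ _ (\sum_(k <oo) ((expR k.+2%:R)%:E * (\1_[set z | k.+1%:R < z] y)%:E))%E).
  apply: (@le_trans _ _ (\sum_(0 <= i < j.+1) ((expR i.+2%:R)%:E * (\1_[set z | i.+1%:R < z] y)%:E))%E).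
    rewrite big_nat_recr//=.
    rewrite [X in (_ <= _ + X)%E](_ : _ = (expR j.+2%:R)%:E); last first.
      by rewrite indicE mem_set ?mule1//= yE ltr_nat.
    by rewrite leeDr// sume_ge0.
  by apply: nneseries_lim_ge => i _ _; exact: s0.
by rewrite leeDr// lee_fin expR_ge0.
Qed.

(** For [y = |g| / c] one has [y^6 <= 6! e^y]. In the layers of [e^y] the weight [e^(k+2)] meets the
    tail [2 e^(-2(k+1))], leaving a geometric series of ratio [1/e]. *)
Lemma tail_int_pow6 g c : L0 g -> 0 < c ->
  (forall k, (distribution_fun g (c * k.+1%:R) <= (2 * expR (- (2 * k.+1%:R)))%:E)%E) ->
  mu.-integrable I (EFin \o (fun x => modulus (g x) ^+ 6)).
Proof.
move=> Lg c0 tail; have mg := measurable_modulus Lg.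
pose y x := modulus (g x) / c.
have y0 x : 0 <= y x by rewrite divr_ge0 ?modulus_ge0// ltW.
have my : measurable_fun I y by apply: measurable_funM.
pose E k := I `&` [set x | k.+1%:R < y x].
have mE k : measurable (E k) by exact: measurable_gt.
have mI : measurable (I : set (measurableTypeR R)) by exact: measurable_itv.
have EE k : mu (E k) = distribution_fun g (c * k.+1%:R).
  rewrite /distribution_fun; congr (mu (_ `&` _)); apply/seteqP; split => x /=;
    by rewrite /y ltr_pdivlMr// mulrC.
have m6 : measurable_fun I (fun x => modulus (g x) ^+ 6) by exact: measurable_funX.
apply/integrableP; split; first exact/measurable_EFinP.
pose T := (fun x => (expR (1 : R))%:E + \sum_(k <oo) ((expR (k.+2%:R : R))%:E * (\1_(E k) x)%:E))%E.
pose C : R := c ^+ 6 * 6`!%:R.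
have C0 : 0 <= C by rewrite mulr_ge0// exprn_ge0// ltW.
have s0 k x : (0 <= (expR (k.+2%:R : R))%:E * (\1_(E k) x)%:E)%E.
  by rewrite -EFinM lee_fin mulr_ge0 ?expR_ge0// indicE.
have mi k : measurable_fun I (fun x => (\1_(E k) x : R)%:E).
  by apply/measurable_EFinP; apply: measurable_funTS; exact: measurable_indic.
have ms k : measurable_fun I (fun x => (expR (k.+2%:R : R))%:E * (\1_(E k) x)%:E)%E.
  exact: measurable_funeM.
have mS : measurable_fun I (fun x => \sum_(k <oo) ((expR (k.+2%:R : R))%:E * (\1_(E k) x)%:E))%E.
  exact: (@ge0_emeasurable_sum _ (measurableTypeR R) R I
    (fun k x => ((expR (k.+2%:R : R))%:E * (\1_(E k) x)%:E)%E) xpredT (fun k x _ _ => s0 k x) (fun k _ => ms k)).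
have mT : measurable_fun I T by apply: emeasurable_funD => //; exact: measurable_cst.
have T0 x : I x -> (0 <= T x)%E.
  move=> _; apply: adde_ge0; first by rewrite lee_fin expR_ge0.
  by apply: nneseries_ge0 => k _ _; exact: s0.
apply: (@le_lt_trans _ _ (\int[mu]_(x in I) (C%:E * T x))%E).
  apply: le_integral_ge0 => // x Ix.
  rewrite /= ger0_norm ?exprn_ge0 ?modulus_ge0//.
  apply: (@le_trans _ _ (C%:E * (expR (y x))%:E)%E).
    rewrite -EFinM lee_fin.
    have := expR_ge1Dxn 5 (y0 x) => h.
    have {}h : y x ^+ 6 <= 6`!%:R * expR (y x).
      rewrite -ler_pdivrMl ?ltr0n ?fact_gt0// mulrC (le_trans _ h)// lerDr//.
    have -> : modulus (g x) ^+ 6 = c ^+ 6 * y x ^+ 6.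
      by rewrite -exprMn /y mulrC divfK// gt_eqF.
    by rewrite /C -(mulrA (c ^+ 6)) ler_wpM2l// exprn_ge0// ltW.
  apply: lee_wpmul2l; first by rewrite lee_fin.
  apply: (le_trans (expR_layer (y0 x))).
  rewrite /T leeD2l// lee_nneseries// => k _.
  rewrite lee_wpmul2l ?lee_fin ?expR_ge0// !indicE ler_nat.
  by case: (boolP (y x \in _)) => // /set_mem /= yk; rewrite mem_set.
rewrite ge0_integralZl_EFin//.
rewrite lte_mul_pinfty//.
rewrite /T ge0_integralD//; last by move=> x _; apply: nneseries_ge0 => k _ _; exact: s0.
rewrite lte_add_pinfty//.
  rewrite integral_cst//; have := @mu_I11 R; rewrite /= => ->.
  by rewrite -EFinM ltry.
rewrite integral_nneseries//.
apply: (@le_lt_trans _ _ (\sum_(k <oo) (2 * expR 1 * (expR (-1)) ^+ k.+1)%:E)%E).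
  apply: lee_nneseries => [k _ _|k _].
    by apply: integral_ge0 => x _; exact: s0.
  rewrite ge0_integralZl_EFin ?expR_ge0//; last exact: mi.
  rewrite integral_indic//; last exact: mE.
  have tk : (mu (E k `&` I) <= (2 * expR (- (2 * k.+1%:R)))%:E)%E.
    rewrite (_ : E k `&` I = E k); first by rewrite EE; exact: tail.
    by apply/seteqP; split => [x []//|x Ex]; split => //; case: Ex.
  apply: (le_trans (lee_wpmul2l _ tk)); first by rewrite lee_fin expR_ge0.
  rewrite -EFinM lee_fin -expRM_natl mulrN1 mulrCA -expRD -mulrA -expRD ler_pM2l// ler_expR.
  have -> : k.+2%:R = k.+1%:R + 1 :> R by rewrite natr1.
  by move: (k.+1%:R : R) => z; lra.
apply: (@le_lt_trans _ _ (2 * expR 1 * (1 - expR (-1))^-1)%:E); last exact: ltry.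
have q0 := expR_gt0 (-1 : R).
have q1 : expR (-1) < 1 :> R by rewrite -[ltRHS]expR0 ltr_expR ltrN10.
have e1 := expR_gt0 (1 : R).
apply: lime_le.
  apply: is_cvg_nneseries => k _ _; rewrite lee_fin.
  by rewrite !mulr_ge0 ?exprn_ge0 ?ltW.
apply: nearW => n; rewrite sumEFin lee_fin -mulr_sumr ler_pM2l ?mulr_gt0//.
move: (expR (-1)) q0 q1 => q q0 q1.
have -> : \sum_(0 <= k < n) q ^+ k.+1 = q * (1 - q ^+ n) / (1 - q) :> R.
  elim: n => [|n IH]; first by rewrite big_geq// expr0 subrr mulr0 mul0r.
  by rewrite big_nat_recr//= IH exprS; field; rewrite subr_eq0 gt_eqF.
rewrite ler_piMl ?invr_ge0 ?subr_ge0 ?(ltW q1)//.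
rewrite mulr_ile1 ?subr_ge0 ?exprn_ile1 ?(ltW q0) ?(ltW q1)//.
by rewrite gerBl exprn_ge0// ltW.
Qed.

Lemma Lexp_wint_sqr g : Lexp g ->
  wint (fun x => complex.Re (g x) ^+ 2) /\ wint (fun x => complex.Im (g x) ^+ 2).
Proof.
move=> Lg; have [c [c0 tail]] := Lexp_tail Lg.
have [[mr mi] _] := Lg; have i6 := tail_int_pow6 Lg.1 c0 tail.
split; apply: wint_sqr_of_pow6 => //; apply: (int_le _ _ i6).
- exact: measurable_funX.
- move=> x _; rewrite normrX [leRHS]ger0_norm ?exprn_ge0 ?modulus_ge0//.
  by rewrite lerXn2r ?nnegrE ?modulus_ge0 ?Re_le_modulus.
- exact: measurable_funX.
- move=> x _; rewrite normrX [leRHS]ger0_norm ?exprn_ge0 ?modulus_ge0//.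
  by rewrite lerXn2r ?nnegrE ?modulus_ge0 ?Im_le_modulus.
Qed.

End ExpIntegrability.

(** * From factorial moments to the Zygmund norm *)

Section MomentsZygmund.
Context {R : realType}.
Local Notation mu := (@lebesgue_measure R).
Local Notation I := (@I11 R).
Implicit Types (g : R -> R[i]) (x t s l c K C : R) (n m k j q : nat).

Lemma fact_le_expn n : (n`! <= n ^ n)%N.
Proof.
have h m : (m <= n)%N -> (m`! <= n ^ m)%N.
  elim: m => [//|m IH] mn; rewrite factS expnS leq_mul// IH// ltnW//.
exact: h.
Qed.

(** Markov's inequality for the power [2k] at the level [2 C e k]: as [(2k)! <= (2k)^(2k)], the
    quotient is at most [K e^(-2k)]. *)
Lemma moments_distribution g K C k : L0 g -> 2 <= K -> 0 < C ->
  (\int[mu]_(x in I) (modulus (g x) ^+ k.*2)%:E <= (K * (C ^+ k.*2 * (k.*2)`!%:R))%:E)%E ->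
  (distribution_fun g (2 * C * expR 1 * k%:R) <= (K * expR (- k%:R))%:E)%E.
Proof.
move=> Lg K2 C0 mom; have mg := measurable_modulus Lg.
have K0 : 0 <= K by lra.
have e1 := expR_gt0 (1 : R).
case: k mom => [_|k mom].
  (* At [k = 0] the level is 0 and the distribution may be the full measure 2, hence [2 <= K]. *)
  rewrite mulr0 oppr0 expR0 mulr1; apply: (le_trans (distribution_fun_le2 _ Lg)).
  by rewrite lee_fin.
have k0 : 0 < k.+1%:R :> R by rewrite ltr0n.
move: (k.+1) k0 mom => {}k k0 mom.
set l := 2 * C * expR 1 * k%:R.
have l0 : 0 < l by rewrite !mulr_gt0.
have mI : measurable (I : set (measurableTypeR R)) by exact: measurable_itv.
pose E := I `&` [set x | l < modulus (g x)].
have mE : measurable (E : set (measurableTypeR R)) by exact: measurable_gt.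
have h : ((l ^+ k.*2)%:E * mu E <= (K * (C ^+ k.*2 * (k.*2)`!%:R))%:E)%E.
  apply: (le_trans _ mom).
  apply: (@le_trans _ _ (\int[mu]_(x in E) (modulus (g x) ^+ k.*2)%:E)%E); last first.
    apply: ge0_subset_integral => //.
    - by apply/measurable_EFinP; exact: measurable_funX.
    - by move=> x _; rewrite lee_fin exprn_ge0 ?modulus_ge0.
    - by move=> x [].
  rewrite -(integral_cst mu mE); apply: le_integral_ge0 => x.
    by move=> _; rewrite lee_fin exprn_ge0// ltW.
  by move=> [_ /ltW lg]; rewrite lee_fin lerXn2r ?nnegrE ?modulus_ge0// ltW.
have lk0 : 0 < l ^+ k.*2 by rewrite exprn_gt0.
rewrite -lee_pdivlMl// -EFinM in h.
apply: (le_trans h); rewrite lee_fin.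
rewrite mulrCA ler_wpM2l// mulrC ler_pdivrMr//.
apply: (@le_trans _ _ (C ^+ k.*2 * (2 * k%:R) ^+ k.*2)).
  rewrite ler_pM2l ?exprn_gt0// (le_trans (_ : _ <= (k.*2 ^ k.*2)%:R))//.
    by rewrite ler_nat fact_le_expn.
  by rewrite natrX -mul2n natrM.
have -> : l ^+ k.*2 = expR 1 ^+ k.*2 * (C ^+ k.*2 * (2 * k%:R) ^+ k.*2).
  by rewrite -!exprMn /l; congr (_ ^+ _); ring.
rewrite [leRHS]mulrA ler_peMl ?mulr_ge0 ?exprn_ge0 ?mulr_ge0 ?(ltW C0) ?(ltW k0)//.
rewrite -expRM_natl mulr1 -expRD -[leLHS]expR0 ler_expR.
by rewrite -mul2n natrM; lra.
Qed.

(** With [k] the integer part of [ln (K / s)], the level [c (k + 1)] has distribution at most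
    [K e^(-(k+1)) <= s]. *)
Lemma rearrangement_log g K c s : 2 <= K -> 0 < c -> 0 < s -> s < 2 ->
  (forall k, (distribution_fun g (c * k%:R) <= (K * expR (- k%:R))%:E)%E) ->
  (rearrangement g s <= (c * (ln K + 1 - ln s))%:E)%E.
Proof.
move=> K2 c0 s0 s2 tail; have K0 : 0 < K by lra.
have L0 : 0 <= ln K - ln s by rewrite subr_ge0 ler_ln ?posrE//; lra.
have [k1 k2] := andP (truncn_itv L0); set k := Num.truncn _ in k1 k2.
apply: (@le_trans _ _ (c * k.+1%:R)%:E); last first.
  by rewrite lee_fin ler_pM2l// -natr1; move: k1; move: (k%:R : R) => z; lra.
apply: rearrangement_le; first by rewrite mulr_ge0// ltW.
apply: (le_trans (tail _)); rewrite lee_fin -ler_pdivlMl//.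
rewrite -[leRHS]lnK ?posrE ?mulr_gt0 ?invr_gt0// ler_expR.
rewrite lnM ?posrE ?invr_gt0// lnV ?posrE//; lra.
Qed.

Lemma tail_norm_Lexp g K c : 2 <= K -> 0 < c ->
  (forall k, (distribution_fun g (c * k%:R) <= (K * expR (- k%:R))%:E)%E) ->
  (norm_Lexp g < +oo)%E.
Proof.
move=> K2 c0 tail; have K0 : 0 < K by lra.
have lK : 0 <= ln K by rewrite ln_ge0//; lra.
apply: (@le_lt_trans _ _ (2 * c * (3 + ln K))%:E); last exact: ltry.
apply: ge_ereal_sup => _ [t + <-]; rewrite /= in_itv/= => /andP[t0 t2].
have L1 := ln2e_ge1 t0 t2; set L := ln _ in L1 *.
have Lt : ln t = ln 2 + 1 - L.
  rewrite /L lnM ?posrE ?invr_gt0 ?mulr_gt0 ?expR_gt0// lnV ?posrE//.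
  by rewrite lnM ?posrE ?expR_gt0// expRK; ring.
have l2 : 0 <= ln 2 :> R by rewrite ln_ge0//; lra.
have ltK : ln t <= ln K by rewrite ler_ln ?posrE//; lra.
(* Antiderivative of the majorant [f] below; on [(0, t)] it is bounded by its value at [t], and
   [integral_oo_is_derive_le] costs a factor 2. *)
pose F s := c * (s * (ln K + 2 - ln s)).
pose f s := c * (ln K + 1 - ln s).
have lsK s : 0 < s < t -> ln s <= ln K.
  by move=> /andP[s0 st]; rewrite ler_ln ?posrE//; lra.
have h : (\int[mu]_(s in `](0:R)%R, t[) rearrangement g s <= (2 * (c * (t * (ln K + 2 - ln t))))%:E)%E.
  apply: (@le_trans _ _ (\int[mu]_(s in `](0:R)%R, t[) (f s)%:E)%E).
    apply: le_integral_ge0; first by move=> s _; exact: rearrangement_ge0.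
    move=> s; rewrite /= in_itv/= => /andP[s0 st].
    by apply: rearrangement_log => //; exact: lt_trans st t2.
  apply: (@integral_oo_is_derive_le _ f F) => //.
  - by move=> s st; rewrite mulr_ge0 ?(ltW c0)//; have := lsK _ st; lra.
  - move=> s /andP[s0 st].
    have d1 := is_derive1_ln s0.
    have d2 := is_deriveB (is_derive_cst (ln K + 2) s (1:R)) d1.
    have d3 := is_deriveZ c (is_deriveM (is_derive_id s (1:R)) d2).
    apply: (is_derive_eq d3); rewrite /GRing.scale /= /f.
    rewrite (_ : (cst (ln K + 2) - ln (R:=R)) s = ln K + 2 - ln s)//.
    by move: (ln K) (ln s) => p q; field; rewrite gt_eqF.
  - move=> s /andP[s0 st]; apply: cvgM; first exact: cvg_cst.
    by apply: cvgB; [exact: cvg_cst|exact: continuous_ln].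
  - move=> s st; have ls := lsK _ st; case/andP: st => s0 st.
    rewrite ger0_norm /F; last by rewrite !mulr_ge0 ?(ltW c0) ?(ltW s0)//; lra.
    rewrite ler_pM2l//.
    have h1 : s * (ln t - ln s) <= t - s.
      rewrite -ln_div ?posrE//.
      have h2 : ln (t / s) <= t / s - 1.
        rewrite -[X in ln X](_ : 1 + (t / s - 1) = _); last by ring.
        by apply: le_ln1Dx; rewrite ltrBrDr addNr divr_gt0.
      rewrite -(ler_pM2l s0) in h2; apply: (le_trans h2).
      by rewrite mulrBr mulrCA divff ?gt_eqF// !mulr1.
    have h3 : 0 <= (t - s) * (ln K - ln t) by rewrite mulr_ge0// subr_ge0// ltW.
    by nra.
have tL : 0 < t * L by rewrite mulr_gt0//; lra.
apply: (le_trans (lee_wpmul2r _ h)); first by rewrite lee_fin invr_ge0 ltW.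
rewrite -EFinM lee_fin ler_pdivrMr// Lt.
have h1 : ln K + 2 - (ln 2 + 1 - L) <= (3 + ln K) * L.
  have : 0 <= (L - 1) * ln K by rewrite mulr_ge0//; lra.
  nra.
have -> : 2 * c * (3 + ln K) * (t * L) = 2 * (c * (t * ((3 + ln K) * L))) by ring.
by rewrite !ler_pM2l.
Qed.

Lemma moments_Lexp g K C : L0 g -> 2 <= K -> 0 < C ->
  (forall k, \int[mu]_(x in I) (modulus (g x) ^+ k.*2)%:E <= (K * (C ^+ k.*2 * (k.*2)`!%:R))%:E)%E ->
  Lexp g.
Proof.
move=> Lg K2 C0 mom; split => //.
apply: (@tail_norm_Lexp _ K (2 * C * expR 1)) => //.
  by rewrite !mulr_gt0 ?expR_gt0.
by move=> k; exact: moments_distribution.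
Qed.

End MomentsZygmund.

(** * The range of the finite Hilbert transform *)

Section ConjugatePairs.
Context {R : realType}.
Local Notation mu := (@lebesgue_measure R).
Local Notation I := (@I11 R).
Local Open Scope complex_scope.
Implicit Types (f g F G u v : R -> R) (x t b : R) (n : nat).

Local Notation int u := (mu.-integrable I (EFin \o u)).

(* Writing x = cos s, the relation says that G is the even function conjugate
   to the odd function f. *)
Definition conj_pair f G := [/\ measurable_fun I f, wint (fun x => f x ^+ 2),
  measurable_fun I G, wint (fun x => G x ^+ 2) &
  forall n, J (fun x => Cn n x * G x) = - J (fun x => Sn n x * f x)].

Lemma eq_ae_Rintegral u v : measurable_fun I u -> measurable_fun I v ->
  ae_eq mu I u v -> \int[mu]_(x in I) u x = \int[mu]_(x in I) v x.
Proof.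
move=> mu0 mv uv; congr fine.
have mI : measurable (I : set (measurableTypeR R)) by exact: measurable_itv.
apply: ae_eq_integral => //; first exact/measurable_EFinP.
  exact/measurable_EFinP.
by apply: (ae_imp _ uv) => x /= h Ix; rewrite h.
Qed.

Lemma eq_ae_J u v : measurable_fun I u -> measurable_fun I v ->
  ae_eq mu I u v -> J u = J v.
Proof.
move=> mu0 mv uv; apply: eq_ae_Rintegral; try exact: measurable_divw.
by apply: (ae_imp _ uv) => x /= h Ix; rewrite h.
Qed.

Lemma eq_ae_int u v : measurable_fun I v -> ae_eq mu I u v -> int u -> int v.
Proof.
move=> mv uv iu.
have mI : measurable (I : set (measurableTypeR R)) by exact: measurable_itv.
apply/integrableP; split; first exact/measurable_EFinP.
have [mu0 iu0] := integrableP _ _ _ iu.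
apply: le_lt_trans iu0; rewrite le_eqVlt; apply/orP; left; apply/eqP/ae_eq_integral => //.
- by apply: measurableT_comp => //; exact/measurable_EFinP.
- exact: measurableT_comp.
- by apply: (ae_imp _ uv) => x /= h Ix; rewrite h.
Qed.

Lemma eq_ae_trunc u v b t : 0 < b -> I t -> measurable_fun I v -> int u ->
  ae_eq mu I u v -> trunc b u t = trunc b v t.
Proof.
move=> b0 It mv iu uv; have iv := eq_ae_int mv uv iu.
rewrite -!integral_trk//; apply: eq_ae_Rintegral.
- exact: int_measurable (int_trk t b0 iu).
- exact: int_measurable (int_trk t b0 iv).
- by apply: (ae_imp _ uv) => x /= h Ix; rewrite h.
Qed.

Lemma conj_pair_J f G : conj_pair f G -> J G = 0.
Proof.
move=> [_ _ _ _ /(_ 0%N)]; rewrite (_ : (fun x => Cn 0 x * _) = G); last first.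
  by apply/funext => x; rewrite Cn0 mul1r.
rewrite (_ : (fun x => Sn 0 x * _) = (fun=> 0)) ?J0 ?oppr0//.
by apply/funext => x; rewrite Sn0 mul0r.
Qed.

(** The limit holds at common Lebesgue points of [f] and [G]; the truncated integrals see only the
    class, so any representative [u] of [f] may be inserted. *)
Lemma conj_pair_trunc_sin f G u : conj_pair f G -> measurable_fun I u -> ae_eq mu I f u ->
  {ae mu, forall t, I t -> trunc b u t @[b --> (0 : R)^'+] --> pi * G t}.
Proof.
move=> fG0 mu0 fu; have JG := conj_pair_J fG0; have [mf wf2 mG wG2 fG] := fG0.
have wf := wint_sqr mf wf2; have wG := wint_sqr mG wG2.
apply: (ae_imp2 _ (ae_smallavg (wint_int wf)) (ae_smallavg (wint_int wG))) => t hf hG It.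
apply: cvg_trans (cvg_trunc_sin wf wG JG fG It (hf It) (hG It)).
apply: near_eq_cvg; near=> b.
by apply: eq_ae_trunc => //; exact: wint_int.
Unshelve. all: by end_near. Qed.

Lemma conj_pair_trunc_cos f G u : conj_pair f G -> measurable_fun I u -> ae_eq mu I G u ->
  {ae mu, forall t, I t ->
    trunc b (fun x => u x / w x) t @[b --> (0 : R)^'+] --> - (pi * f t / w t)}.
Proof.
move=> [mf wf2 mG wG2 fG] mu0 Gu.
have wf := wint_sqr mf wf2; have wG := wint_sqr mG wG2.
have Gf n : (0 < n)%N -> J (fun x => Sn n x * f x) = - J (fun x => Cn n x * G x).
  by move=> _; rewrite fG opprK.
apply: (ae_imp2 _ (ae_smallavg wG) (ae_smallavg (wint_int wf))) => t hG hf It.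
apply: cvg_trans (cvg_trunc_cos wG wf Gf It (hG It) (hf It)).
apply: near_eq_cvg; near=> b.
apply: eq_ae_trunc => //; first exact: measurable_divw.
by apply: (ae_imp _ Gu) => x /= h Ix; rewrite h.
Unshelve. all: by end_near. Qed.

Lemma exists_conj_pair_sin f : measurable_fun I f -> wint (fun x => f x ^+ 2) ->
  exists G, conj_pair f G.
Proof. by move=> mf wf; have [G [mG wG _ fG]] := exists_conj_sin mf wf; exists G. Qed.

Lemma exists_conj_pair_cos G : measurable_fun I G -> wint (fun x => G x ^+ 2) -> J G = 0 ->
  exists f, conj_pair f G.
Proof.
move=> mG wG JG; have [f [mf wf Gf]] := exists_conj_cos mG wG.
exists f; split => // -[|n]; last by rewrite Gf// opprK.
rewrite (_ : (fun x => Cn 0 x * _) = G); last by apply/funext => x; rewrite Cn0 mul1r.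
rewrite (_ : (fun x => Sn 0 x * _) = (fun=> 0)) ?J0 ?oppr0//.
by apply/funext => x; rewrite Sn0 mul0r.
Qed.

Lemma conj_pairZ (c : R) f G : conj_pair f G ->
  conj_pair (fun x => c * f x) (fun x => c * G x).
Proof.
move=> [mf wf mG wG fG]; split.
- exact: measurable_funM.
- by apply: eq_wint (wintZ (c ^+ 2) wf) => x _; rewrite exprMn.
- exact: measurable_funM.
- by apply: eq_wint (wintZ (c ^+ 2) wG) => x _; rewrite exprMn.
move=> n.
have h (k u : R -> R) : measurable_fun I k -> (forall x, I x -> `|k x| <= 1) ->
    measurable_fun I u -> wint (fun x => u x ^+ 2) ->
    J (fun x => k x * (c * u x)) = c * J (fun x => k x * u x).
  move=> mk k1 mu0 wu; rewrite -JZ; last exact: wintMl mk k1 (wint_sqr mu0 wu).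
  by congr J; apply/funext => x; ring.
rewrite !h ?fG ?mulrN//; try exact: measurable_Cn; try exact: measurable_Sn.
  by move=> x _; exact: Sn_le1.
by move=> x _; exact: Cn_le1.
Qed.

(** Scaling by [1 / M] reduces to [conj_moment], and [1 / w >= 1] allows the weight to be
    dropped. *)
Lemma conj_pair_moment f G (M : R) k : conj_pair f G -> 0 < M -> (forall x, I x -> `|f x| <= M) ->
  (\int[mu]_(x in I) (G x ^+ k.*2)%:E <= (pi * (M ^+ k.*2 * (k.*2)`!%:R))%:E)%E.
Proof.
move=> fG M0 fM; have fG' := conj_pairZ M^-1 fG; have JG' := conj_pair_J fG'.
have [mf' wf' mG' wG' h] := fG'.
have f1 x : I x -> `|M^-1 * f x| <= 1.
  by move=> Ix; rewrite normrM gtr0_norm ?invr_gt0// ler_pdivrMl// mulr1 fM.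
have mom := conj_moment k mf' f1 (wint_sqr mG' wG') JG' h.
have Mk0 : 0 < M ^+ k.*2 by rewrite exprn_gt0.
have even0 (y : R) : 0 <= y ^+ k.*2 by rewrite exprn_even_ge0// odd_double.
have [_ _ mG _ _] := fG.
apply: (@le_trans _ _ (\int[mu]_(x in I) ((M ^+ k.*2)%:E * ((M^-1 * G x) ^+ k.*2 / w x)%:E))%E).
  apply: le_integral_ge0 => x Ix; first by rewrite lee_fin.
  rewrite -EFinM lee_fin exprMn exprVn !mulrA divff ?gt_eqF// mul1r.
  by rewrite ler_peMr// invf_ge1 ?w_gt0 ?w_le1.
have mI : measurable (I : set (measurableTypeR R)) by exact: measurable_itv.
rewrite ge0_integralZl_EFin ?(ltW Mk0)//; last 2 first.
- by move=> x Ix; rewrite lee_fin divr_ge0 ?w_ge0.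
- by apply/measurable_EFinP; apply: measurable_divw; exact: measurable_funX.
apply: (le_trans (lee_wpmul2l _ mom)); first by rewrite lee_fin ltW.
by rewrite -EFinM lee_fin mulrCA.
Qed.

End ConjugatePairs.

(** * Complex-valued functions and the two inclusions *)

Section ComplexTransform.
Context {R : realType}.
Local Notation mu := (@lebesgue_measure R).
Local Notation I := (@I11 R).
Local Open Scope complex_scope.
Implicit Types (f g : R -> R[i]) (x t b : R) (k n : nat).

Lemma Re_divC (z : R[i]) (r : R) : complex.Re (z / r%:C) = complex.Re z / r.
Proof. by case: z => p q; rewrite -fmorphV /= mulr0 subr0. Qed.

Lemma Im_divC (z : R[i]) (r : R) : complex.Im (z / r%:C) = complex.Im z / r.
Proof. by case: z => p q; rewrite -fmorphV /= mulr0 add0r. Qed.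

Lemma real_complex_mul (r p q : R) : r%:C * (p +i* q) = (r * p) +i* (r * q).
Proof. by apply/eqP; rewrite eq_complex /= !mul0r subr0 addr0 !eqxx. Qed.

Lemma cvg_complex (T : Type) (F : set_system T) {FF : Filter F} (u v : T -> R) (p q : R) :
  u x @[x --> F] --> p -> v x @[x --> F] --> q ->
  ((u x +i* v x : R[i]^o) @[x --> F] --> (p +i* q : R[i]^o)).
Proof.
move=> up vq; apply/cvgrPdist_lt => z; rewrite ltcE /= => /andP[z0 e0].
(* A positive element in the order of [R[i]] has zero imaginary part, so the radius is real. *)
have -> : z = (complex.Re z)%:C by move: z0; case: (z) => p' q' /= /eqP ->.
move: (complex.Re z) e0 => e e0.
have e20 : 0 < e / 2 by rewrite divr_gt0.
near=> x.
have h1 : `|p - u x| < e / 2 by near: x; exact: (cvgrPdist_lt _ _).1 up _ e20.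
have h2 : `|q - v x| < e / 2 by near: x; exact: (cvgrPdist_lt _ _).1 vq _ e20.
have -> : `|(p +i* q : R[i]^o) - (u x +i* v x)| = (modulus ((p - u x) +i* (q - v x)))%:C.
  by rewrite normc_def modulusE.
rewrite ltcR (le_lt_trans (modulus_le _))//=; lra.
Unshelve. all: by end_near. Qed.

Lemma T_of_trunc f (p q t : R) :
  trunc b (fun x => complex.Re (f x)) t @[b --> (0 : R)^'+] --> pi * p ->
  trunc b (fun x => complex.Im (f x)) t @[b --> (0 : R)^'+] --> pi * q ->
  T f t = p +i* q.
Proof.
move=> hp hq; apply: (@cvg_lim (R[i]^o : topologicalType)); first exact: (@norm_hausdorff R[i] (R[i]^o)).
have E : (fun b => (pi^-1)%:C * (cintegral `]-1, t - b[ (fun x => f x / (x - t)%:C)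
                  + cintegral `]t + b, 1[ (fun x => f x / (x - t)%:C)) : R[i]^o) =
  (fun b => (pi^-1 * trunc b (fun x => complex.Re (f x)) t) +i*
            (pi^-1 * trunc b (fun x => complex.Im (f x)) t) : R[i]^o).
  apply/funext => b; rewrite /cintegral /trunc -real_complex_mul; congr (_ * _).
  under eq_Rintegral do rewrite Re_divC.
  under [X in _ +i* X + _]eq_Rintegral do rewrite Im_divC.
  under [X in _ + (X +i* _)]eq_Rintegral do rewrite Re_divC.
  by under [X in _ + (_ +i* X)]eq_Rintegral do rewrite Im_divC.
rewrite E; apply: cvg_complex.
  rewrite -[X in _ --> X](mulKf (@pi_neq0 R) p); apply: cvgM => //; exact: cvg_cst.
by rewrite -[X in _ --> X](mulKf (@pi_neq0 R) q); apply: cvgM => //; exact: cvg_cst.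
Qed.

Lemma Tcheck_of_trunc g (p q t : R) : I t ->
  trunc b (fun x => complex.Re (g x) / w x) t @[b --> (0 : R)^'+] --> - (pi * p / w t) ->
  trunc b (fun x => complex.Im (g x) / w x) t @[b --> (0 : R)^'+] --> - (pi * q / w t) ->
  Tcheck g t = p +i* q.
Proof.
move=> It hp hq; have wt := w_neq0 It.
have hT : T (divw g) t = (- (p / w t)) +i* (- (q / w t)).
  apply: T_of_trunc.
    by rewrite /divw; under eq_fun do under eq_fun do rewrite Re_divC; rewrite mulrN mulrA.
  by rewrite /divw; under eq_fun do under eq_fun do rewrite Im_divC; rewrite mulrN mulrA.
rewrite /Tcheck hT real_complex_mul !mulrN ![w t * _]mulrC !divfK//.
by apply/eqP; rewrite eq_complex /= !opprK !eqxx.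
Qed.

Lemma phi_invwE g :
  phi_invw g = J (fun x => complex.Re (g x)) +i* J (fun x => complex.Im (g x)).
Proof.
rewrite /phi_invw /cintegral /J /divw; under eq_Rintegral do rewrite Re_divC.
by under [X in _ +i* X]eq_Rintegral do rewrite Im_divC.
Qed.

(** Clipping both parts at [M] gives representatives bounded everywhere, with [M > 0] so that one
    may divide by it. *)
Lemma Linfty_repr f : Linfty f -> exists (M : R) (f1 f2 : R -> R), [/\ 0 < M,
  measurable_fun I f1 /\ measurable_fun I f2,
  forall x : R, `|f1 x| <= M, forall x : R, `|f2 x| <= M &
  eq_ae f (fun x => f1 x +i* f2 x)].
Proof.
move=> [[m1 m2] fin].
have [M M0 hM] : exists2 M : R, 0 < M &
    {ae mu, forall x, (((fun x => (modulus (f x))%:E) \_ I) x <= M%:E)%E}.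
  case E : (ess_sup _ _) fin => [r| |] // _.
    exists (Num.max 1 r); first by rewrite lt_max ltr01.
    by apply/ess_supP; rewrite E lee_fin le_max lexx orbT.
  by exists 1 => //; apply/ess_supP; rewrite E leNye.
pose clip (y : R) := Num.max (- M) (Num.min M y).
have clipM y : `|clip y| <= M.
  by rewrite ler_norml /clip le_max lexx/= ge_max ge_min lexx andbT; lra.
have clipE y : `|y| <= M -> clip y = y.
  by rewrite ler_norml => /andP[h1 h2]; rewrite /clip (min_r h2) (max_r h1).
have mclip (u : R -> R) : measurable_fun I u -> measurable_fun I (clip \o u).
  move=> mu0; apply: measurable_maxr; first exact: measurable_cst.
  by apply: measurable_minr => //; exact: measurable_cst.
exists M, (fun x => clip (complex.Re (f x))), (fun x => clip (complex.Im (f x))); split => //.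
  by split; exact: mclip.
apply: (ae_imp _ hM) => x /= + Ix; rewrite patchE mem_set// lee_fin => fM.
rewrite !clipE ?(le_trans (Re_le_modulus _))// ?(le_trans (Im_le_modulus _))//.
by case: (f x).
Qed.

Lemma eq_ae_Re f g : eq_ae f g ->
  ae_eq mu I (fun x => complex.Re (f x)) (fun x => complex.Re (g x)).
Proof. by apply: ae_imp => x /= h Ix; rewrite h. Qed.

Lemma eq_ae_Im f g : eq_ae f g ->
  ae_eq mu I (fun x => complex.Im (f x)) (fun x => complex.Im (g x)).
Proof. by apply: ae_imp => x /= h Ix; rewrite h. Qed.

Lemma eq_ae_sym f g : eq_ae f g -> eq_ae g f.
Proof. by apply: ae_imp => x /= h Ix; rewrite h. Qed.

Lemma eq_ae_trans f g h : eq_ae f g -> eq_ae g h -> eq_ae f h.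
Proof. by apply: ae_imp2 => x /= h1 h2 Ix; rewrite h1// h2. Qed.

Lemma conj_pair_T (f1 f2 G1 G2 : R -> R) f : conj_pair f1 G1 -> conj_pair f2 G2 -> L0 f ->
  eq_ae (fun x => f1 x +i* f2 x) f -> eq_ae (T f) (fun x => G1 x +i* G2 x).
Proof.
move=> c1 c2 [m1 m2] ff.
have h1 := conj_pair_trunc_sin c1 m1 (eq_ae_Re ff).
have h2 := conj_pair_trunc_sin c2 m2 (eq_ae_Im ff).
by apply: (ae_imp2 _ h1 h2) => t /= k1 k2 It; apply: T_of_trunc; [exact: k1|exact: k2].
Qed.

Lemma conj_pair_Tcheck (f1 f2 G1 G2 : R -> R) g : conj_pair f1 G1 -> conj_pair f2 G2 -> L0 g ->
  eq_ae (fun x => G1 x +i* G2 x) g -> eq_ae (Tcheck g) (fun x => f1 x +i* f2 x).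
Proof.
move=> c1 c2 [m1 m2] gG.
have h1 := conj_pair_trunc_cos c1 m1 (eq_ae_Re gG).
have h2 := conj_pair_trunc_cos c2 m2 (eq_ae_Im gG).
by apply: (ae_imp2 _ h1 h2) => t /= k1 k2 It; apply: Tcheck_of_trunc => //; [exact: k1|exact: k2].
Qed.

Lemma conj_pair_Lexp (f1 f2 G1 G2 : R -> R) g (M : R) : 0 < M ->
  conj_pair f1 G1 -> conj_pair f2 G2 ->
  (forall x, `|f1 x| <= M) -> (forall x, `|f2 x| <= M) -> L0 g ->
  eq_ae (fun x => G1 x +i* G2 x) g -> Lexp g.
Proof.
move=> M0 c1 c2 f1M f2M Lg gG; have [m1 m2] := Lg.
(* The modulus is at most twice the larger part in absolute value: [2^(2k)] is absorbed into
   [C = 2 M], and the moments of the two parts add up to [K = 2 pi]. *)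
apply: (@moments_Lexp _ _ (2 * pi) (2 * M)) => //; [|by rewrite mulr_gt0|].
  by have := @pi_ge2 R; lra.
move=> k.
have mI : measurable (I : set (measurableTypeR R)) by exact: measurable_itv.
have even0 (y : R) : 0 <= y ^+ k.*2 by rewrite exprn_even_ge0// odd_double.
have norm2k (y : R) : `|y| ^+ k.*2 = y ^+ k.*2.
  by rewrite -normrX ger0_norm.
have mom (u G : R -> R) : ae_eq mu I G u -> measurable_fun I G -> measurable_fun I u ->
    (\int[mu]_(x in I) (G x ^+ k.*2)%:E <= (pi * (M ^+ k.*2 * (k.*2)`!%:R))%:E)%E ->
    (\int[mu]_(x in I) (u x ^+ k.*2)%:E <= (pi * (M ^+ k.*2 * (k.*2)`!%:R))%:E)%E.
  move=> Gu mG mu0; apply: le_trans; rewrite le_eqVlt; apply/orP; left; apply/eqP.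
  apply: ae_eq_integral => //.
  - by apply/measurable_EFinP; exact: measurable_funX.
  - by apply/measurable_EFinP; exact: measurable_funX.
  - by apply: (ae_imp _ Gu) => x /= h Ix; rewrite h.
have [_ _ mG1 _ _] := c1; have [_ _ mG2 _ _] := c2.
have h1 := mom _ _ (eq_ae_Re gG) mG1 m1 (conj_pair_moment k c1 M0 (fun x _ => f1M x)).
have h2 := mom _ _ (eq_ae_Im gG) mG2 m2 (conj_pair_moment k c2 M0 (fun x _ => f2M x)).
have q0 : 0 <= (2 : R) ^+ k.*2 by exact: exprn_ge0.
apply: (@le_trans _ _ (\int[mu]_(x in I) ((2 ^+ k.*2)%:E *
    ((complex.Re (g x) ^+ k.*2)%:E + (complex.Im (g x) ^+ k.*2)%:E)))%E).
  apply: le_integral_ge0 => x Ix; first by rewrite lee_fin exprn_ge0// modulus_ge0.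
  rewrite -EFinD -EFinM lee_fin.
  set p := complex.Re _; set q := complex.Im _.
  apply: (@le_trans _ _ ((2 * Num.max `|p| `|q|) ^+ k.*2)).
    apply: lerXn2r; first by rewrite nnegrE modulus_ge0.
      by rewrite nnegrE; apply: mulr_ge0 => //; rewrite le_max normr_ge0.
    apply: (le_trans (modulus_le _)); rewrite mulr2n mulrDl !mul1r.
    by apply: lerD; rewrite le_max lexx ?orbT.
  rewrite exprMn ler_wpM2l//.
  have [_|_] := leP `|p| `|q|; rewrite norm2k.
    by rewrite lerDr.
  by rewrite lerDl.
have mp u : measurable_fun I (u : R -> R) ->
    measurable_fun I (fun x => (u x ^+ k.*2)%:E).
  by move=> mu0; apply/measurable_EFinP; exact: measurable_funX.
rewrite ge0_integralZl_EFin//; last 2 first.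
- by move=> x _; rewrite -EFinD lee_fin addr_ge0.
- by apply: emeasurable_funD; exact: mp.
rewrite ge0_integralD//; last 4 first.
- by move=> x _; rewrite lee_fin.
- exact: mp.
- by move=> x _; rewrite lee_fin.
- exact: mp.
apply: (le_trans (lee_wpmul2l _ (leeD h1 h2))); first by rewrite lee_fin.
rewrite -EFinD -EFinM lee_fin exprMn le_eqVlt; apply/orP; left; apply/eqP; ring.
Qed.

(** The partners of the two parts of [f] are constructed first and then identified with those of
    [T f], that is of [g]; all three conclusions are read off the conjugate pairs. *)
Lemma range_T_necessary g : range_T g ->
  [/\ Lexp g, phi_invw g = 0 & class_in (Tcheck g) Linfty].
Proof.
move=> [Lg [f Lf gT]].
have [M [f1 [f2 [M0 [m1 m2] f1M f2M ff]]]] := Linfty_repr Lf.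
have wsq (u : R -> R) : measurable_fun I u -> (forall x, `|u x| <= M) -> wint (fun x => u x ^+ 2).
  move=> mu0 uM; apply: (@wint_bounded _ _ (M ^+ 2)); first exact: measurable_funX.
  by move=> x _; rewrite normrX lerXn2r ?nnegrE// ltW.
have [G1 c1] := exists_conj_pair_sin m1 (wsq _ m1 f1M).
have [G2 c2] := exists_conj_pair_sin m2 (wsq _ m2 f2M).
have TG := conj_pair_T c1 c2 Lf.1 (eq_ae_sym ff).
have Gg := eq_ae_sym (eq_ae_trans gT TG).
have [[mg1 mg2] [_ _ mG1 _ _] [_ _ mG2 _ _]] := And3 Lg c1 c2.
split.
- exact: conj_pair_Lexp M0 c1 c2 f1M f2M Lg Gg.
- rewrite phi_invwE -(eq_ae_J mG1 mg1 (eq_ae_Re Gg)) -(eq_ae_J mG2 mg2 (eq_ae_Im Gg)).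
  by rewrite (conj_pair_J c1) (conj_pair_J c2).
- exists f => //; apply: eq_ae_trans (eq_ae_sym ff).
  exact: conj_pair_Tcheck c1 c2 Lg Gg.
Qed.

(** The partners of the two parts of [g] are at first only square integrable. They form [Tcheck g]
    almost everywhere, hence agree with its bounded representative [k], and then [T k] is [g]. *)
Lemma range_T_sufficient g : Lexp g -> phi_invw g = 0 -> class_in (Tcheck g) Linfty ->
  range_T g.
Proof.
move=> Lg phi0 [k Lk Tk]; have [w1 w2] := Lexp_wint_sqr Lg; have [[m1 m2] _] := Lg.
move: phi0; rewrite phi_invwE => -[J1 J2].
have [f1 c1] := exists_conj_pair_cos m1 w1 J1.
have [f2 c2] := exists_conj_pair_cos m2 w2 J2.
have gE : (fun x => complex.Re (g x) +i* complex.Im (g x)) = g.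
  by apply/funext => x; case: (g x).
split; first exact: Lg.1.
exists k => //; apply: eq_ae_sym; rewrite -gE; apply: (conj_pair_T c1 c2 Lk.1).
apply: eq_ae_trans Tk; apply: eq_ae_sym; apply: (conj_pair_Tcheck c1 c2 Lg.1).
by rewrite gE; exact: aeW.
Qed.

(** [Q_Lexp g] is constant on [I]; a nonzero constant vanishing almost everywhere would make [I] a
    null set. *)
Lemma Ker_Q_phi : @Ker_Q R = @Ker_phi R.
Proof.
apply/seteqP; split => g [Lg h]; split => //; last first.
  by apply: aeW => x Ix; rewrite /Q_Lexp h mulr0 mul0r.
apply/eqP; apply: contraT => phi0.
have : mu I = 0.
  have mI : measurable (I : set (measurableTypeR R)) by exact: measurable_itv.
  case: h => N [mN N0 hN]; apply: (subset_measure0 mI mN _ N0).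
  move=> x Ix; apply: hN => /= /(_ Ix) /eqP; apply/negP.
  rewrite /Q_Lexp indicE mem_set// mulr1 mulf_neq0//.
  by rewrite eq_complex /= eqxx andbT invr_eq0 pi_neq0.
by rewrite mu_I11 => -[] /eqP; rewrite pnatr_eq0.
Qed.

End ComplexTransform.

Local Open Scope complex_scope.

Theorem corollary5p2 (R : realType) :
  (forall g : R -> R[i], Lexp g ->
     (range_T g <->
      class_in (Tcheck g) Linfty /\ cintegral I11 (fun x => g x / (w x)%:C) = 0))
  /\ (@range_T R = [set g | Ker_phi g /\ class_in (Tcheck g) Linfty])
  /\ (@range_T R = [set g | Ker_Q g /\ class_in (Tcheck g) Linfty]).
Proof.
have E : @range_T R = [set g | Ker_phi g /\ class_in (Tcheck g) Linfty].
  apply/seteqP; split => g.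
    by move=> /range_T_necessary [Lg g0 Tg].
  by move=> [[Lg g0] Tg]; exact: range_T_sufficient.
split; last by rewrite Ker_Q_phi.
move=> g Lg; split.
  by move=> /range_T_necessary [].
by move=> [Tg g0]; exact: range_T_sufficient.
Qed.
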